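(* Let $(\mathfrak v,\langle\,,\,\rangle_{\mathfrak v})$ be a real vector space with an inner product, and let $\rho,\rho':\mathfrak v\to\mathfrak{so}(\mathfrak v)$ be injective linear maps satisfying $\rho(u)v+\rho(v)u=0$ and $\rho'(u)v+\rho'(v)u=0$ for all $u,v\in\mathfrak v$. Let $N$ and $N'$ be the simply connected 2-step nilpotent Lie groups (of corank zero and of the same dimension) with Lie algebras $\mathfrak n(\mathfrak v,\rho)$ and $\mathfrak n(\mathfrak v,\rho')$ respectively, endowed with the bi-invariant pseudo-Riemannian metrics determined by the canonical hyperbolic ad-invariant metrics of these Lie algebras. Then $N$ and $N'$ are isometric.
   Context: All Lie algebras are real and finite dimensional. $\mathfrak{so}(\mathfrak v)$ denotes the skew-symmetric endomorphisms of $(\mathfrak v,\langle\,,\,\rangle_{\mathfrak v})$. The Lie algebra $\mathfrak n(\mathfrak v,\rho)$ is the vector space $\mathfrak v^*\oplus\mathfrak v$ with the canonical hyperbolic metric $\langle z_1+v_1,z_2+v_2\rangle=z_1(v_2)+z_2(v_1)$ ($z_i\in\mathfrak v^*$, $v_i\in\mathfrak v$) and with Lie bracket given by $[\mathfrak v^*,\mathfrak n(\mathfrak v,\rho)]=0$, $[\mathfrak v,\mathfrak v]\subset\mathfrak v^*$ and $\langle[u,v],w\rangle=\langle\rho(w)u,v\rangle_{\mathfrak v}$ for $u,v,w\in\mathfrak v$. The metric is ad-invariant, i.e. $\langle [x,y],z\rangle+\langle y,[x,z]\rangle=0$ for all $x,y,z$, so translating it over the group by left translations gives a bi-invariant metric.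 Corank zero means the center equals the commutator. Isometric means that there is a diffeomorphism preserving the pseudo-Riemannian metrics (not required to be a group homomorphism). *)

(* Defs.v *)
From HB Require Import structures.
From mathcomp Require Import all_boot all_order all_algebra.
From mathcomp Require Import sesquilinear.
From mathcomp Require Import all_classical all_reals all_analysis.

Set Implicit Arguments.
Unset Strict Implicit.
Unset Printing Implicit Defensive.

Import Order.TTheory GRing.Theory Num.Theory.
Import numFieldNormedType.Exports.

Local Open Scope classical_set_scope.
Local Open Scope ring_scope.

(* For D open in a finite-dimensional space: all iterated directional
   derivatives of order at most k exist and are continuous on D. *)
Fixpoint Ck_on (R : realType) (V W : normedModType R) (k : nat) (D : set V)
    (f : V -> W) : Prop :=
  (forall x, D x -> {for x, continuous f}) /\
  match k with
  | 0 => True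
  | k'.+1 => (forall x v, D x -> derivable f x v) /\
             (forall v, Ck_on k' D (fun x => 'D_v f x))
  end.

Definition smooth_on (R : realType) (V W : normedModType R) (D : set V)
  (f : V -> W) : Prop := forall k, Ck_on k D f.

(* [cparam] is the inverse of [ccoord]; both are total functions, whose values
   are relevant only on [cdom] and on [ccoord @` cdom] respectively. *)
Record chart (R : realType) (m : nat) (M : topologicalType) := Chart {
  cdom : set M;
  ccoord : M -> 'rV[R]_m;
  cparam : 'rV[R]_m -> M;
  dom_open : open cdom;
  codom_open : open (ccoord @` cdom);
  coord_continuous : {within cdom, continuous ccoord};
  param_continuous : {within ccoord @` cdom, continuous cparam};
  coordK : forall p, cdom p -> cparam (ccoord p) = p
}.

(* The atlas is indexed by the points of the manifold: [chart_at p] is a chart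
   around p, and tangent vectors at p are written in the coordinates of this
   preferred chart, so that T_p M is 'rV[R]_m. *)
Record manifold (R : realType) (m : nat) := Manifold {
  points :> topologicalType;
  points_hausdorff : hausdorff_space points;
  points_second_countable : @second_countable points;
  chart_at : points -> chart R m points;
  mem_chart_at : forall p, cdom (chart_at p) p;
  chart_compat : forall p q,
    smooth_on (ccoord (chart_at p) @` (cdom (chart_at p) `&` cdom (chart_at q)))
              (ccoord (chart_at q) \o cparam (chart_at p))
}.

Definition smooth_map (R : realType) (m n : nat) (M : manifold R m)
    (N : manifold R n) (f : M -> N) : Prop :=
  continuous f /\
  forall (p : M) (q : N),
    smooth_on
      (ccoord (chart_at p) @` (cdom (chart_at p) `&` f @^-1` cdom (chart_at q)))
      (ccoord (chart_at q) \o f \o cparam (chart_at p)).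

(* Smoothness of a map M1 x M2 -> N, read in the product charts. *)
Definition smooth_map2 (R : realType) (m1 m2 n : nat) (M1 : manifold R m1)
    (M2 : manifold R m2) (N : manifold R n) (f : M1 -> M2 -> N) : Prop :=
  continuous (fun z : M1 * M2 => f z.1 z.2) /\
  forall (p : M1) (q : M2) (r : N),
    smooth_on
      [set (ccoord (chart_at p) z.1, ccoord (chart_at q) z.2) | z in
         [set z : M1 * M2 | [/\ cdom (chart_at p) z.1, cdom (chart_at q) z.2
                              & cdom (chart_at r) (f z.1 z.2)]]]
      (fun w : 'rV[R]_m1 * 'rV[R]_m2 =>
         ccoord (chart_at r)
           (f (cparam (chart_at p) w.1) (cparam (chart_at q) w.2))).

Definition diffeomorphism (R : realType) (m n : nat) (M : manifold R m)
    (N : manifold R n) (f : M -> N) : Prop :=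
  smooth_map f /\
  exists g : N -> M, [/\ smooth_map g, cancel f g & cancel g f].

(* The tangent map T_p M -> T_(f p) N. *)
Definition tangent_map (R : realType) (m n : nat) (M : manifold R m)
    (N : manifold R n) (f : M -> N) (p : M) (v : 'rV[R]_m) : 'rV[R]_n :=
  'D_v (ccoord (chart_at (f p)) \o f \o cparam (chart_at p))
       (ccoord (chart_at p) p).

(* [g p u v] is the scalar product of the tangent vectors u, v at p. *)
Definition metric (R : realType) (m : nat) (M : manifold R m) : Type :=
  M -> 'rV[R]_m -> 'rV[R]_m -> R.

Definition isometric (R : realType) (m n : nat) (M : manifold R m)
    (N : manifold R n) (g : metric M) (h : metric N) : Prop :=
  exists f : M -> N, diffeomorphism f /\
    forall p u v, h (f p) (tangent_map f p u) (tangent_map f p v) = g p u v.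

Definition path_connected (R : realType) (T : topologicalType) : Prop :=
  forall x y : T, exists c : R -> T,
    [/\ {within `[0, 1], continuous c}, c 0 = x & c 1 = y].

Definition simply_connected (R : realType) (T : topologicalType) : Prop :=
  [/\ [set: T] !=set0, path_connected R T &
      forall c : R -> T, {within `[0, 1], continuous c} -> c 0 = c 1 ->
        exists H : R * R -> T,
          [/\ {within (`[0, 1] `*` `[0, 1]), continuous H},
              forall t, t \in `[0, 1] -> H (0, t) = c t,
              forall t, t \in `[0, 1] -> H (1, t) = c 0 &
              forall s, s \in `[0, 1] -> H (s, 0) = c 0 /\ H (s, 1) = c 0]].

Record lieGroup (R : realType) (m : nat) := LieGroup {
  lie_manifold :> manifold R m;
  lmul : lie_manifold -> lie_manifold -> lie_manifold;
  lone : lie_manifold;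
  linv : lie_manifold -> lie_manifold;
  lmulA : associative lmul;
  lmul1g : left_id lone lmul;
  lmulVg : left_inverse lone linv lmul;
  lmul_smooth : smooth_map2 lmul;
  linv_smooth : smooth_map linv
}.

(* The left-invariant vector field with value v at the identity, written in
   the coordinates of the chart around the identity. *)
Definition left_field (R : realType) (m : nat) (G : lieGroup R m)
    (v x : 'rV[R]_m) : 'rV[R]_m :=
  let c := chart_at (lone G) in
  'D_v (fun y => ccoord c (lmul (cparam c x) (cparam c y))) (ccoord c (lone G)).

(* The Lie bracket on T_e G: the value at e of the bracket of left-invariant
   vector fields, with [X, Y] = DY(X) - DX(Y) in coordinates. *)
Definition lie_bracket (R : realType) (m : nat) (G : lieGroup R m)
    (u v : 'rV[R]_m) : 'rV[R]_m :=
  let x0 := ccoord (chart_at (lone G)) (lone G) in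
  'D_(left_field G u x0) (left_field G v) x0
  - 'D_(left_field G v x0) (left_field G u) x0.

(* psi identifies the Lie algebra T_e G of G with (L, br). *)
Definition lie_algebra_identification (R : realType) (m : nat)
    (G : lieGroup R m) (L : lmodType R) (br : L -> L -> L)
    (psi : {linear 'rV[R]_m -> L}) : Prop :=
  bijective psi /\
  forall u v, psi (lie_bracket G u v) = br (psi u) (psi v).

(* The left-invariant metric on G determined by a form h on its Lie algebra. *)
Definition left_metric (R : realType) (m : nat) (G : lieGroup R m)
    (L : lmodType R) (psi : {linear 'rV[R]_m -> L}) (h : L -> L -> R) :
    metric G :=
  fun p u v => h (psi (tangent_map (lmul (linv p)) p u))
                 (psi (tangent_map (lmul (linv p)) p v)).

Arguments left_metric {R m} G {L} psi h p u v.

Definition skew_endo (R : realType) (V : vectType R) (ip : {dot V for idfun})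
  (f : 'End(V)) : Prop := forall u v, ip (f u) v = - ip u (f v).

Definition nalg (R : realType) (V : vectType R) : vectType R :=
  ('Hom(V, R^o) * V)%type.

Definition hyperbolic (R : realType) (V : vectType R) (x y : nalg V) : R :=
  x.1 y.2 + y.1 x.2.

Definition nbracket (R : realType) (V : vectType R) (ip : {dot V for idfun})
    (rho : {linear V -> 'End(V)}) (x y : nalg V) : nalg V :=
  (linfun (fun w : V => ip (rho w x.2) y.2 : R^o), 0).

(* [nbracket] satisfies the defining equation <[u,v],w> = <rho(w)u,v>. *)
Lemma nbracketE (R : realType) (V : vectType R) (ip : {dot V for idfun})
    (rho : {linear V -> 'End(V)}) (u v w : V) :
  hyperbolic (nbracket ip rho (0, u) (0, v)) (0, w) = ip (rho w u) v.
Proof.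
rewrite /hyperbolic /nbracket /= zero_lfunE addr0.
have lin : linear (fun w : V => ip (rho w u) v : R^o).
  by move=> a x y; rewrite linearP add_lfunE scale_lfunE linearPl.
pose f := GRing.isLinear.Build R V R^o _ (fun w : V => ip (rho w u) v : R^o) lin.
pose g : {linear V -> R^o} := HB.pack (fun w : V => ip (rho w u) v : R^o) f.
exact: (lfunE g).
Qed.

(* Main.v *)
(**
  Let [br] be the bracket of one of the two Lie algebras [L]. Since [L] is
  2-step nilpotent, the simply connected group is [L] itself with the law
  [a ** b = a + b + br a b / 2], the logarithm being the isomorphism. At [a] the
  differential of the logarithm sends a tangent vector with left-invariant
  value [w] to [w + br a w / 2]. As the hyperbolic form is ad-invariant and
  the derived algebra is isotropic,
  [<w + br a w / 2, w' + br a w' / 2> = <w, w'>]: in logarithmic coordinates the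
  metric is the constant form of [L]. Both groups are thus isometric to the
  same pseudo-Euclidean space, and matching their logarithms is an isometry.

  The logarithm is constructed without the general theory of Lie groups. Write
  [omega] for the left-invariant Maurer-Cartan form in the chart at the identity
  and [P] for a linear map that kills the brackets and satisfies
  [br (P x) y = br x y]. Then [P omega] is closed; if [F] is a primitive of it,
  [omega + br F omega / 2] is closed too, and its primitive is the logarithm
  near the identity. Its local inverse [sig] extends to the homomorphism
  [x |-> sig (x / k) ^ k] ([k] large), which is surjective by connectedness and
  injective because a null-homotopy of the loop [t |-> exp (t x)] can be cut into
  cells on which the local logarithm is a homomorphism.
*)

Require Import Defs.
From HB Require Import structures.
From mathcomp Require Import all_boot all_order all_algebra.
From mathcomp Require Import sesquilinear.
From mathcomp Require Import all_classical all_reals all_analysis.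
From mathcomp Require Import ring lra.

Set Implicit Arguments.
Unset Strict Implicit.
Unset Printing Implicit Defensive.

Import Order.TTheory GRing.Theory Num.Theory.
Import numFieldNormedType.Exports.
Local Open Scope classical_set_scope.
Local Open Scope ring_scope.

(** * Smooth functions *)

(** The relation [d Phi = omega + br Phi omega / 2] satisfied by the logarithm has [Phi] on both
    sides. It becomes a quadrature because [br] sees [Phi] only through [P Phi], and [P] turns the
    relation into [d (P Phi) = P omega]: thus [P Phi] must be the primitive [F], known beforehand.
    Closedness of both forms rests on the Maurer-Cartan equation, obtained by differentiating the
    left invariance of [omega] and cancelling the second derivatives of the translation by Schwarz.
    The same invariance makes [F] additive and [Phi] multiplicative. The obstacle of the global part
    is that [sig] is known to be multiplicative only when both factors and their product are small.
    Long products are therefore compared across a strip of small cells, and one combinatorial lemma,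
    [chain_shift], serves twice: applied to [sig] it makes the extension multiplicative, applied to
    the local logarithm it makes the extension injective. Away from the identity, smoothness and
    differentials are carried by left translation. *)

Lemma near_eq_continuous (T U : topologicalType) (f g : T -> U) (x : T) :
  {near x, f =1 g} -> {for x, continuous f} -> {for x, continuous g}.
Proof.
move=> fg cf; have fgx : f x = g x by exact: (nbhs_singleton fg).
by rewrite /prop_for /continuous_at -fgx; apply: cvg_trans cf; exact: near_eq_cvg.
Qed.

Section CkTheory.
Context {R : realType} {V W : normedModType R}.
Implicit Types (D E : set V) (f g : V -> W).

Lemma Ck_onS k D f : Ck_on k.+1 D f -> Ck_on k D f.
Proof.
elim: k f => [|k IH] f /= [cf [df Df]]; first by [].
by split=> //; split=> // v; exact: IH.
Qed.

Lemma Ck_on_sub k D E f : D `<=` E -> Ck_on k E f -> Ck_on k D f.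
Proof.
move=> DE; elim: k f => [|k IH] f /= [cf].
  by move=> _; split=> // x /DE; exact: cf.
move=> [df Df]; split; first by move=> x /DE; exact: cf.
by split=> [x v /DE|v]; [exact: df|exact: IH].
Qed.

Lemma Ck_on_eq k D f g : open D -> (forall x, D x -> f x = g x) ->
  Ck_on k D f -> Ck_on k D g.
Proof.
move=> oD; elim: k f g => [|k IH] f g fg.
all: have nfg x : D x -> {near x, f =1 g}
  by move=> Dx; apply: filterS (open_nbhs_nbhs (conj oD Dx)) => y /fg.
  move=> [cf _]; split=> // x Dx.
  exact: near_eq_continuous (nfg x Dx) (cf x Dx).
move=> [cf [df Df]]; split=> [x Dx|].
  exact: near_eq_continuous (nfg x Dx) (cf x Dx).
split=> [x v Dx|v]; first exact: (near_eq_derivable (nfg x Dx)) (df x v Dx).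
by apply: IH (Df v) => x Dx; exact: near_eq_derive (nfg x Dx).
Qed.

Lemma Ck_on_cst k D (c : W) : Ck_on k D (cst c : V -> W).
Proof.
elim: k c => [|k IH] c /=.
  by split=> // x _; exact: cvg_cst.
split; first by move=> x _; exact: cvg_cst.
split=> [x v _|v]; first exact: derivable_cst.
suff -> : (fun x => 'D_v (cst c) x) = cst (0 : W) by exact: IH.
by apply/funext => x; rewrite derive_cst.
Qed.

Lemma Ck_on_add k D f g : open D -> Ck_on k D f -> Ck_on k D g ->
  Ck_on k D (fun x => f x + g x).
Proof.
move=> oD; elim: k f g => [|k IH] f g /= [cf fs] [cg gs].
  by split=> // x Dx; apply: (@continuousD _ _ _ f g); [exact: cf|exact: cg].
split; first by move=> x Dx; apply: (@continuousD _ _ _ f g); [exact: cf|exact: cg].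
split=> [x v Dx|v].
  by apply: (@derivableD _ _ _ f g); [exact: fs.1|exact: gs.1].
apply: (@Ck_on_eq _ _ (fun x => 'D_v f x + 'D_v g x)) => //.
  by move=> x Dx; rewrite -(deriveD (fs.1 _ _ Dx) (gs.1 _ _ Dx)).
exact: IH (fs.2 v) (gs.2 v).
Qed.

Lemma Ck_on_sum k D (I : Type) (r : seq I) (P : pred I) (F : I -> V -> W) :
  open D -> (forall i, P i -> Ck_on k D (F i)) ->
  Ck_on k D (fun x => \sum_(i <- r | P i) F i x).
Proof.
move=> oD HF; elim: r => [|i r IH].
  rewrite (_ : (fun x => _) = cst 0); first exact: Ck_on_cst.
  by apply/funext => x; rewrite big_nil.
rewrite (_ : (fun x => _) = fun x =>
    (if P i then F i x else 0) + \sum_(i <- r | P i) F i x); last first.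
  by apply/funext => x; rewrite big_cons; case: ifP => // _; rewrite add0r.
apply: Ck_on_add => //.
by move: (HF i); case: (P i) => [/(_ isT)//|_]; exact: Ck_on_cst.
Qed.

End CkTheory.

Section CkReal.
Context {R : realType} {V : normedModType R}.
Implicit Types (D E : set V) (f g : V -> R).

Lemma Ck_on_mul k D f g : open D -> Ck_on k D f -> Ck_on k D g ->
  Ck_on k D (fun x => f x * g x).
Proof.
move=> oD; elim: k f g => [|k IH] f g /=.
  move=> [cf fs] [cg gs].
  by split=> // x Dx; apply: (@continuousM _ _ f g); [exact: cf|exact: cg].
move=> /[dup] /Ck_onS Cf [cf [df Df]] /[dup] /Ck_onS Cg [cg [dg Dg]].
split; first by move=> x Dx; apply: (@continuousM _ _ f g); [exact: cf|exact: cg].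
split=> [x v Dx|v].
  by apply: (@derivableM _ _ f g); [exact: df|exact: dg].
apply: (@Ck_on_eq _ _ _ _ _ (fun x => f x * 'D_v g x + g x * 'D_v f x)) => //.
  by move=> x Dx; rewrite -(deriveM (df _ _ Dx) (dg _ _ Dx)).
by apply: Ck_on_add => //; apply: IH => //.
Qed.

Lemma Ck_on_coordP k D n (f : V -> 'rV[R]_n) : open D ->
  Ck_on k D f <-> forall i, Ck_on k D (fun x => f x 0 i).
Proof.
move=> oD.
have contP (g : V -> 'rV[R]_n) x : {for x, continuous g} <->
    forall i, {for x, continuous (fun x => g x 0 i)}.
  split=> [cg i|cg].
    apply: (@continuous_comp _ _ _ g (fun M : 'rV[R]_n => M 0 i)) => //.
    exact: coord_continuous.
  apply/cvgrPdist_le => /= e e0; near=> y.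
  rewrite /Num.Def.normr/= mx_normrE (bigmax_le _ (ltW e0))//= => -[i j] _.
  rewrite !mxE /= ord1; move: j {i}; near: y; apply: filter_forall => j.
  by move/cvgrPdist_le: (cg j) => /(_ e e0).
elim: k f => [|k IH] f /=.
  split=> [[cf _] i|cf]; first by split=> // x Dx; exact: (contP _ _).1 (cf x Dx) i.
  by split=> // x Dx; apply/contP => i; exact: (cf i).1.
split=> [[cf [df Df]] i|H].
  split; first by move=> x Dx; exact: (contP _ _).1 (cf x Dx) i.
  split=> [x v Dx|v]; first by move/derivable_mxP: (df x v Dx); exact.
  have /(IH _).1/(_ i) := Df v; apply: Ck_on_eq => // x Dx.
  by rewrite derive_mx ?mxE//; exact: df.
have df x v : D x -> derivable f x v.
  by move=> Dx; apply/derivable_mxP => i j; rewrite (ord1 i); exact: (H j).2.1.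
split; first by move=> x Dx; apply/contP => i; exact: (H i).1.
split=> // v; apply/IH => i; have [_ [_ /(_ v)]] := H i.
by apply: Ck_on_eq => // x Dx; rewrite derive_mx ?mxE//; exact: df.
Unshelve. all: by end_near. Qed.

End CkReal.

(** * Directional derivatives along affine maps and the mean value theorem *)

Section Affine.
Context {R : realType} {U V W : normedModType R}.
Implicit Types (f : V -> W) (A : U -> V).

(** Along the line directed by [v], [A] moves on the line directed by [w], so the difference
    quotients of [f \o A] at [x] and of [f] at [A x] are the same function of [h]. The lemma holds
    for every [f], and so can precede the chain rule. *)
Lemma derivable_affineE f A x v w :
    (forall h : R, A (h *: v + x) = h *: w + A x) ->
  derivable (f \o A) x v = derivable f (A x) w.
Proof.
move=> HA; rewrite /derivable.
rewrite (_ : (fun h => _) = fun h => h^-1 *: ((f \o shift (A x)) (h *: w) - f (A x))) //.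
by apply/funext => h /=; rewrite HA.
Qed.

Lemma derivable_affine f A x v w :
    (forall h : R, A (h *: v + x) = h *: w + A x) ->
  derivable f (A x) w -> derivable (f \o A) x v.
Proof. by move=> HA; rewrite (derivable_affineE f HA). Qed.

Lemma derive_affine f A x v w :
    (forall h : R, A (h *: v + x) = h *: w + A x) ->
  'D_v (f \o A) x = 'D_w f (A x).
Proof.
move=> HA; rewrite /derive.
rewrite (_ : (fun h => _) = fun h => h^-1 *: ((f \o shift (A x)) (h *: w) - f (A x))) //.
by apply/funext => h /=; rewrite HA.
Qed.

Lemma Ck_on_affine k (D : set V) f A L :
    continuous A -> (forall x v (h : R), A (h *: v + x) = h *: L v + A x) ->
  Ck_on k D f -> Ck_on k (A @^-1` D) (f \o A).
Proof.
move=> cA HA; elim: k f => [|k IH] f /= [cf].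
  by move=> _; split=> // x Dx; apply: continuous_comp; [exact: cA|exact: cf].
move=> [df Df]; split.
  by move=> x Dx; apply: continuous_comp; [exact: cA|exact: cf].
split=> [x v Dx|v].
  by apply: (derivable_affine (HA x v)); exact: df.
rewrite (_ : (fun x => _) = (fun y => 'D_(L v) f y) \o A); first exact: IH.
by apply/funext => x /=; rewrite (derive_affine _ (HA x v)).
Qed.

End Affine.

Section MeanValue.
Context {R : realType} {V : normedModType R}.

(** On the line through [x] directed by [v] the claim concerns a function of one real variable,
    where derivability is differentiability and the derivative is linear in the direction. *)
Lemma is_derive_scale {W : normedModType R} (f : V -> W) x v (r : R) :
  derivable f x v -> is_derive x (r *: v) f (r *: 'D_v f x).
Proof.
move=> dfv; pose A (h : R) : V := h *: v + x.
have A0 : A 0 = x by rewrite /A scale0r add0r.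
have HA (w h : R) : A (h *: w + 0) = h *: (w *: v) + A 0.
  by rewrite /A addr0 scale0r add0r scalerA.
have HA1 (h : R) : A (h *: (1 : R) + 0) = h *: v + A 0 by rewrite HA scale1r.
have dA : differentiable (f \o A) 0.
  by apply/derivable1_diffP/(derivable_affine HA1); rewrite A0.
have Er : 'D_r (f \o A) 0 = 'D_(r *: v) f x by rewrite (derive_affine f (HA r)) A0.
have E1 : 'D_1 (f \o A) 0 = 'D_v f x by rewrite (derive_affine f HA1) A0.
apply: DeriveDef; last first.
  by rewrite -Er -E1 !deriveE// -[in LHS](mulr1 r) -[r * 1]/(r *: 1) linearZ.
rewrite -A0 -(derivable_affineE f (HA r)); exact: diff_derivable.
Qed.

Lemma segment_MVT (f : V -> R) (a v : V) :
    (forall s, 0 <= s <= 1 -> derivable f (s *: v + a) v) ->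
  exists2 s, 0 <= s <= 1 & f (v + a) - f a = 'D_v f (s *: v + a).
Proof.
move=> df; pose A (s : R) : V := s *: v + a.
have HA (s h : R) : A (h *: (1 : R) + s) = h *: v + A s.
  by rewrite /A scaler1 scalerDl addrA.
have dg (s : R) : 0 <= s <= 1 -> derivable (f \o A : R -> R) s 1.
  by move=> sr; apply: (derivable_affine (HA s)); exact: df.
have [||c] := @MVT_segment R (f \o A) (fun s => 'D_v f (A s)) 0 1 ler01.
- move=> s; rewrite in_itv /= => /andP[s0 s1].
  apply: DeriveDef; last exact: derive_affine (HA s).
  by apply: dg; rewrite !ltW.
- by apply: derivable_within_continuous => s; rewrite in_itv /=; exact: dg.
rewrite in_itv /= subr0 mulr1 => c01 E; exists c => //.
by rewrite -[RHS]E /= /A scale1r scale0r add0r.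
Qed.

Lemma line_MVT (f : V -> R) (a v : V) (r : R) :
    (forall s, `|s| <= `|r| -> derivable f (s *: v + a) v) ->
  exists2 s, `|s| <= `|r| & f (r *: v + a) - f a = r * 'D_v f (s *: v + a).
Proof.
move=> df.
have dr s : 0 <= s <= 1 -> derivable f (s *: (r *: v) + a) v.
  move=> /andP[s0 s1]; rewrite scalerA; apply: df.
  by rewrite normrM ger0_norm// ler_piMl.
have [s s01|s s01 ->] := @segment_MVT f a (r *: v).
  exact: @ex_derive _ _ _ _ _ _ _ (is_derive_scale r (dr s s01)).
exists (s * r); last first.
  rewrite (@derive_val _ _ _ _ _ _ _ (is_derive_scale r (dr s s01))).
  by rewrite scalerA.
by case/andP: s01 => s0 s1; rewrite normrM ger0_norm// ler_piMl.
Qed.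

End MeanValue.

(** * From continuous partial derivatives to differentiability and the chain rule *)

Section RowVectors.
Context {R : realType}.

Lemma coord_le_norm n (x : 'rV[R]_n) i : `|x 0 i| <= `|x|.
Proof.
rewrite [leRHS]/Num.Def.normr/= mx_normrE.
exact: (le_bigmax _ (fun i : 'I_1 * 'I_n => `|x i.1 i.2|) (0, i)).
Qed.

Lemma rV_norm_le n (x : 'rV[R]_n) c : 0 <= c ->
  (forall i, `|x 0 i| <= c) -> `|x| <= c.
Proof.
move=> c0 xc; rewrite [leLHS]/Num.Def.normr/= mx_normrE (bigmax_le _ c0)//.
by case=> i j _ /=; rewrite ord1.
Qed.

Definition lin_of {U W : lmodType R} (f : U -> W) (lf : linear f) :
  {linear U -> W} := HB.pack f (GRing.isLinear.Build R U W *:%R f lf).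

Lemma rV_linearE n (W : lmodType R) (f : {linear 'rV[R]_n -> W}) x :
  f x = \sum_i x 0 i *: f (delta_mx 0 i).
Proof.
by rewrite {1}[x]row_sum_delta linear_sum; apply: eq_bigr => i _; rewrite linearZ.
Qed.

Lemma rV_linear_continuous n (W : normedModType R)
  (f : {linear 'rV[R]_n -> W}) : continuous f.
Proof.
rewrite (_ : GRing.Linear.sort f = fun x => \sum_i x 0 i *: f (delta_mx 0 i)).
  move=> x; have [|i _|+ _] := @Ck_on_sum R 'rV[R]_n W 0 setT 'I_n
      (index_enum 'I_n) xpredT (fun i y => y 0 i *: f (delta_mx 0 i)).
  - exact: openT.
  - split=> // y _.
    exact: (@cvgZr_tmp _ _ _ (nbhs y) _ _ _ _ (@coord_continuous R 1 n 0 i y)).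
  - exact.
by apply/funext => x; exact: rV_linearE.
Qed.

(** One goes from [x] to [h + x] changing one coordinate at a time. On each step the mean value
    theorem gives a partial derivative at a nearby point, which continuity compares with its value
    at [x]. *)
Lemma C1_expansion n (D : set 'rV[R]_n) (f : 'rV[R]_n -> R) x e :
    open D -> (forall y v, D y -> derivable f y v) ->
    (forall v y, D y -> {for y, continuous ('D_v f)}) -> D x -> 0 < e ->
  \forall h \near (0 : 'rV[R]_n),
    `|f (h + x) - f x - \sum_i h 0 i * 'D_(delta_mx 0 i) f x| <= e * `|h|.
Proof.
move=> oD df cDf Dx e0.
(* The [n] steps contribute at most [e'] times the norm of [h] each; [n.+1] keeps the quotient
   meaningful for [n = 0]. *)
pose e' := e / n.+1%:R.
have e'0 : 0 < e' by rewrite divr_gt0.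
have : \forall y \near x, D y /\ forall i : 'I_n,
    `|'D_(delta_mx 0 i) f x - 'D_(delta_mx 0 i) f y| <= e'.
  near=> y; split; first by near: y; exact: open_nbhs_nbhs.
  near: y; apply: filter_forall => i.
  by move/cvgrPdist_le: (cDf (delta_mx 0 i) x Dx); exact.
move=> /nbhs_ballP[d /= d0 Hd].
have {}Hd y : `|y| < d -> D (y + x) /\ forall i : 'I_n,
    `|'D_(delta_mx 0 i) f x - 'D_(delta_mx 0 i) f (y + x)| <= e'.
  by move=> yd; apply: Hd; rewrite -ball_normE /= opprD addrCA subrr addr0 normrN.
near=> h.
have hd : `|h| < d.
  by near: h; apply/nbhs_ballP; exists d => //= y; rewrite -ball_normE /= sub0r normrN.
(* [p k] keeps the first [k] coordinates of [h]: the path runs from [p 0 = 0] to [p n = h]. *)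
pose p (k : nat) : 'rV[R]_n := \row_j (if (j < k)%N then h 0 j else 0).
have pS (k : 'I_n) : p k.+1 = h 0 k *: delta_mx 0 k + p k.
  apply/rowP => j; rewrite !mxE eqxx /= ltnS leq_eqVlt.
  have [->|jk] := eqVneq j k; first by rewrite eqxx ltnn mulr1 addr0.
  by rewrite (_ : (_ == _ :> nat) = false) ?mulr0 ?add0r//; apply/negbTE.
have pn s (k : 'I_n) : `|s| <= `|h 0 k| -> `|s *: delta_mx 0 k + p k| <= `|h|.
  move=> sh; apply: rV_norm_le => // j; rewrite !mxE eqxx /=.
  have [->|jk] := eqVneq j k.
    by rewrite ltnn mulr1 addr0 (le_trans sh)// coord_le_norm.
  by rewrite mulr0 add0r; case: ifP => _; rewrite ?normr0// coord_le_norm.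
have step (k : 'I_n) : `|f (p k.+1 + x) - f (p k + x) -
    h 0 k * 'D_(delta_mx 0 k) f x| <= e' * `|h|.
  have [|s sh] := @line_MVT R _ f (p k + x) (delta_mx 0 k) (h 0 k).
    move=> s sh; apply: df; rewrite addrA; apply: (Hd _ _).1.
    exact: le_lt_trans (pn _ _ sh) hd.
  rewrite pS -(addrA (_ *: _)) => ->; rewrite -mulrBr normrM mulrC ler_pM//.
    rewrite distrC addrA; apply: (Hd _ _).2.
    exact: le_lt_trans (pn _ _ sh) hd.
  exact: coord_le_norm.
have -> : f (h + x) - f x = \sum_(k < n) (f (p k.+1 + x) - f (p k + x)).
  rewrite -(big_mkord xpredT (fun k => f (p k.+1 + x) - f (p k + x))).
  rewrite telescope_sumr//; congr (f _ - f _).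
    by congr (_ + _); apply/rowP => j; rewrite mxE ltn_ord.
  by rewrite (_ : p 0%N = 0) ?add0r//; apply/rowP => j; rewrite !mxE.
rewrite -sumrB (le_trans (ler_norm_sum _ _ _))//.
apply: (@le_trans _ _ (\sum_(k < n) e' * `|h|)); first exact: ler_sum.
rewrite sumr_const card_ord -mulr_natl mulrA ler_wpM2r//.
by rewrite /e' mulrCA ler_piMr ?(ltW e0)// ler_pdivrMr// mul1r ler_nat.
Unshelve. all: by end_near. Qed.

Lemma expansion_differentiable (V W : normedModType R) (f : V -> W) x
    (L : {linear V -> W}) : continuous L ->
    (forall e, 0 < e ->
      \forall h \near (0 : V), `|f (h + x) - f x - L h| <= e * `|h|) ->
  differentiable f x.
Proof.
move=> cL fL.
have E : f \o shift x = cst (f x) + L +o_ 0 id.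
  apply/eqaddoP => _/posnumP[e]; near=> h.
  by rewrite /= !fctE opprD addrA; near: h; exact: fL.
by apply/diff_locallyP; rewrite (diff_unique cL E); split.
Unshelve. all: by end_near. Qed.

Lemma C1_differentiable n (D : set 'rV[R]_n) (f : 'rV[R]_n -> R) x :
    open D -> (forall y v, D y -> derivable f y v) ->
    (forall v y, D y -> {for y, continuous ('D_v f)}) -> D x ->
  differentiable f x.
Proof.
move=> oD df cDf Dx.
pose l (h : 'rV[R]_n) : R := \sum_i h 0 i * 'D_(delta_mx 0 i) f x.
have ll : linear l.
  move=> a u v; rewrite /l scaler_sumr -big_split; apply: eq_bigr => i _ /=.
  by rewrite !mxE mulrDl scalerAl.
apply: (@expansion_differentiable _ _ f x (lin_of ll)).
  exact: rV_linear_continuous.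
by move=> e e0; exact: C1_expansion oD df cDf Dx e0.
Qed.

End RowVectors.

Section ChainRule.
Context {R : realType} {U V W : normedModType R}.

(** [f] enters only through its restriction to the line directed by [v]; there it is differentiable,
    and the differentials compose. *)
Lemma is_derive_comp (f : U -> V) (g : V -> W) x v :
    derivable f x v -> differentiable g (f x) ->
  is_derive x v (g \o f) ('D_('D_v f x) g (f x)).
Proof.
move=> df dg; pose A (h : R) : U := h *: v + x.
have HA (h : R) : A (h *: (1 : R) + 0) = h *: v + A 0.
  by rewrite /A scaler1 addr0 scale0r add0r.
have A0 : A 0 = x by rewrite /A scale0r add0r.
have dfA : differentiable (f \o A) 0.
  by apply/derivable1_diffP/(derivable_affine HA); rewrite A0.
have dgfA : differentiable (g \o (f \o A)) 0.
  by apply: differentiable_comp => //=; rewrite A0.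
have e1 := derive_affine f HA; have e2 := derive_affine (g \o f) HA.
rewrite A0 in e1 e2.
have dg0 : differentiable g ((f \o A) 0) by rewrite /= A0.
apply: DeriveDef; first exact/derivable1P/derivable1_diffP.
rewrite -e2 (deriveE _ dgfA) (diff_comp dfA dg0) /= -(deriveE _ dfA) e1.
by rewrite -deriveE A0.
Qed.

End ChainRule.

(** * Symmetry of second derivatives *)

Section Schwarz.
Context {R : realType} {V : normedModType R}.

(** The mean value theorem is used twice: along [v] for the increment of [f] in the direction [u],
    then along [u] for ['D_v f]. The bound by [d] keeps the whole parallelogram inside [D]. *)
Lemma second_difference (f : V -> R) (D : set V) x u v (s d : R) :
    (forall y, `|y - x| < d -> D y) -> Ck_on 2 D f ->
    `|s| * (`|u| + `|v|) < d ->
  exists2 y, `|y - x| < d &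
    f (s *: u + (s *: v + x)) - f (s *: v + x) - (f (s *: u + x) - f x) =
    s * (s * 'D_u ('D_v f) y).
Proof.
move=> xD [cf [df Df]] sd.
have near_x a b : `|a| <= `|s| -> `|b| <= `|s| ->
    `|a *: u + (b *: v + x) - x| < d.
  move=> aS bS; rewrite addrA addrK; apply: le_lt_trans sd.
  rewrite (le_trans (ler_normD _ _))// !normrZ mulrDr.
  by rewrite lerD// ler_wpM2r.
pose A (y : V) := s *: u + y.
have HA y (h : R) : A (h *: v + y) = h *: v + A y by rewrite /A addrCA.
have dA t : `|t| <= `|s| ->
    derivable (f \o A : V -> R) (t *: v + x) v /\ derivable f (t *: v + x) v.
  move=> ts; split.
    by apply: (derivable_affine (HA _)); apply/df/xD; exact: near_x.
  apply/df/xD; have := @near_x 0 t; rewrite scale0r add0r.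
  by apply=> //; rewrite normr0.
have [t ts|t ts] := @line_MVT R V (f \o A - f) x v s.
  by apply: derivableB; [exact: (dA t ts).1|exact: (dA t ts).2].
rewrite deriveB; [|exact: (dA t ts).1|exact: (dA t ts).2].
rewrite (derive_affine f (HA _)) => E.
have {}E : f (s *: u + (s *: v + x)) - f (s *: v + x) - (f (s *: u + x) - f x) =
  s * ('D_v f (s *: u + (t *: v + x)) - 'D_v f (t *: v + x)) by exact: E.
rewrite {}E.
have [r rs|r rs] := @line_MVT R V ('D_v f) (t *: v + x) u s.
  by apply: (Df v).2.1; apply/xD; exact: near_x.
by move=> ->; exists (r *: u + (t *: v + x)) => //; exact: near_x.
Qed.

(** The points [y] and [z] may differ: in [derive_swap] each order of differentiation comes with its
    own intermediate point. *)
Lemma continuous_eq (f g : V -> R) x :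
    {for x, continuous f} -> {for x, continuous g} ->
    (forall d, 0 < d ->
      exists y z, [/\ `|y - x| < d, `|z - x| < d & f y = g z]) ->
  f x = g x.
Proof.
move=> cf cg fg; apply/eqP; rewrite -subr_eq0 -normr_le0.
apply/ler_addgt0Pr => e e0; rewrite add0r [leRHS]splitr.
have e2 : 0 < e / 2 by rewrite divr_gt0.
have /nbhs_ballP[d1 /= d10 h1] : \forall y \near x, `|f x - f y| <= e / 2.
  exact: (cvgrPdist_le _ _).1 cf _ e2.
have /nbhs_ballP[d2 /= d20 h2] : \forall y \near x, `|g x - g y| <= e / 2.
  exact: (cvgrPdist_le _ _).1 cg _ e2.
have [|y [z [yd zd yz]]] := fg (Num.min d1 d2); first by rewrite lt_min d10.
rewrite -(subrKA (f y)) (le_trans (ler_normD _ _))// lerD//.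
  by apply: h1; rewrite -ball_normE /= distrC (lt_le_trans yd)// ge_min lexx.
rewrite yz distrC; apply: h2.
by rewrite -ball_normE /= distrC (lt_le_trans zd)// ge_min lexx orbT.
Qed.

(** The second difference over a parallelogram is symmetric in its sides. It equals [s ^ 2] times
    either mixed derivative at some point of a small ball around [x]; after cancelling [s ^ 2],
    continuity identifies the two limits. *)
Lemma derive_swap (D : set V) (f : V -> R) x u v :
  open D -> Ck_on 2 D f -> D x -> 'D_u ('D_v f) x = 'D_v ('D_u f) x.
Proof.
move=> oD fD Dx.
have cont w1 w2 : {for x, continuous ('D_w1 ('D_w2 f))}.
  by case: fD => _ [_ Df]; exact: ((Df w2).2.2 w1).1 x Dx.
have /nbhs_ballP[d1 /= d10 xD1] : nbhs x D by exact: open_nbhs_nbhs.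
apply: (continuous_eq (cont u v) (cont v u)) => d2 d20.
pose d := Num.min d1 d2.
have d0 : 0 < d by rewrite lt_min d10.
have xD y : `|y - x| < d -> D y.
  move=> yd; apply: xD1; rewrite -ball_normE /= distrC.
  by rewrite (lt_le_trans yd)// ge_min lexx.
pose c := `|u| + `|v| + 1.
have c0 : 0 < c by rewrite ltr_wpDl// addr_ge0.
(* With this step the parallelogram stays within distance [d] of [x]; the [+ 1] in [c] makes [c]
   positive even if [u] and [v] vanish. *)
pose s := d / 2 / c.
have s0 : 0 < s by rewrite !divr_gt0.
have sd : `|s| * (`|u| + `|v|) < d.
  rewrite gtr0_norm// (@lt_trans _ _ (s * c))//; first by rewrite ltr_pM2l// ltrDl.
  by rewrite /s divfK ?gt_eqF// ltr_pdivrMr// ltr_pMr// ltrDl.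
have [y yd Ey] := second_difference xD fD sd.
have [|z zd Ez] := @second_difference f D x v u s d xD fD.
  by rewrite (addrC `|v|).
exists y, z; split; [|by rewrite (lt_le_trans zd)// ge_min lexx orbT|].
  by rewrite (lt_le_trans yd)// ge_min lexx orbT.
apply: (mulfI (lt0r_neq0 s0)); apply: (mulfI (lt0r_neq0 s0)).
apply: etrans (esym Ey) _; apply: etrans _ Ez; rewrite (addrCA (s *: v) (s *: u) x).
move: (f (s *: u + (s *: v + x))) (f (s *: v + x)) (f (s *: u + x)) (f x).
by move=> p1 p2 p3 p4; rewrite !opprD !opprK !addrA; congr (_ + _); rewrite addrAC.
Qed.

End Schwarz.

Section Composition.
Context {R : realType}.

Lemma C1_differentiable_rV n p (D : set 'rV[R]_n) (f : 'rV[R]_n -> 'rV[R]_p) x :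
  open D -> Ck_on 1 D f -> D x -> differentiable f x.
Proof.
move=> oD /(Ck_on_coordP _ _ oD) fD Dx.
have df j : forall y v, D y -> derivable (fun x => f x 0 j) y v := (fD j).2.1.
have cDf j v := ((fD j).2.2 v).1.
pose l (h : 'rV[R]_n) : 'rV[R]_p :=
  \row_j \sum_i h 0 i * 'D_(delta_mx 0 i) (fun x => f x 0 j) x.
have ll : linear l.
  move=> a u v; apply/rowP => j; rewrite !mxE mulr_sumr -big_split.
  by apply: eq_bigr => i _ /=; rewrite !mxE mulrDl mulrA.
apply: (@expansion_differentiable _ _ _ f x (lin_of ll)).
  exact: rV_linear_continuous.
move=> e e0; near=> h; apply: rV_norm_le; first by rewrite mulr_ge0// ltW.
near: h; apply: filter_forall => j; near=> h.
rewrite !mxE; near: h; exact: C1_expansion oD (df j) (cDf j) Dx e0.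
Unshelve. all: by end_near. Qed.

Lemma C1_deriveE n (D : set 'rV[R]_n) (f : 'rV[R]_n -> R) x v :
    open D -> Ck_on 1 D f -> D x ->
  'D_v f x = \sum_i v 0 i * 'D_(delta_mx 0 i) f x.
Proof.
move=> oD fD Dx; have df := C1_differentiable oD fD.2.1 (fun v => (fD.2.2 v).1) Dx.
rewrite deriveE// rV_linearE; apply: eq_bigr => i _.
by rewrite deriveE.
Qed.

Context {V : normedModType R}.

(** The derivative of [g \o f] is a sum of products of coordinates of ['D_v f] with partial
    derivatives of [g] composed with [f]. The induction therefore quantifies over [g] and keeps [f]
    fixed. *)
Lemma Ck_on_comp_real k n (D : set V) (E : set 'rV[R]_n) (f : V -> 'rV[R]_n)
    (g : 'rV[R]_n -> R) : open D -> open E -> (forall x, D x -> E (f x)) ->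
  Ck_on k D f -> Ck_on k E g -> Ck_on k D (g \o f).
Proof.
move=> oD oE DE; elim: k g => [|k IH] g.
  move=> [cf _] [cg _]; split=> // x Dx.
  by apply: (@continuous_comp _ _ _ f g); [exact: cf|apply: cg; exact: DE].
move=> fD gE; have gE1 : Ck_on 1 E g by elim: k {IH fD} gE => // k IH /Ck_onS.
have dgf x v : D x -> is_derive x v (g \o f) ('D_('D_v f x) g (f x)).
  move=> Dx; apply: is_derive_comp; first exact: fD.2.1.
  exact: C1_differentiable oE gE1.2.1 (fun v => (gE1.2.2 v).1) (DE x Dx).
have [cf [df Df]] := fD; have [cg [dg Dg]] := gE.
split.
  move=> x Dx.
  by apply: (@continuous_comp _ _ _ f g); [exact: cf|apply: cg; exact: DE].
split=> [x v Dx|v]; first exact: @ex_derive _ _ _ _ _ _ _ (dgf x v Dx).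
apply: (@Ck_on_eq _ _ _ _ _
    (fun x => \sum_i ('D_v f x) 0 i * 'D_(delta_mx 0 i) g (f x))) => //.
  move=> x Dx; rewrite (@derive_val _ _ _ _ _ _ _ (dgf x v Dx)).
  by rewrite (C1_deriveE _ oE gE1)//; exact: DE.
apply: Ck_on_sum => // i _; apply: Ck_on_mul => //.
  exact: (Ck_on_coordP _ _ oD).1 (Df v) i.
by apply: (IH ('D_(delta_mx 0 i) g)); [exact: Ck_onS|exact: Dg].
Qed.

Lemma Ck_on_comp k n p (D : set V) (E : set 'rV[R]_n) (f : V -> 'rV[R]_n)
    (g : 'rV[R]_n -> 'rV[R]_p) : open D -> open E -> (forall x, D x -> E (f x)) ->
  Ck_on k D f -> Ck_on k E g -> Ck_on k D (g \o f).
Proof.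
move=> oD oE DE fD gE; apply/(Ck_on_coordP _ _ oD) => j.
apply: (@Ck_on_comp_real k n D E f (fun y => g y 0 j)) => //.
exact: (Ck_on_coordP _ _ oE).1 gE j.
Qed.

End Composition.

(** * Smoothness at a point *)

Section SmoothAt.
Context {R : realType}.

(** The domain is existential, so that sums, products and compositions carry no sets along. It is
    only a neighbourhood, because the images of chart domains on which smoothness is given are only
    shown to be neighbourhoods; [smooth_at_open] passes to the interior. *)
Definition smooth_at {V W : normedModType R} (f : V -> W) (x : V) :=
  exists2 D : set V, nbhs x D & smooth_on D f.

Section General.
Context {V W : normedModType R}.
Implicit Types f g : V -> W.

Lemma smooth_at_open f x : smooth_at f x ->
  exists D : set V, [/\ open D, D x & smooth_on D f].
Proof.
move=> [D xD fD]; exists D^°; split; [exact: open_interior|exact: xD|].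
by move=> k; apply: Ck_on_sub (fD k); exact: interior_subset.
Qed.

Lemma smooth_at_near f x : smooth_at f x -> \forall y \near x, smooth_at f y.
Proof.
move=> /smooth_at_open[D [oD Dx fD]]; apply: filterS (open_nbhs_nbhs (conj oD Dx)).
by move=> y Dy; exists D => //; exact: open_nbhs_nbhs.
Qed.

Lemma smooth_at_eq f g x : {near x, f =1 g} -> smooth_at f x -> smooth_at g x.
Proof.
move=> fg /smooth_at_open[D [oD Dx fD]].
exists (D `&` [set y | f y = g y]^°).
  apply: filterI; first exact: open_nbhs_nbhs.
  by apply: open_nbhs_nbhs; split; [exact: open_interior|exact: fg].
move=> k; apply: (@Ck_on_eq _ _ _ _ _ f).
- by apply: openI => //; exact: open_interior.
- by move=> y [_ /interior_subset].
- by apply: Ck_on_sub (fD k) => y [].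
Qed.

(** The open set of all points of smoothness serves as [E]. Each clause of [Ck_on] is pointwise, so
    the various neighbourhoods can be glued ([aux]). *)
Lemma smooth_on_at (D : set V) f : (forall x, D x -> smooth_at f x) <-> 
  (exists2 E : set V, D `<=` E & open E /\ smooth_on E f).
Proof.
have aux k (E : set V) g : (forall x, E x -> exists2 F, nbhs x F & Ck_on k F g) ->
    Ck_on k E g.
  elim: k E g => [|k IH] E g H.
    by split=> // x /H [F xF [cg _]]; apply: cg; exact: nbhs_singleton.
  split; first by move=> x /H [F xF [cg _]]; apply: cg; exact: nbhs_singleton.
  split=> [x v /H [F xF [_ [dg _]]]|v]; first by apply: dg; exact: nbhs_singleton.
  by apply: IH => x /H [F xF [_ [_ Dg]]]; exists F => //; exact: Dg.
split=> [H|[E DE [oE fE]] x /DE Ex]; last by exists E => //; exact: open_nbhs_nbhs.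
exists [set x | smooth_at f x] => //; split.
  by rewrite openE => x; exact: smooth_at_near.
by move=> k; apply: aux => x [F xF fF]; exists F.
Qed.

Lemma smooth_at_continuous f x : smooth_at f x -> {for x, continuous f}.
Proof. by move=> [D xD fD]; exact: (fD 0).1 x (nbhs_singleton xD). Qed.

Lemma smooth_at_derivable f x v : smooth_at f x -> derivable f x v.
Proof. by move=> [D xD fD]; apply: (fD 1).2.1; exact: nbhs_singleton. Qed.

Lemma smooth_at_derive f x v : smooth_at f x -> smooth_at ('D_v f) x.
Proof. by move=> [D xD fD]; exists D => // k; exact: (fD k.+1).2.2. Qed.

Lemma smooth_at_cst (c : W) x : smooth_at (cst c : V -> W) x.
Proof. by exists setT; [exact: filterT|move=> k; exact: Ck_on_cst]. Qed.

Lemma smooth_at_add f g x : smooth_at f x -> smooth_at g x ->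
  smooth_at (fun y => f y + g y) x.
Proof.
move=> /smooth_at_open[D [oD Dx fD]] /smooth_at_open[E [oE Ex gE]].
exists (D `&` E); first by apply: open_nbhs_nbhs; split => //; exact: openI.
by move=> k; apply: Ck_on_add; [exact: openI|apply: Ck_on_sub (fD k)|
  apply: Ck_on_sub (gE k)] => y [].
Qed.

Lemma smooth_at_sum (I : Type) (r : seq I) (F : I -> V -> W) x :
  (forall i, smooth_at (F i) x) -> smooth_at (fun y => \sum_(i <- r) F i y) x.
Proof.
move=> HF; elim: r => [|i r IH].
  apply: smooth_at_eq (smooth_at_cst 0 x).
  by near=> y; rewrite big_nil.
apply: smooth_at_eq (smooth_at_add (HF i) IH).
by near=> y; rewrite big_cons.
Unshelve. all: by end_near. Qed.

Lemma smooth_at_linear (f : {linear V -> W}) x : continuous f -> smooth_at f x.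
Proof.
move=> cf; exists setT; first exact: filterT.
case=> [|k]; first by split=> // y _; exact: cf.
split; first by move=> y _; exact: cf.
have df y : differentiable f y by apply: linear_differentiable; exact: cf.
split=> [y v _|v]; first exact: diff_derivable.
rewrite (_ : (fun y => _) = cst (f v)); first exact: Ck_on_cst.
by apply/funext => y; rewrite deriveE// diff_lin.
Qed.

End General.

Lemma smooth_at_affine {U V W : normedModType R} (f : V -> W) (A L : U -> V) x :
    continuous A -> (forall x v (h : R), A (h *: v + x) = h *: L v + A x) ->
  smooth_at f (A x) -> smooth_at (f \o A) x.
Proof.
move=> cA HA [D xD fD]; exists (A @^-1` D); first exact: cA.
by move=> k; exact: Ck_on_affine.
Qed.

Lemma smooth_at_mul {V : normedModType R} (f g : V -> R) x :
  smooth_at f x -> smooth_at g x -> smooth_at (fun y => f y * g y) x.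
Proof.
move=> /smooth_at_open[D [oD Dx fD]] /smooth_at_open[E [oE Ex gE]].
exists (D `&` E); first by apply: open_nbhs_nbhs; split => //; exact: openI.
by move=> k; apply: Ck_on_mul; [exact: openI|apply: Ck_on_sub (fD k)|
  apply: Ck_on_sub (gE k)] => y [].
Qed.

Lemma smooth_at_coordP {V : normedModType R} n (f : V -> 'rV[R]_n) x :
  smooth_at f x <-> forall i, smooth_at (fun y => f y 0 i) x.
Proof.
split=> [/smooth_at_open[D [oD Dx fD]] i|H].
  exists D; first exact: open_nbhs_nbhs.
  by move=> k; exact: (Ck_on_coordP _ _ oD).1 (fD k) i.
have /choice [D HD] : forall i, exists D : set V,
  [/\ open D, D x & smooth_on D (fun y => f y 0 i)] by move=> i; exact: smooth_at_open.
pose E := [set y | forall i, D i y]^°.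
have xE : nbhs x E.
  apply: open_nbhs_nbhs; split; first exact: open_interior.
  apply: filter_forall => i; apply: open_nbhs_nbhs; by case: (HD i).
exists E => // k; apply/Ck_on_coordP; first exact: open_interior.
move=> i; have [_ _ fD] := HD i; apply: Ck_on_sub (fD k).
by move=> y /interior_subset.
Qed.

Lemma smooth_at_comp {V : normedModType R} n p (f : V -> 'rV[R]_n)
    (g : 'rV[R]_n -> 'rV[R]_p) x :
  smooth_at f x -> smooth_at g (f x) -> smooth_at (g \o f) x.
Proof.
move=> /smooth_at_open[D [oD Dx fD]] /smooth_at_open[E [oE Ex gE]].
pose F := (D `&` f @^-1` E)^°.
have xF : nbhs x F.
  apply: open_nbhs_nbhs; split; first exact: open_interior.
  apply: filterI; first exact: open_nbhs_nbhs.
  by apply: ((fD 0).1 x Dx); exact: open_nbhs_nbhs.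
exists F => // k; apply: (@Ck_on_comp _ _ _ _ _ F E) => //.
- exact: open_interior.
- by move=> y /interior_subset[].
- by apply: Ck_on_sub (fD k) => y /interior_subset[].
Qed.

Lemma smooth_at_comp_real {V : normedModType R} n (f : V -> 'rV[R]_n)
    (g : 'rV[R]_n -> R) x :
  smooth_at f x -> smooth_at g (f x) -> smooth_at (g \o f) x.
Proof.
move=> fx gx.
have : smooth_at ((fun y => \row_(j < 1) g y) \o f) x.
  apply: smooth_at_comp => //; apply/smooth_at_coordP => i.
  by apply: smooth_at_eq gx; near=> y; rewrite mxE.
move=> /smooth_at_coordP/(_ 0); apply: smooth_at_eq.
by near=> y; rewrite /= mxE.
Unshelve. all: by end_near. Qed.

Lemma smooth_at_differentiable n p (f : 'rV[R]_n -> 'rV[R]_p) x :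
  smooth_at f x -> differentiable f x.
Proof.
move=> /smooth_at_open[D [oD Dx fD]].
exact: C1_differentiable_rV oD (fD 1) Dx.
Qed.

End SmoothAt.

(** * Differentiation under the integral and the Poincaré lemma *)

Section SmoothLines.
Context {R : realType}.

Lemma smooth_at_line {V : normedModType R} (y x : V) (t : R) :
  smooth_at (fun s : R => s *: y + x) t.
Proof.
have HA : forall z v (h : R), h *: v + z = h *: v + z :> R by [].
apply: (@smooth_at_affine _ R V V id (fun s : R => s *: y + x) (fun s => s *: y)).
- move=> s; apply: cvgD; last exact: cvg_cst.
  by apply: cvgZr_tmp; exact: cvg_id.
- by move=> s v h; rewrite scalerDl scalerA addrA.
- by apply: (@smooth_at_linear _ V V idfun) => ?; exact: cvg_id.
Qed.

Lemma smooth_at_on_line n (g : 'rV[R]_n -> R) (y x : 'rV[R]_n) (t : R) :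
  smooth_at g (t *: y + x) -> smooth_at (fun s : R => g (s *: y + x)) t.
Proof.
move=> gt; apply: (@smooth_at_comp_real _ R _ (fun s : R => s *: y + x)) => //.
exact: smooth_at_line.
Qed.

Lemma is_derive_on_line n (g : 'rV[R]_n -> R) (y x : 'rV[R]_n) (t : R) :
    smooth_at g (t *: y + x) ->
  is_derive t (1 : R) (fun s : R => g (s *: y + x)) ('D_y g (t *: y + x)).
Proof.
move=> gt; apply: DeriveDef.
  exact: smooth_at_derivable (smooth_at_on_line gt).
apply: (@derive_affine _ R _ _ g (fun s : R => s *: y + x)) => h.
by rewrite scaler1 scalerDl addrA.
Qed.

Lemma smooth_deriveE n (g : 'rV[R]_n -> R) x v : smooth_at g x ->
  'D_v g x = \sum_i v 0 i * 'D_(delta_mx 0 i) g x.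
Proof.
by move=> /smooth_at_open[D [oD Dx gD]]; exact: C1_deriveE oD (gD 1) Dx.
Qed.

Lemma zero_derive_const_real (V : normedModType R) (f : V -> R) x0 r :
    (forall x v, `|x - x0| < r -> is_derive x v f 0) ->
  forall x, `|x - x0| < r -> f x = f x0.
Proof.
move=> df x xr; apply/eqP; rewrite -subr_eq0.
have inb (s : R) : 0 <= s <= 1 -> `|s *: (x - x0) + x0 - x0| < r.
  move=> /andP[s0 s1]; rewrite addrK normrZ ger0_norm//.
  by rewrite (le_lt_trans _ xr)// ler_piMl.
have [s s01|s s01] := @segment_MVT R V f x0 (x - x0).
  exact: @ex_derive _ _ _ _ _ _ _ (df _ _ (inb s s01)).
rewrite subrK => ->.
by rewrite (@derive_val _ _ _ _ _ _ _ (df _ _ (inb s s01))).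
Qed.

Lemma zero_derive_const (V : normedModType R) n (f : V -> 'rV[R]_n) x0 r :
    (forall x v, `|x - x0| < r -> is_derive x v f 0) ->
  forall x, `|x - x0| < r -> f x = f x0.
Proof.
move=> df x xr; apply/rowP => j.
apply: (@zero_derive_const_real _ (fun y => f y 0 j) x0 r) => // y v yr.
have fy := df y v yr; have dfy := @ex_derive _ _ _ _ _ _ _ fy.
apply: DeriveDef; first exact: (derivable_mxP _ _ _).1 dfy 0 j.
have := derive_mx dfy; rewrite (@derive_val _ _ _ _ _ _ _ fy).
by move=> /rowP/(_ j); rewrite !mxE => <-.
Qed.

End SmoothLines.

Section Poincare.
Context {R : realType}.
Notation mu := (@lebesgue_measure R).

(** A constant is integrable over the unit interval and so dominates [df]. The derivative is taken
    at 0 only; other points are reached by shifting the parameter, as [poincare] does. *)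
Lemma leibniz_rule (f df : R -> R -> R) (d M : R) : 0 < d -> 0 <= M ->
    (forall s t : R, `|s| < d -> 0 <= t <= 1 -> is_derive s (1 : R) (f ^~ t) (df s t)) ->
    (forall s : R, `|s| < d -> {within `[0, 1], continuous (f s)}) ->
    (forall s t : R, `|s| < d -> 0 <= t <= 1 -> `|df s t| <= M) ->
  is_derive (0 : R) (1 : R) (fun s => \int[mu]_(t in `[0, 1]) f s t)
    (\int[mu]_(t in `[0, 1]) df 0 t).
Proof.
move=> d0 M0 Hdf Hc HM.
have I0 : (`]- d, d[%classic : set R) 0.
  by rewrite /= in_itv /= oppr_lt0 d0.
have inI (s : R) : (`]- d, d[%classic : set R) s -> `|s| < d.
  by rewrite /= in_itv /= ltr_norml.
have inB (t : R) : (`[0, 1]%classic : set R) t -> 0 <= t <= 1.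
  by rewrite /= in_itv.
have Hint (s : R) : (`]- d, d[%classic : set R) s ->
    mu.-integrable `[0, 1] (EFin \o f s).
  move=> /inI sd; apply: continuous_compact_integrable.
    exact: segment_compact.
  exact: Hc.
have Hder (s t : R) : (`]- d, d[%classic : set R) s -> (`[0, 1]%classic : set R) t ->
    derivable (f ^~ t) s 1.
  by move=> /inI sd /inB tB; exact: @ex_derive _ _ _ _ _ _ _ (Hdf s t sd tB).
have part (s t : R) : `|s| < d -> 0 <= t <= 1 -> partial1of2 f s t = df s t.
  move=> sd tB; rewrite partial1of2E.
  exact: @derive_val _ _ _ _ _ _ _ (Hdf s t sd tB).
have intM : mu.-integrable `[0, 1] (EFin \o cst M).
  apply: continuous_compact_integrable; first exact: segment_compact.
  by apply: continuous_subspaceT => x; exact: cvg_cst.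
have bound (s t : R) : (`]- d, d[%classic : set R) s -> (`[0, 1]%classic : set R) t ->
    `|partial1of2 f s t| <= cst M t.
  by move=> /inI sd /inB tB; rewrite part//; exact: HM.
apply: DeriveDef.
  exact: (@derivable_under_integral R _ _ mu f _ (measurable_itv `[0, 1])
    0 (-d) d I0 Hint Hder _ (fun=> M0) intM bound).
rewrite -derive1E.
rewrite (@differentiation_under_integral R _ _ mu f _ (measurable_itv `[0, 1])
  0 (- d) d I0 Hint Hder _ (fun=> M0) intM bound).
apply: eq_Rintegral => t /set_mem /inB tB.
by rewrite -(part 0 t)// normr0.
Qed.

Lemma FTC_smooth (G g : R -> R) :
    (forall t : R, 0 <= t <= 1 -> is_derive t (1 : R) G (g t)) ->
    (forall t : R, 0 <= t <= 1 -> {for t, continuous g}) ->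
  \int[mu]_(t in `[0, 1]) g t = G 1 - G 0.
Proof.
move=> dG cg.
have cG (t : R) : 0 <= t <= 1 -> {for t, continuous G}.
  move=> t01; apply: differentiable_continuous; apply/derivable1_diffP.
  exact: @ex_derive _ _ _ _ _ _ _ (dG t t01).
rewrite /Rintegral (@continuous_FTC2 _ g G 0 1) ?ltr01//.
- apply: continuous_in_subspaceT => t /set_mem; rewrite /= in_itv /=; exact: cg.
- split.
  + move=> t; rewrite in_itv /= => /andP[t0 t1].
    by apply: (@ex_derive _ _ _ _ _ _ _ (dG t _)); rewrite !ltW.
  + by apply: cvg_at_right_filter; apply: cG; rewrite lexx ler01.
  + by apply: cvg_at_left_filter; apply: cG; rewrite lexx ler01.
- move=> t; rewrite in_itv /= => /andP[t0 t1]; rewrite derive1E.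
  by apply: (@derive_val _ _ _ _ _ _ _ (dG t _)); rewrite !ltW.
Qed.

End Poincare.

Section PoincareLemma.
Context {R : realType}.
Notation mu := (@lebesgue_measure R).

Lemma locally_bounded_family (V : normedModType R) (I : finType)
    (b : I -> V -> R) x0 : (forall i, {for x0, continuous (b i)}) ->
  exists2 M, 0 <= M & \forall x \near x0, forall i, `|b i x| <= M.
Proof.
move=> cb; exists (\sum_i (`|b i x0| + 1)).
  by apply: sumr_ge0 => i _; rewrite addr_ge0.
apply: filter_forall => i; near=> x.
rewrite (bigD1 i)//= (@le_trans _ _ (`|b i x0| + 1))//; last first.
  by rewrite lerDl sumr_ge0// => j _; rewrite addr_ge0.
have : `|b i x0 - b i x| <= 1.
  by near: x; exact: (cvgrPdist_le _ _).1 (cb i) _ ltr01.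
by rewrite -lerBlDl; apply: le_trans; rewrite distrC lerB_dist.
Unshelve. all: by end_near. Qed.

Lemma derive_coord n (x v : 'rV[R]_n) i :
  is_derive x v (fun z : 'rV[R]_n => z 0 i) (v 0 i).
Proof.
have dx : derivable (id : 'rV[R]_n -> 'rV[R]_n) x v by exact: derivable_id.
apply: DeriveDef; first exact: (derivable_mxP _ _ _).1 dx 0 i.
by have := derive_mx dx; rewrite derive_id => /rowP/(_ i); rewrite !mxE => <-.
Qed.

Lemma smooth_at_id (V : normedModType R) (x : V) : smooth_at (id : V -> V) x.
Proof. by apply: (@smooth_at_linear _ _ _ idfun) => ?; exact: cvg_id. Qed.

Lemma smooth_at_coord n (x : 'rV[R]_n) i :
  smooth_at (fun z : 'rV[R]_n => z 0 i) x.
Proof.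
by have /smooth_at_coordP := smooth_at_id x.
Qed.

Lemma is_derive_bigsum (V : normedModType R) (I : Type) (r : seq I)
    (h : I -> V -> R) (dh : I -> R) x v :
  (forall i, is_derive x v (h i) (dh i)) ->
  is_derive x v (fun y => \sum_(i <- r) h i y) (\sum_(i <- r) dh i).
Proof.
move=> H; elim: r => [|i r IH].
  rewrite big_nil (_ : (fun y => _) = cst 0); first exact: is_derive_cst.
  by apply/funext => y; rewrite big_nil.
rewrite big_cons (_ : (fun y => _) = h i + (fun y => \sum_(j <- r) h j y)).
  exact: is_deriveD.
by apply/funext => y; rewrite big_cons.
Qed.

(** With [y = x - x0], the primitive is the integral over [t] in the unit interval of the sum of
    [y_i * a_i (x0 + t y)]. By closedness the derivative of the integrand in the direction [v] is
    the [t]-derivative of [t] times the sum of [v_i * a_i (x0 + t y)], and the integral is evaluated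
    at its ends. The radius shrinks to [r'], where the [a_i] and their partial derivatives are
    bounded, as the differentiation under the integral demands. *)
Lemma poincare n (a : 'I_n -> 'rV[R]_n -> R) x0 r : 0 < r ->
    (forall i x, `|x - x0| < r -> smooth_at (a i) x) ->
    (forall i j x, `|x - x0| < r ->
      'D_(delta_mx 0 j) (a i) x = 'D_(delta_mx 0 i) (a j) x) ->
  exists2 r', 0 < r' <= r & exists2 F : 'rV[R]_n -> R, F x0 = 0 &
    forall x v, `|x - x0| < r' -> is_derive x v F (\sum_i v 0 i * a i x).
Proof.
move=> r0 sa closed_a.
have x0r : `|x0 - x0| < r by rewrite subrr normr0.
have [M1 M10 H1] := @locally_bounded_family _ _ a x0
  (fun i => smooth_at_continuous (sa i x0 x0r)).
have [M2 M20 H2] := @locally_bounded_family _ _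
  (fun ij : 'I_n * 'I_n => 'D_(delta_mx 0 ij.2) (a ij.1)) x0
  (fun ij => smooth_at_continuous (smooth_at_derive _ (sa ij.1 x0 x0r))).
have /nbhs_ballP[r1 /= r10 Hr1] : \forall x \near x0, (forall i, `|a i x| <= M1) /\
    (forall ij : 'I_n * 'I_n, `|'D_(delta_mx 0 ij.2) (a ij.1) x| <= M2).
  exact: filterI.
pose r' := Num.min r r1.
have r'0 : 0 < r' by rewrite lt_min r0.
have r'r : r' <= r by rewrite ge_min lexx.
have {}Hr1 x : `|x - x0| < r' -> (forall i, `|a i x| <= M1) /\
    (forall i j, `|'D_(delta_mx 0 j) (a i) x| <= M2).
  move=> xr; have [|H1x H2x] := Hr1 x.
    by rewrite -ball_normE /= distrC (lt_le_trans xr)// ge_min lexx orbT.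
  by split=> // i j; exact: (H2x (i, j)).
have {}sa i x : `|x - x0| < r' -> smooth_at (a i) x.
  by move=> xr; apply: sa; exact: lt_le_trans r'r.
have {}closed_a i j x : `|x - x0| < r' ->
    'D_(delta_mx 0 j) (a i) x = 'D_(delta_mx 0 i) (a j) x.
  by move=> xr; apply: closed_a; exact: lt_le_trans r'r.
exists r'; first by rewrite r'0.
exists (fun x => \int[mu]_(t in `[0, 1])
    \sum_i (x - x0) 0 i * a i (t *: (x - x0) + x0)).
  rewrite subrr (@eq_Rintegral _ _ _ _ _ (cst 0)); last first.
    by move=> t _; rewrite big1// => i _; rewrite mxE mul0r.
  by rewrite /Rintegral integral0.
move=> x v xr; pose y := x - x0.
(* For parameters below [d] the point [x + s v] remains in the ball of radius [r']. *)
pose d := (r' - `|y|) / (`|v| + 1).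
have v1 : 0 < `|v| + 1 by rewrite ltr_wpDl.
have d0 : 0 < d by rewrite divr_gt0// subr_gt0.
have sy (s : R) : `|s| < d -> `|s *: v + y| < r'.
  move=> sd; rewrite (le_lt_trans (ler_normD _ _))// -ltrBrDr normrZ.
  rewrite (@le_lt_trans _ _ (`|s| * (`|v| + 1)))//.
    by rewrite ler_wpM2l// lerDl.
  by rewrite -ltr_pdivlMr.
have inb (s t : R) : `|s| < d -> 0 <= t <= 1 ->
    `|t *: (s *: v + y) + x0 - x0| < r'.
  move=> sd /andP[t0 t1]; rewrite addrK normrZ ger0_norm//.
  by rewrite (le_lt_trans _ (sy s sd))// ler_piMl.
pose f (s t : R) : R := \sum_i (s *: v + y) 0 i * a i (t *: (s *: v + y) + x0).
pose df (s t : R) : R := \sum_i ((s *: v + y) 0 i *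
  (t * 'D_v (a i) (t *: (s *: v + y) + x0)) + a i (t *: (s *: v + y) + x0) * v 0 i).
have smooth_line (w : 'rV[R]_n) (g : 'rV[R]_n -> R) (t : R) :
    smooth_at g (t *: w + x0) -> smooth_at (fun u : R => g (u *: w + x0)) t.
  exact: smooth_at_on_line.
have smooth_f (s t : R) : `|s| < d -> 0 <= t <= 1 -> smooth_at (f s) t.
  move=> sd t01; apply: smooth_at_sum => i; apply: smooth_at_mul.
    exact: smooth_at_cst.
  by apply: smooth_line; apply: sa; exact: inb.
have deriv_f (s t : R) : `|s| < d -> 0 <= t <= 1 ->
    is_derive s (1 : R) (f ^~ t) (df s t).
  move=> sd t01; apply: is_derive_bigsum => i.
  have E : (fun s : R => a i (t *: (s *: v + y) + x0)) =
           (fun s : R => a i (s *: (t *: v) + (t *: y + x0))).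
    apply/funext => u; congr (a i _).
    by rewrite scalerDr !scalerA (mulrC t) addrA.
  have p1 : is_derive s (1 : R) (fun s : R => (s *: v + y) 0 i) (v 0 i).
    have := @is_derive_on_line R n (fun z => z 0 i) v y s (smooth_at_coord _ _).
    by rewrite (@derive_val _ _ _ _ _ _ _ (derive_coord _ _ _)).
  have smp : smooth_at (a i) (t *: (s *: v + y) + x0) by apply: sa; exact: inb.
  have p2 : is_derive s (1 : R) (fun s : R => a i (t *: (s *: v + y) + x0))
      (t * 'D_v (a i) (t *: (s *: v + y) + x0)).
    have Ep : t *: (s *: v + y) + x0 = s *: (t *: v) + (t *: y + x0).
      by rewrite scalerDr !scalerA (mulrC t) addrA.
    rewrite E Ep; rewrite Ep in smp; have := is_derive_on_line smp.
    by rewrite (@derive_val _ _ _ _ _ _ _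
      (is_derive_scale t (smooth_at_derivable smp))).
  exact: is_deriveM p1 p2.
have deriveDv i z : `|z - x0| < r' ->
    'D_v (a i) z = \sum_j v 0 j * 'D_(delta_mx 0 j) (a i) z.
  by move=> zr; apply: smooth_deriveE; exact: sa.
pose M := \sum_(i < n) (r' * (\sum_(j < n) `|v 0 j| * M2) + M1 * `|v 0 i|).
have bound_df (s t : R) : `|s| < d -> 0 <= t <= 1 -> `|df s t| <= M.
  move=> sd t01; have [Ha Hda] := Hr1 _ (inb s t sd t01).
  rewrite (le_trans (ler_norm_sum _ _ _))// ler_sum// => i _.
  rewrite (le_trans (ler_normD _ _))// lerD//; last first.
    by rewrite normrM ler_wpM2r.
  rewrite normrM ler_pM//.
    by rewrite (le_trans (coord_le_norm _ _))// ltW// sy.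
  rewrite normrM; case/andP: (t01) => t0 t1.
  rewrite (@le_trans _ _ `|'D_v (a i) (t *: (s *: v + y) + x0)|)//.
    by rewrite ger0_norm// ler_piMl.
  rewrite deriveDv; last exact: inb.
  rewrite (le_trans (ler_norm_sum _ _ _))// ler_sum// => j _.
  by rewrite normrM ler_wpM2l.
have M0 : 0 <= M.
  apply: sumr_ge0 => i _; apply: addr_ge0; last by rewrite mulr_ge0.
  apply: mulr_ge0; first exact: ltW.
  by apply: sumr_ge0 => j _; rewrite mulr_ge0.
have n0 : `|0 : R| < d by rewrite normr0.
have L := @leibniz_rule R f df d M d0 M0 deriv_f _ bound_df.
have {L}/= L : is_derive (0 : R) (1 : R) (fun s => \int[mu]_(t in `[0, 1]) f s t)
    (\int[mu]_(t in `[0, 1]) df 0 t).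
  apply: L => s sd; apply: continuous_in_subspaceT => t /set_mem.
  by rewrite /= in_itv /= => t01; apply: smooth_at_continuous; exact: smooth_f.
(* [G] is the primitive of [df 0] on the unit interval. *)
pose G (t : R) := t * \sum_i v 0 i * a i (t *: y + x0).
have E0 : 0 *: v + y = y by rewrite scale0r add0r.
have inb0 (t : R) : 0 <= t <= 1 -> `|t *: y + x0 - x0| < r'.
  by move=> t01; rewrite -E0; exact: inb.
have intdf : \int[mu]_(t in `[0, 1]) df 0 t = \sum_i v 0 i * a i x.
  transitivity (G 1 - G 0); last first.
    rewrite /G mul0r subr0 mul1r; apply: eq_bigr => i _.
    by rewrite scale1r /y subrK.
  apply: FTC_smooth.
  - move=> t t01; rewrite /df E0.
    have -> : \sum_i (y 0 i * (t * 'D_v (a i) (t *: y + x0))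
        + a i (t *: y + x0) * v 0 i) =
      t * (\sum_i v 0 i * 'D_y (a i) (t *: y + x0))
        + (\sum_i v 0 i * a i (t *: y + x0)) * 1.
      rewrite big_split /= mulr1; congr (_ + _); last first.
        by apply: eq_bigr => i _; rewrite mulrC.
      rewrite mulr_sumr (eq_bigr (fun i => \sum_j t * (y 0 i *
          (v 0 j * 'D_(delta_mx 0 j) (a i) (t *: y + x0))))); last first.
        move=> i _; rewrite deriveDv; last exact: inb0.
        by rewrite mulrCA mulr_sumr mulr_sumr.
      (* Closedness enters here: after the exchange of sums, [D_j a_i] is replaced by [D_i a_j], and
         the sum over [i] becomes the derivative of [a_j] along [y]. *)
      rewrite exchange_big /=; apply: eq_bigr => j _.
      rewrite (smooth_deriveE _ (sa j _ (inb0 t t01))) !mulr_sumr.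
      apply: eq_bigr => i _; rewrite (mulrCA (y 0 i)).
      by rewrite (closed_a i j)//; exact: inb0.
    have q : is_derive t (1 : R) (fun s : R => \sum_i v 0 i * a i (s *: y + x0))
        (\sum_i v 0 i * 'D_y (a i) (t *: y + x0)).
      apply: is_derive_bigsum => i.
      exact: @is_deriveZ _ _ _ _ (v 0 i) _ _ _
        (is_derive_on_line (sa i _ (inb0 t t01))).
    exact: is_deriveM (is_derive_id t (1 : R)) q.
  - move=> t t01; apply: smooth_at_continuous; rewrite /df E0.
    apply: smooth_at_sum => i; apply: smooth_at_add.
      apply: smooth_at_mul; first exact: smooth_at_cst.
      apply: (@smooth_at_mul _ R id); first exact: smooth_at_id.
      by apply: (smooth_line y ('D_v (a i))); apply: smooth_at_derive; apply: sa; exact: inb0.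
    apply: smooth_at_mul; last exact: smooth_at_cst.
    by apply: (smooth_line y (a i)); apply: sa; exact: inb0.
set F := (fun x => _ : R).
pose A (h : R) : 'rV[R]_n := h *: v + x.
have HA (h : R) : A (h *: (1 : R) + 0) = h *: v + A 0.
  by rewrite /A scaler1 addr0 scale0r add0r.
have A0 : A 0 = x by rewrite /A scale0r add0r.
have FA : F \o A = fun s => \int[mu]_(t in `[0, 1]) f s t.
  by apply/funext => s; rewrite /F /A /f /= -/y -addrA.
rewrite -intdf -A0; apply: DeriveDef.
  by rewrite -(derivable_affineE F HA) FA; exact: @ex_derive _ _ _ _ _ _ _ L.
by rewrite -(derive_affine F HA) FA (@derive_val _ _ _ _ _ _ _ L).
Qed.

End PoincareLemma.

Section Primitive.
Context {R : realType}.

(** Continuous directional derivatives make [f] differentiable, hence continuous; its higher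
    derivatives are those of [g v]. *)
Lemma smooth_at_primitive n (D : set 'rV[R]_n) (f : 'rV[R]_n -> R)
    (g : 'rV[R]_n -> 'rV[R]_n -> R) : open D ->
    (forall x v, D x -> is_derive x v f (g v x)) ->
    (forall x v, D x -> smooth_at (g v) x) ->
  forall x, D x -> smooth_at f x.
Proof.
move=> oD df sg x Dx; exists D; first exact: open_nbhs_nbhs.
have dff y v : D y -> derivable f y v.
  by move=> Dy; exact: @ex_derive _ _ _ _ _ _ _ (df y v Dy).
have Ef v y : D y -> g v y = 'D_v f y.
  by move=> Dy; rewrite (@derive_val _ _ _ _ _ _ _ (df y v Dy)).
have cf v y : D y -> {for y, continuous ('D_v f)}.
  move=> Dy; apply: near_eq_continuous (smooth_at_continuous (sg y v Dy)).
  by apply: filterS (open_nbhs_nbhs (conj oD Dy)) => z /Ef.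
have c0 y : D y -> {for y, continuous f}.
  move=> Dy; apply: differentiable_continuous.
  exact: C1_differentiable oD dff cf Dy.
case=> [|k]; first by split.
split=> //; split=> // v; apply: (Ck_on_eq oD (Ef v)).
have [E DE [_ sE]] := (smooth_on_at D (g v)).1 (fun y => sg y v).
exact: Ck_on_sub DE (sE k).
Qed.

Lemma poincare_rV n p (a : 'I_n -> 'rV[R]_n -> 'rV[R]_p)
    (x0 : 'rV[R]_n) r : 0 < r ->
    (forall i x, `|x - x0| < r -> smooth_at (a i) x) ->
    (forall i j x, `|x - x0| < r ->
      'D_(delta_mx 0 j) (a i) x = 'D_(delta_mx 0 i) (a j) x) ->
  exists2 r', 0 < r' <= r & exists2 F : 'rV[R]_n -> 'rV[R]_p, F x0 = 0 &
    forall x, `|x - x0| < r' -> smooth_at F x /\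
      forall v, is_derive x v F (\sum_i v 0 i *: a i x).
Proof.
move=> r0 sa ca.
have /choice [F HF] : forall j : 'I_p, exists F : 'rV[R]_n -> R, F x0 = 0 /\
    exists2 r', 0 < r' & forall x, `|x - x0| < r' -> smooth_at F x /\
      forall v, is_derive x v F (\sum_i v 0 i * a i x 0 j).
  move=> j; have saj i x : `|x - x0| < r -> smooth_at (fun y => a i y 0 j) x.
    by move=> xr; have /smooth_at_coordP/(_ j) := sa i x xr.
  have [|r' /andP[r'0 r'r] [F F0 dF]] := poincare r0 saj.
    move=> i k x xr; have := ca i k x xr.
    rewrite (derive_mx (smooth_at_derivable (sa i x xr))).
    rewrite (derive_mx (smooth_at_derivable (sa k x xr))).
    by move=> /rowP/(_ j); rewrite !mxE.
  exists F; split=> //; exists r' => // x xr; split; last by move=> v; exact: dF.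
  apply: (@smooth_at_primitive _ (ball x0 r') _
    (fun v x => \sum_i v 0 i * a i x 0 j)).
  - exact: ball_open.
  - by move=> y v; rewrite -ball_normE /= distrC => yr; exact: dF.
  - move=> y v; rewrite -ball_normE /= distrC => yr.
    apply: smooth_at_sum => i; apply: smooth_at_mul; first exact: smooth_at_cst.
    by apply: saj; exact: lt_le_trans r'r.
  - by rewrite -ball_normE /= distrC.
pose P (j : 'I_p) (x : 'rV[R]_n) := smooth_at (F j) x /\
    forall v, is_derive x v (F j) (\sum_i v 0 i * a i x 0 j).
have : \forall x \near x0, forall j : 'I_p, P j x.
  apply: (@filter_forall _ _ P (nbhs x0)) => j; have [_ [r' r'0 Hr']] := HF j.
  apply/nbhs_ballP; exists r' => // x; rewrite -ball_normE /= distrC.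
  exact: Hr'.
move=> /nbhs_ballP[r1 /= r10 Hr1].
exists (Num.min r r1); first by rewrite lt_min r0 r10 ge_min lexx.
exists (fun x => \row_j F j x).
  by apply/rowP => j; rewrite !mxE (HF j).1.
move=> x xr; have {}Hr1 : forall j : 'I_p, smooth_at (F j) x /\
    forall v, is_derive x v (F j) (\sum_i v 0 i * a i x 0 j).
  by apply: Hr1; rewrite -ball_normE /= distrC (lt_le_trans xr)// ge_min lexx orbT.
have EF j : (fun y => (\row_j F j y) 0 j) = F j by apply/funext => y; rewrite mxE.
have sF : smooth_at (fun x => \row_j F j x) x.
  by apply/smooth_at_coordP => j; rewrite EF; exact: (Hr1 j).1.
split=> // v; apply: DeriveDef; first exact: smooth_at_derivable.
rewrite (derive_mx (smooth_at_derivable sF)); apply/rowP => j.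
rewrite !mxE EF summxE (@derive_val _ _ _ _ _ _ _ ((Hr1 j).2 v)).
by apply: eq_bigr => i _; rewrite mxE.
Qed.

End Primitive.

(** * The inverse function theorem *)

Section InverseFunction.
Context {R : realType}.

(** The partial derivatives of [f - id] vanish at [x0], so they are small on a ball; the ball being
    convex, the mean value theorem applies on every segment in it. *)
Lemma near_id_lipschitz n (f : 'rV[R]_n -> 'rV[R]_n) (x0 : 'rV[R]_n) :
    smooth_at f x0 -> (forall v, 'D_v f x0 = v) ->
  exists2 r, 0 < r & forall x y, `|x - x0| < r -> `|y - x0| < r ->
    `|(f x - x) - (f y - y)| <= 2^-1 * `|x - y|.
Proof.
move=> sf idf.
pose g i (x : 'rV[R]_n) : R := f x 0 i - x 0 i.
have sg x i : smooth_at f x -> smooth_at (g i) x.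
  move=> /smooth_at_coordP/(_ i) sfx.
  have sN : smooth_at (fun y : 'rV[R]_n => - y 0 i) x.
    apply: (@smooth_at_eq _ _ _ (fun y : 'rV[R]_n => -1 * y 0 i)).
      by near=> y; rewrite mulN1r.
    by apply: smooth_at_mul; [exact: smooth_at_cst|exact: smooth_at_coord].
  exact: smooth_at_add sfx sN.
(* The [n] partial derivatives then add up to at most [1 / 2]. *)
pose e : R := 2^-1 / n.+1%:R.
have e0 : 0 < e by rewrite divr_gt0// invr_gt0.
have Dg0 i v : 'D_v (g i) x0 = 0.
  have /smooth_at_coordP/(_ i) sfi := sf.
  rewrite (_ : g i = (fun x => f x 0 i) - (fun x => x 0 i))//.
  rewrite deriveB; [|exact: smooth_at_derivable|
    exact: smooth_at_derivable (smooth_at_coord _ _)].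
  rewrite (@derive_val _ _ _ _ _ _ _ (derive_coord x0 v i)).
  have := derive_mx (smooth_at_derivable (v := v) sf); rewrite idf.
  by move=> /rowP/(_ i); rewrite mxE => <-; rewrite subrr.
have : \forall x \near x0, smooth_at f x /\ forall ij : 'I_n * 'I_n,
    `|'D_(delta_mx 0 ij.2) (g ij.1) x| <= e.
  have h2 : \forall x \near x0, forall ij : 'I_n * 'I_n,
      `|'D_(delta_mx 0 ij.2) (g ij.1) x| <= e.
    apply: (@filter_forall _ _ (fun (ij : 'I_n * 'I_n) x =>
      `|'D_(delta_mx 0 ij.2) (g ij.1) x| <= e) (nbhs x0)) => -[i j] /=.
    have c := smooth_at_continuous (smooth_at_derive (delta_mx 0 j) (sg _ i sf)).
    near=> x; rewrite -normrN -sub0r -(Dg0 i (delta_mx 0 j)).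
    by near: x; exact: (cvgrPdist_le _ _).1 c _ e0.
  exact: filterI (smooth_at_near sf) h2.
move=> /nbhs_ballP[r /= r0 Hr].
have {}Hr x : `|x - x0| < r -> smooth_at f x /\ forall ij : 'I_n * 'I_n,
    `|'D_(delta_mx 0 ij.2) (g ij.1) x| <= e.
  by move=> xr; apply: Hr; rewrite -ball_normE /= distrC.
exists r => // x y xr yr; apply: rV_norm_le; first by rewrite mulr_ge0// invr_ge0.
move=> i; have inb (s : R) : 0 <= s <= 1 -> `|s *: (x - y) + y - x0| < r.
  move=> /andP[s0 s1].
  have -> : s *: (x - y) + y - x0 = s *: (x - x0) + (1 - s) *: (y - x0).
    by apply/rowP => k; rewrite !mxE; ring.
  rewrite (le_lt_trans (ler_normD _ _))// !normrZ !ger0_norm ?subr_ge0//.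
  have [->|s_neq0] := eqVneq s 0; first by rewrite mul0r add0r subr0 mul1r.
  have sp : 0 < s by rewrite lt_def s_neq0.
  rewrite (@lt_le_trans _ _ (s * r + (1 - s) * `|y - x0|))//.
    by rewrite ltrD2r ltr_pM2l.
  rewrite (@le_trans _ _ (s * r + (1 - s) * r))//.
    by rewrite lerD2l ler_wpM2l ?subr_ge0// ltW.
  by rewrite -mulrDl addrC subrK mul1r.
have [s s01|s s01] := @segment_MVT R _ (g i) y (x - y).
  exact: smooth_at_derivable (sg _ i (Hr _ (inb s s01)).1).
rewrite subrK !mxE -/(g i x) -/(g i y) => ->.
have [sfs Hs] := Hr _ (inb s s01).
rewrite (smooth_deriveE _ (sg _ i sfs)) (le_trans (ler_norm_sum _ _ _))//.
apply: (@le_trans _ _ (\sum_(k < n) `|x - y| * e)).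
  apply: ler_sum => k _; rewrite normrM ler_pM//; first exact: coord_le_norm.
  exact: (Hs (i, k)).
rewrite sumr_const card_ord -mulrnAr mulrC ler_wpM2r//.
rewrite /e -mulr_natr -mulrA ler_piMr// ?invr_ge0//.
by rewrite ler_pdivrMl// mulr1 ler_nat.
Unshelve. all: by end_near. Qed.

(** A solution of [f x = z] is a fixed point of [x |-> z - (f x - x)], a contraction of ratio
    [1 / 2] on the closed ball of radius [r / 2]. The same estimate on [f - id] gives the lower
    bound on the distances between values of [f]. *)
Lemma local_inverse n (f : 'rV[R]_n -> 'rV[R]_n) (x0 : 'rV[R]_n) r0 :
    0 < r0 -> smooth_at f x0 -> (forall v, 'D_v f x0 = v) ->
  exists (r rho : R) (g : 'rV[R]_n -> 'rV[R]_n),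
    [/\ 0 < r <= r0, 0 < rho,
        forall x y, `|x - x0| < r -> `|y - x0| < r ->
          `|x - y| <= 2 * `|f x - f y| &
        forall z, `|z - f x0| < rho -> `|g z - x0| < r /\ f (g z) = z].
Proof.
move=> r00 sf idf; have [r1 r10 Hr1] := near_id_lipschitz sf idf.
pose r := Num.min r0 r1.
have r_gt0 : 0 < r by rewrite lt_min r00.
have {}Hr1 x y : `|x - x0| < r -> `|y - x0| < r ->
    `|(f x - x) - (f y - y)| <= 2^-1 * `|x - y|.
  by move=> xr yr; apply: Hr1; rewrite (lt_le_trans xr, lt_le_trans yr)// ge_min lexx orbT.
(* The contraction moves [x] to a distance at most [rho + r / 4 = r / 2] from [x0], which keeps the
   closed ball stable. *)
pose rho := r / 4.
have rho0 : 0 < rho by rewrite divr_gt0.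
have sol z : `|z - f x0| < rho -> exists x, `|x - x0| < r /\ f x = z.
  move=> zr; pose U := closed_ball x0 (r / 2).
  have r2 : 0 < r / 2 by rewrite divr_gt0.
  have UE : U = [set x | `|x - x0| <= r / 2].
    by rewrite /U closed_ballE//; apply/seteqP; split=> x /=; rewrite /closed_ball_ /= distrC.
  have Ur x : U x -> `|x - x0| < r.
    by rewrite UE /= => xr; rewrite (le_lt_trans xr)// ltr_pdivrMr// ltr_pMr// ltr1n.
  pose T x := z - (f x - x).
  have TU : set_fun U U T.
    move=> x Ux; rewrite UE /= /T.
    rewrite (_ : _ - x0 = (z - f x0) - ((f x - x) - (f x0 - x0))); last first.
      by apply/rowP => k; rewrite !mxE; ring.
    rewrite (le_trans (ler_normB _ _))//.
    have x0r : `|x0 - x0| < r by rewrite subrr normr0.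
    have h1 := Hr1 x x0 (Ur x Ux) x0r; rewrite UE /= in Ux.
    rewrite (le_trans (lerD (ltW zr) h1))//.
    rewrite (@le_trans _ _ (rho + 2^-1 * (r / 2)))//.
      by rewrite lerD2l ler_wpM2l// invr_ge0.
    by rewrite /rho; lra.
  pose X : completeNormedModType R := HB.pack 'rV[R]_n.
  have [|||x Ux Tx] := @banach_fixed_point R X U (mkfun_fun TU).
  - exists (2^-1)%:nng; split; first by rewrite /= invf_lt1// ltr1n.
    move=> [x y] [/= Ux Uy] /=; rewrite /T.
    rewrite (_ : _ - _ = - ((f x - x) - (f y - y))); last first.
      by apply/rowP => k; rewrite !mxE; ring.
    by rewrite normrN; apply: Hr1; exact: Ur.
  - exact: closed_ball_closed.
  - by exists x0; rewrite UE /= subrr normr0 ltW.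
  exists x; split; first exact: Ur.
  have {}Tx : x = z - (f x - x) := Tx.
  by move/(congr1 (fun w => w + (f x - x))): Tx; rewrite subrK addrC subrK.
have /choice [g Hg] : forall z, exists x, `|z - f x0| < rho ->
    `|x - x0| < r /\ f x = z.
  move=> z; have [/sol [x Hx]|zr] := boolP (`|z - f x0| < rho); first by exists x.
  by exists x0.
exists r, rho, g; split=> //; first by rewrite r_gt0 ge_min lexx.
move=> x y xr yr; have h := Hr1 x y xr yr.
have : `|x - y| <= `|f x - f y| + 2^-1 * `|x - y|.
  rewrite (_ : x - y = (f x - f y) - ((f x - x) - (f y - y))) ?(le_trans (ler_normB _ _))//.
    rewrite lerD2l (le_trans h)// ler_wpM2l ?invr_ge0//.
    rewrite (_ : x - y = (f x - f y) - ((f x - x) - (f y - y)))//.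
    by apply/rowP => k; rewrite !mxE; ring.
  by apply/rowP => k; rewrite !mxE; ring.
by move: (`|x - y|) (`|f x - f y|) => p q; lra.
Qed.

End InverseFunction.

Section InverseSmooth.
Context {R : realType}.

Lemma lipschitz_continuous_at (V W : normedModType R) (g : V -> W) z (K : R) :
    0 < K -> (\forall y \near z, `|g z - g y| <= K * `|z - y|) ->
  {for z, continuous g}.
Proof.
move=> K0 H; apply/cvgrPdist_le => /= e e0; near=> y.
have h1 : `|g z - g y| <= K * `|z - y| by near: y.
rewrite (le_trans h1)// -ler_pdivlMl//; near: y.
apply/nbhs_ballP; exists (K^-1 * e); first by rewrite /= mulr_gt0// invr_gt0.
by move=> y; rewrite -ball_normE /= => /ltW.
Unshelve. all: by end_near. Qed.

(** The lower bound on [f] controls the error of the linear approximation: the distance from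
    [g (z + h w)] to [g z + h v] is at most twice that from [z + h w] to [f (g z + h v)], which is
    negligible against [h]. *)
Lemma inverse_derive n (f g : 'rV[R]_n -> 'rV[R]_n) (x0 : 'rV[R]_n) r rho :
    (forall x y, `|x - x0| < r -> `|y - x0| < r -> `|x - y| <= 2 * `|f x - f y|) ->
    (forall z, `|z - f x0| < rho -> `|g z - x0| < r /\ f (g z) = z) ->
  forall z v w, `|z - f x0| < rho -> is_derive (g z) v f w -> is_derive z w g v.
Proof.
move=> lip inv z v w zr dfw.
have dfv : derivable f (g z) v by exact: @ex_derive _ _ _ _ _ _ _ dfw.
suff H : h^-1 *: ((g \o shift z) (h *: w) - g z) @[h --> 0^'] --> v.
  by apply: DeriveDef; [apply/cvg_ex; exists v|exact: cvg_lim H].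
have Hf : h^-1 *: ((f \o shift (g z)) (h *: v) - f (g z)) @[h --> 0^'] --> w.
  by have := dfv; rewrite -(@derive_val _ _ _ _ _ _ _ dfw).
have [gzr fgz] := inv z zr.
have near_line (x y p : 'rV[R]_n) (d : R) : `|x - p| < d ->
    \forall h \near (0 : R), `|h *: y + x - p| < d.
  move=> xd; have y1 : 0 < `|y| + 1 by rewrite ltr_wpDl.
  apply/nbhs_ballP; exists ((d - `|x - p|) / (`|y| + 1)).
    by rewrite /= divr_gt0// subr_gt0.
  move=> h; rewrite -ball_normE /= sub0r normrN ltr_pdivlMr// => hd.
  rewrite -addrA (le_lt_trans (ler_normD _ _))// -ltrBrDr normrZ.
  by rewrite (le_lt_trans _ hd)// ler_wpM2l// lerDl.
apply/cvgrPdist_le => e e0; have e2 : 0 < e / 2 by rewrite divr_gt0.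
near=> h.
have h0 : h != 0 by near: h; exact: nbhs_dnbhs_neq.
have hw : `|h *: w + z - f x0| < rho.
  by near: h; apply: nbhs_dnbhs; exact: near_line.
have hv : `|h *: v + g z - x0| < r.
  by near: h; apply: nbhs_dnbhs; exact: near_line.
have Hh : `|w - h^-1 *: (f (h *: v + g z) - f (g z))| <= e / 2.
  by near: h; exact: (cvgrPdist_le _ _).1 Hf _ e2.
have [ghr fgh] := inv _ hw.
have := lip _ _ hv ghr; rewrite fgh => L.
have -> : v - h^-1 *: ((g \o shift z) (h *: w) - g z) =
    h^-1 *: ((h *: v + g z) - g (h *: w + z)).
  by rewrite /= -[X in _ = _ *: X]addrA [RHS]scalerDr scalerA mulVf// scale1r -scalerN opprB.
rewrite normrZ normfV ler_pdivrMl ?normr_gt0//.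
apply: le_trans L _; rewrite -ler_pdivlMl// mulrCA.
have -> : f (h *: v + g z) - (h *: w + z) =
    - (h *: (w - h^-1 *: (f (h *: v + g z) - f (g z)))).
  rewrite scalerBr scalerA mulfV// scale1r fgz opprB.
  by rewrite addrAC opprD addrA addrAC.
by rewrite normrN normrZ ler_wpM2l// mulrC.
Unshelve. all: by end_near. Qed.

(** Bootstrapping: if [g] is of class C^k, so is its derivative [B w \o g], hence [g] is of class
    C^(k+1). *)
Lemma smooth_on_ode n (D : set 'rV[R]_n) (g : 'rV[R]_n -> 'rV[R]_n)
    (B : 'rV[R]_n -> 'rV[R]_n -> 'rV[R]_n) : open D ->
    (forall z, D z -> {for z, continuous g}) ->
    (forall z w, D z -> is_derive z w g (B w (g z))) ->
    (forall z w, D z -> smooth_at (B w) (g z)) ->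
  smooth_on D g.
Proof.
move=> oD cg dg sB; elim=> [|k IH]; first by split.
split=> //; split; first by move=> z w Dz; exact: @ex_derive _ _ _ _ _ _ _ (dg z w Dz).
move=> w; pose E := [set x | smooth_at (B w) x].
have [E' EE' [oE' sE']] := (smooth_on_at E (B w)).1 (fun x => id).
apply: (@Ck_on_eq _ _ _ _ _ (B w \o g)) => //.
  by move=> z Dz; rewrite (@derive_val _ _ _ _ _ _ _ (dg z w Dz)).
apply: (@Ck_on_comp _ _ _ _ _ D E') => // z Dz.
by apply: EE'; exact: sB.
Qed.

(** [B w x] is a solution, smooth in [x], of the linear equation that the differential of [f] at [x]
    sends it to [w]. It gives the derivative of the inverse, on which the bootstrapping runs. *)
Lemma inverse_function n (f : 'rV[R]_n -> 'rV[R]_n)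
    (B : 'rV[R]_n -> 'rV[R]_n -> 'rV[R]_n) (x0 : 'rV[R]_n) r0 :
    0 < r0 -> (forall v, 'D_v f x0 = v) ->
    (forall x w, `|x - x0| < r0 ->
      [/\ smooth_at f x, smooth_at (B w) x & 'D_(B w x) f x = w]) ->
  exists (r rho : R) (g : 'rV[R]_n -> 'rV[R]_n),
    [/\ 0 < r <= r0, 0 < rho,
        forall x y, `|x - x0| < r -> `|y - x0| < r -> f x = f y -> x = y &
        forall z, `|z - f x0| < rho ->
          [/\ `|g z - x0| < r, f (g z) = z & smooth_at g z]].
Proof.
move=> r00 idf H.
have x0r : `|x0 - x0| < r0 by rewrite subrr normr0.
have [sf _ _] := H x0 0 x0r.
have [r [rho [g [/andP[r_gt0 rr0] rho0 lip inv]]]] := local_inverse r00 sf idf.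
exists r, rho, g; split=> //; first by rewrite r_gt0.
  move=> x y xr yr fxy; apply/eqP; rewrite -subr_eq0 -normr_le0.
  by rewrite (le_trans (lip x y xr yr))// fxy subrr normr0 mulr0.
pose D := ball (f x0) rho.
have DE z : D z <-> `|z - f x0| < rho by rewrite /D -ball_normE /= distrC.
have in_r0 z : D z -> `|g z - x0| < r0.
  by move=> /DE /inv[gr _]; exact: lt_le_trans rr0.
have oD : open D by exact: ball_open.
have sg : smooth_on D g.
  apply: (@smooth_on_ode _ D g B) => // z.
  - move=> Dz; apply: (@lipschitz_continuous_at _ _ g z 2) => //.
    apply: filterS (open_nbhs_nbhs (conj oD Dz)) => y Dy.
    have [gzr fgz] := inv z ((DE z).1 Dz); have [gyr fgy] := inv y ((DE y).1 Dy).
    by rewrite (le_trans (lip _ _ gzr gyr))// fgz fgy.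
  - move=> w Dz; apply: (inverse_derive lip inv); first exact/DE.
    have [sfz sBz Ez] := H (g z) w (in_r0 z Dz).
    by apply: DeriveDef => //; exact: smooth_at_derivable.
  - by move=> w /in_r0 /(H _ w)[].
move=> z zr; have [gzr fgz] := inv z zr; split=> //.
by exists D => //; apply: open_nbhs_nbhs; split=> //; exact/DE.
Qed.

End InverseSmooth.

(** * Calculus of row-vector-valued functions *)

Section VectorCalculus.
Context {R : realType}.

Lemma smooth_deriveE_rV n p (f : 'rV[R]_n -> 'rV[R]_p) (x v : 'rV[R]_n) :
  smooth_at f x -> 'D_v f x = \sum_i v 0 i *: 'D_(delta_mx 0 i) f x.
Proof.
move=> sf; have df := smooth_at_differentiable sf.
by rewrite deriveE// rV_linearE; apply: eq_bigr => i _; rewrite deriveE.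
Qed.

Lemma is_derive_linear (V : normedModType R) n p
    (L : {linear 'rV[R]_n -> 'rV[R]_p}) (g : V -> 'rV[R]_n) (x v : V) (dg : 'rV[R]_n) :
  is_derive x v g dg -> is_derive x v (L \o g) (L dg).
Proof.
move=> dgx; have dL : differentiable L (g x).
  by apply: smooth_at_differentiable; apply: smooth_at_linear; exact: rV_linear_continuous.
have := is_derive_comp (@ex_derive _ _ _ _ _ _ _ dgx) dL.
rewrite (@derive_val _ _ _ _ _ _ _ dgx) deriveE// diff_lin//.
exact: rV_linear_continuous.
Qed.

Lemma is_derive_coord (V : normedModType R) n (g : V -> 'rV[R]_n) (x v : V) (dg : 'rV[R]_n) i :
  is_derive x v g dg -> is_derive x v (fun y => g y 0 i) (dg 0 i).
Proof.
move=> dgx; have d := @ex_derive _ _ _ _ _ _ _ dgx.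
apply: DeriveDef; first exact: (derivable_mxP _ _ _).1 d 0 i.
have := derive_mx d; rewrite (@derive_val _ _ _ _ _ _ _ dgx).
by move=> /rowP/(_ i); rewrite mxE => <-.
Qed.

Lemma is_derive_rowP (V : normedModType R) n (g : V -> 'rV[R]_n) (x v : V) (dg : 'rV[R]_n) :
  (forall i, is_derive x v (fun y => g y 0 i) (dg 0 i)) -> is_derive x v g dg.
Proof.
move=> H; have d : derivable g x v.
  by apply/derivable_mxP => i j; rewrite ord1; exact: @ex_derive _ _ _ _ _ _ _ (H j).
apply: DeriveDef => //; rewrite derive_mx//; apply/rowP => i.
by rewrite mxE (@derive_val _ _ _ _ _ _ _ (H i)).
Qed.

Lemma is_derive_lincomb (V : normedModType R) n p (m : V -> 'rV[R]_n)
    (b : 'I_n -> V -> 'rV[R]_p) (x v : V) (dm : 'rV[R]_n)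
    (db : 'I_n -> 'rV[R]_p) :
    is_derive x v m dm -> (forall i, is_derive x v (b i) (db i)) ->
  is_derive x v (fun y => \sum_i m y 0 i *: b i y)
    (\sum_i (dm 0 i *: b i x + m x 0 i *: db i)).
Proof.
move=> dmx dbx; apply: is_derive_rowP => j.
rewrite (_ : (fun y => _) = fun y => \sum_i m y 0 i * b i y 0 j); last first.
  by apply/funext => y; rewrite summxE; apply: eq_bigr => i _; rewrite mxE.
rewrite summxE; apply: is_derive_bigsum => i.
have := is_deriveM (is_derive_coord i dmx) (is_derive_coord j (dbx i)).
rewrite !mxE addrC [_ *: (dm 0 i)]mulrC; exact.
Qed.

Lemma smooth_at_lincomb (V : normedModType R) n p (m : V -> 'rV[R]_n)
    (b : 'I_n -> V -> 'rV[R]_p) (x : V) :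
    smooth_at m x -> (forall i, smooth_at (b i) x) ->
  smooth_at (fun y => \sum_i m y 0 i *: b i y) x.
Proof.
move=> sm sb; apply/smooth_at_coordP => j.
rewrite (_ : (fun y => _) = fun y => \sum_i m y 0 i * b i y 0 j); last first.
  by apply/funext => y; rewrite summxE; apply: eq_bigr => i _; rewrite mxE.
apply: smooth_at_sum => i; apply: smooth_at_mul; first by move/smooth_at_coordP: sm.
by have /smooth_at_coordP/(_ j) := sb i.
Qed.

Lemma derive_swap_rV (V : normedModType R) p (f : V -> 'rV[R]_p) (x u v : V) :
  smooth_at f x -> 'D_u ('D_v f) x = 'D_v ('D_u f) x.
Proof.
move=> sf; have co w w' k : ('D_w ('D_w' f) x) 0 k =
    'D_w ('D_w' (fun y => f y 0 k)) x.
  rewrite (derive_mx (smooth_at_derivable (smooth_at_derive w' sf))) mxE.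
  apply: near_eq_derive; apply: filterS (smooth_at_near sf) => y sfy.
  by rewrite (derive_mx (smooth_at_derivable sfy)) mxE.
apply/rowP => k; apply: etrans (co u v k) (etrans _ (esym (co v u k))).
have /smooth_at_coordP/(_ k) /smooth_at_open[D [oD Dx fD]] := sf.
exact: derive_swap oD (fD 2) Dx.
Qed.

Lemma smooth_at_linear_comp (V : normedModType R) n p
    (L : {linear 'rV[R]_n -> 'rV[R]_p}) (g : V -> 'rV[R]_n) (x : V) :
  smooth_at g x -> smooth_at (L \o g) x.
Proof.
move=> sg; apply: smooth_at_comp => //; apply: smooth_at_linear.
exact: rV_linear_continuous.
Qed.

Section Shift.
Context {n p : nat} {W : normedModType R}.
Variables (f : 'rV[R]_p -> W) (L : {linear 'rV[R]_n -> 'rV[R]_p}) (c : 'rV[R]_p).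

Let A (x : 'rV[R]_n) : 'rV[R]_p := L x + c.

Let affA (x v : 'rV[R]_n) (h : R) : A (h *: v + x) = h *: L v + A x.
Proof. by rewrite /A linearP addrA. Qed.

Lemma smooth_at_shift (x : 'rV[R]_n) :
  smooth_at f (L x + c) -> smooth_at (fun y => f (L y + c)) x.
Proof.
apply: (@smooth_at_affine _ _ _ _ f A L) => //.
move=> y; apply: (@smooth_at_continuous _ _ _ A).
apply: smooth_at_add; last exact: smooth_at_cst.
by apply: smooth_at_linear; exact: rV_linear_continuous.
Qed.

Lemma derive_on_shift (x v : 'rV[R]_n) :
  'D_v (fun y => f (L y + c)) x = 'D_(L v) f (L x + c).
Proof. exact: (@derive_affine _ _ _ _ f A x v (L v) (affA x v)). Qed.

End Shift.

End VectorCalculus.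

(** * The local logarithm *)

Lemma same_derive_eq {R : realType} (V : normedModType R) n
    (f g : V -> 'rV[R]_n) (d : V -> V -> 'rV[R]_n) (x0 : V) r :
    (forall x v, `|x - x0| < r -> is_derive x v f (d x v)) ->
    (forall x v, `|x - x0| < r -> is_derive x v g (d x v)) ->
  forall x, `|x - x0| < r -> f x - f x0 = g x - g x0.
Proof.
move=> df dg x xr; have H : forall x v, `|x - x0| < r -> is_derive x v (f - g) 0.
  move=> y v yr; rewrite -(subrr (d y v)).
  exact: is_deriveB (df y v yr) (dg y v yr).
have E : f x - g x = f x0 - g x0 := zero_derive_const H xr.
move: (f x) (f x0) (g x) (g x0) E => p1 p2 p3 p4 E; apply/rowP => k.
by move/rowP/(_ k): E; rewrite !mxE; lra.
Qed.

Section Bracket.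
Context {R : realType} {n : nat}.

(* [P] stands for the projection of [v^* + v] onto [v]. *)
Definition two_step_bracket (br : 'rV[R]_n -> 'rV[R]_n -> 'rV[R]_n)
    (P : {linear 'rV[R]_n -> 'rV[R]_n}) :=
  [/\ forall y, linear (br ^~ y), forall x, linear (br x),
      forall x, br x x = 0, forall x y, P (br x y) = 0 &
      forall x y, br (P x) y = br x y].

Context {br : 'rV[R]_n -> 'rV[R]_n -> 'rV[R]_n}.
Context {P : {linear 'rV[R]_n -> 'rV[R]_n}}.
Hypothesis brP : two_step_bracket br P.

Lemma br0l y : br 0 y = 0.
Proof.
have [H _ _ _ _] := brP; have := H y 1 0 0.
rewrite scaler0 addr0 scale1r => /eqP.
by rewrite -subr_eq0 opprD addrA subrr sub0r oppr_eq0 => /eqP.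
Qed.

Lemma br0r x : br x 0 = 0.
Proof.
have [_ H _ _ _] := brP; have := H x 1 0 0.
rewrite scaler0 addr0 scale1r => /eqP.
by rewrite -subr_eq0 opprD addrA subrr sub0r oppr_eq0 => /eqP.
Qed.

Lemma brDl x y z : br (x + y) z = br x z + br y z.
Proof. by have [H _ _ _ _] := brP; rewrite -[x in LHS]scale1r H scale1r. Qed.

Lemma brDr x y z : br x (y + z) = br x y + br x z.
Proof. by have [_ H _ _ _] := brP; rewrite -[y in LHS]scale1r H scale1r. Qed.

Lemma brZl a x y : br (a *: x) y = a *: br x y.
Proof. by have [H _ _ _ _] := brP; rewrite -[a *: x]addr0 H br0l addr0. Qed.

Lemma brZr a x y : br x (a *: y) = a *: br x y.
Proof. by have [_ H _ _ _] := brP; rewrite -[a *: y]addr0 H br0r addr0. Qed.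

Lemma brNl x y : br (- x) y = - br x y.
Proof. by rewrite -scaleN1r brZl scaleN1r. Qed.

Lemma brNr x y : br x (- y) = - br x y.
Proof. by rewrite -scaleN1r brZr scaleN1r. Qed.

Lemma brxx x : br x x = 0.
Proof. by have [_ _ H _ _] := brP. Qed.

Lemma brC x y : br x y = - br y x.
Proof.
apply/eqP; rewrite -addr_eq0; have := brxx (x + y).
by rewrite brDl !brDr !brxx add0r addr0 => ->.
Qed.

Lemma P_br x y : P (br x y) = 0.
Proof. by have [_ _ _ H _] := brP. Qed.

Lemma br_P x y : br (P x) y = br x y.
Proof. by have [_ _ _ _ H] := brP. Qed.

Lemma br_br x y z : br x (br y z) = 0.
Proof. by rewrite brC -br_P P_br br0l oppr0. Qed.

Lemma br_brl x y z : br (br x y) z = 0.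
Proof. by rewrite brC br_br oppr0. Qed.

Definition br_lin x : {linear 'rV[R]_n -> 'rV[R]_n} :=
  let: And5 _ H _ _ _ := brP in lin_of (H x).

Lemma br_linE x : br_lin x = br x :> (_ -> _).
Proof. by rewrite /br_lin; case: brP. Qed.

Lemma br_expand x y : br x y = \sum_i x 0 i *: br_lin (delta_mx 0 i) y.
Proof.
have [H _ _ _ _] := brP.
rewrite -[LHS]/((lin_of (H y)) x) rV_linearE; apply: eq_bigr => i _.
by rewrite br_linE.
Qed.

Lemma smooth_at_br (V : normedModType R) (f g : V -> 'rV[R]_n) (x : V) :
  smooth_at f x -> smooth_at g x -> smooth_at (fun y => br (f y) (g y)) x.
Proof.
move=> sf sg; rewrite (_ : (fun y => _) =
    fun y => \sum_i f y 0 i *: (br_lin (delta_mx 0 i) \o g) y).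
  by apply: smooth_at_lincomb => // i; exact: smooth_at_linear_comp.
by apply/funext => y; exact: br_expand.
Qed.

Lemma is_derive_br (V : normedModType R) (f g : V -> 'rV[R]_n) (x v : V)
    (df dg : 'rV[R]_n) :
    is_derive x v f df -> is_derive x v g dg ->
  is_derive x v (fun y => br (f y) (g y)) (br df (g x) + br (f x) dg).
Proof.
move=> dfx dgx; rewrite (_ : (fun y => _) =
    fun y => \sum_i f y 0 i *: (br_lin (delta_mx 0 i) \o g) y); last first.
  by apply/funext => y; exact: br_expand.
rewrite !br_expand -big_split; apply: is_derive_lincomb => // i.
exact: is_derive_linear.
Qed.

End Bracket.

(** * The Maurer-Cartan form of a local group and its integration *)

Section LocalGroup.
Context {R : realType} {n : nat}.
Context {br : 'rV[R]_n -> 'rV[R]_n -> 'rV[R]_n}.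
Context {P : {linear 'rV[R]_n -> 'rV[R]_n}}.
Hypothesis brP : two_step_bracket br P.
Variables (U : set 'rV[R]_n) (x0 : 'rV[R]_n).
(** In a chart with the identity at [x0], [mu x y] is the product and [de x y] is [x^-1 y]. Points
    of [U] may have their product outside [U]. Joint smoothness is stated on the concatenation of
    the two arguments. *)
Variables (mu de : 'rV[R]_n -> 'rV[R]_n -> 'rV[R]_n).
Let mu2 (z : 'rV[R]_(n + n)) := mu (lsubmx z) (rsubmx z).
Let de2 (z : 'rV[R]_(n + n)) := de (lsubmx z) (rsubmx z).
Hypothesis oU : open U.
Hypothesis Ux0 : U x0.
Hypothesis smooth_mu2 : forall x y, U x -> U y -> smooth_at mu2 (row_mx x y).
Hypothesis smooth_de2 : forall x y, U x -> U y -> smooth_at de2 (row_mx x y).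
Hypothesis de_mu2 : forall g x y, U g -> U x -> U y ->
  de (mu g x) (mu g y) = de x y.
Hypothesis de_mu : forall x y, U x -> U y -> de x (mu x y) = y.
Hypothesis mu_de : forall x y, U x -> U y -> mu x (de x y) = y.
Hypothesis mux0 : forall x, U x -> mu x x0 = x.
Hypothesis mu0x : forall x, U x -> mu x0 x = x.

(** [X v] is the left-invariant field with value [v] at [x0], and [om v x] is the Maurer-Cartan form
    at [x] applied to [v]: in [om] the point [x] is both the divisor and the place of
    differentiation. *)
Let X (v x : 'rV[R]_n) : 'rV[R]_n := 'D_v (mu x) x0.
Let om (v x : 'rV[R]_n) : 'rV[R]_n := 'D_v (de x) x.

Hypothesis br_def : forall u v, br u v = 'D_u (X v) x0 - 'D_v (X u) x0.

Fact rinj_linear : linear (fun y : 'rV[R]_n => row_mx 0 y : 'rV[R]_(n + n)).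
Proof. by move=> a u v; rewrite scale_row_mx add_row_mx scaler0 addr0. Qed.
Fact linj_linear : linear (fun y : 'rV[R]_n => row_mx y 0 : 'rV[R]_(n + n)).
Proof. by move=> a u v; rewrite scale_row_mx add_row_mx scaler0 addr0. Qed.
Fact diag_linear : linear (fun y : 'rV[R]_n => row_mx y y : 'rV[R]_(n + n)).
Proof. by move=> a u v; rewrite scale_row_mx add_row_mx. Qed.

Let rinj := lin_of rinj_linear.
Let linj := lin_of linj_linear.
Let diag := lin_of diag_linear.

Let rinjE x y : rinj y + row_mx x 0 = row_mx x y.
Proof. by rewrite /rinj /= add_row_mx add0r addr0. Qed.
Let linjE x y : linj x + row_mx 0 y = row_mx x y.
Proof. by rewrite /linj /= add_row_mx add0r addr0. Qed.

Let muE g : mu g = fun y => mu2 (rinj y + row_mx g 0).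
Proof. by apply/funext => y; rewrite rinjE /mu2 row_mxKl row_mxKr. Qed.
Let deE g : de g = fun y => de2 (rinj y + row_mx g 0).
Proof. by apply/funext => y; rewrite rinjE /de2 row_mxKl row_mxKr. Qed.

Lemma smooth_mu g x : U g -> U x -> smooth_at (mu g) x.
Proof.
by move=> Ug Ux; rewrite muE; apply: smooth_at_shift; rewrite rinjE; exact: smooth_mu2.
Qed.

Lemma smooth_de g x : U g -> U x -> smooth_at (de g) x.
Proof.
by move=> Ug Ux; rewrite deE; apply: smooth_at_shift; rewrite rinjE; exact: smooth_de2.
Qed.

Lemma smooth_X v x : U x -> smooth_at (X v) x.
Proof.
move=> Ux; have -> : X v = fun x => ('D_(rinj v) mu2) (linj x + row_mx 0 x0).
  by apply/funext => y; rewrite /X muE derive_on_shift rinjE linjE.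
apply: (@smooth_at_shift _ _ _ _ ('D_(rinj v) mu2) linj (row_mx 0 x0)).
by apply: smooth_at_derive; rewrite linjE; exact: smooth_mu2.
Qed.

Lemma smooth_om v x : U x -> smooth_at (om v) x.
Proof.
move=> Ux; have -> : om v = fun x => ('D_(rinj v) de2) (diag x + 0).
  by apply/funext => y; rewrite /om deE derive_on_shift rinjE addr0.
apply: (@smooth_at_shift _ _ _ _ ('D_(rinj v) de2) diag 0).
by apply: smooth_at_derive; rewrite addr0; exact: smooth_de2.
Qed.

Lemma om_lin v x : U x -> om v x = \sum_i v 0 i *: om (delta_mx 0 i) x.
Proof. by move=> Ux; rewrite /om smooth_deriveE_rV//; exact: smooth_de. Qed.

Let nearU x : U x -> \forall y \near x, U y.
Proof. by move=> Ux; exact: open_nbhs_nbhs. Qed.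

Let near_mu g x : U g -> U x -> U (mu g x) -> \forall y \near x, U (mu g y).
Proof.
move=> Ug Ux Ugx; have := smooth_at_continuous (smooth_mu Ug Ux); apply.
exact: nearU.
Qed.

(** Left invariance of the Maurer-Cartan form, from differentiating [de_mu2] in its last variable on
    the diagonal. *)
Lemma om_mu g x w : U g -> U x -> U (mu g x) ->
  om ('D_w (mu g) x) (mu g x) = om w x.
Proof.
move=> Ug Ux Ugx.
have := is_derive_comp (smooth_at_derivable (v := w) (smooth_mu Ug Ux))
  (smooth_at_differentiable (smooth_de Ugx Ugx)).
move=> /(@derive_val _ _ _ _ _ _ _) E; apply: etrans (esym E) _.
apply: near_eq_derive.
by apply: filterS (nearU Ux) => y Uy; rewrite /= de_mu2.
Qed.

Lemma om_X v x : U x -> om (X v x) x = v.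
Proof.
move=> Ux; have Ux0x : U (mu x x0) by rewrite mux0.
have := is_derive_comp (smooth_at_derivable (v := v) (smooth_mu Ux Ux0))
  (smooth_at_differentiable (smooth_de Ux Ux0x)).
rewrite mux0// => /(@derive_val _ _ _ _ _ _ _) E.
apply: etrans (esym E) _; rewrite (near_eq_derive (g := id)) ?derive_id//.
by apply: filterS (nearU Ux0) => y Uy; rewrite /= de_mu.
Qed.

Lemma X_om v x : U x -> X (om v x) x = v.
Proof.
move=> Ux; have dexx : de x x = x0 by rewrite -[X in de x X](mux0 Ux) de_mu.
have Udexx : U (de x x) by rewrite dexx.
have := is_derive_comp (smooth_at_derivable (v := v) (smooth_de Ux Ux))
  (smooth_at_differentiable (smooth_mu Ux Udexx)).
rewrite dexx => /(@derive_val _ _ _ _ _ _ _) E.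
apply: etrans (esym E) _; rewrite (near_eq_derive (g := id)) ?derive_id//.
by apply: filterS (nearU Ux) => y Uy; rewrite /= mu_de.
Qed.

Lemma X_x0 v : X v x0 = v.
Proof.
rewrite /X (near_eq_derive (g := id)) ?derive_id//.
by apply: filterS (nearU Ux0) => y Uy; rewrite mu0x.
Qed.

Lemma om_x0 v : om v x0 = v.
Proof. by rewrite -[in LHS](X_x0 v) om_X. Qed.

Lemma derive_om_lin a c g : U g ->
  'D_a (om c) g = \sum_i c 0 i *: 'D_a (om (delta_mx 0 i)) g.
Proof.
move=> Ug; have H := is_derive_lincomb (is_derive_cst c g a)
  (fun i => derivableP (smooth_at_derivable (v := a) (smooth_om (delta_mx 0 i) Ug))).
have := @derive_val _ _ _ _ _ _ _ H.
rewrite (near_eq_derive (g := om c)); last first.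
  by apply: filterS (nearU Ug) => y Uy; rewrite [RHS]om_lin.
by move=> ->; apply: eq_bigr => i _; rewrite mxE scale0r add0r.
Qed.

(** The invariance [om_mu] is differentiated at [x0]. The first term comes from the vector argument
    of [om], the second from its base point; expanding [om] linearly in the vector over the standard
    basis separates the two. *)
Lemma derive_om_left g u w : U g ->
  'D_u (om w) x0 = om ('D_u ('D_w (mu g)) x0) g + 'D_(X u g) (om (X w g)) g.
Proof.
move=> Ug; have smg := smooth_mu Ug Ux0.
have Ugx : U (mu g x0) by rewrite mux0.
have d1 := derivableP (smooth_at_derivable (v := u) (smooth_at_derive w smg)).
have d2 i := is_derive_comp (smooth_at_derivable (v := u) smg)
  (smooth_at_differentiable (smooth_om (delta_mx 0 i) Ugx)).
have H := is_derive_lincomb d1 d2.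
rewrite (om_lin _ Ug) (derive_om_lin _ _ Ug) -big_split /=.
rewrite (near_eq_derive (g := fun y => \sum_i ('D_w (mu g) y) 0 i *:
    (om (delta_mx 0 i) \o mu g) y)); last first.
  near=> y; rewrite -[RHS]om_lin; last by near: y; exact: near_mu.
  by rewrite om_mu//; near: y; [exact: nearU|exact: near_mu].
rewrite (@derive_val _ _ _ _ _ _ _ H).
by apply: eq_bigr => i _; rewrite /= mux0.
Unshelve. all: by end_near. Qed.

Lemma derive_om_leftE g u w a b : U g -> X u g = a -> X w g = b ->
  'D_u (om w) x0 = om ('D_u ('D_w (mu g)) x0) g + 'D_a (om b) g.
Proof. by move=> Ug <- <-; exact: derive_om_left. Qed.

(** The identity [om (X v y) y = v] has a constant right-hand side; its derivative at [x0] is the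
    sum of the two terms. *)
Lemma derive_om_x0 u v : 'D_u (om v) x0 = - 'D_u (X v) x0.
Proof.
have d1 := derivableP (smooth_at_derivable (v := u) (smooth_X v Ux0)).
have d2 i := derivableP (smooth_at_derivable (v := u) (smooth_om (delta_mx 0 i) Ux0)).
have H := @derive_val _ _ _ _ _ _ _ (is_derive_lincomb d1 d2).
rewrite (near_eq_derive (g := cst v)) ?derive_cst in H; last first.
  by apply: filterS (nearU Ux0) => y Uy; rewrite -om_lin// om_X.
rewrite big_split /= -om_lin// om_x0 X_x0 -derive_om_lin// in H.
by apply/eqP; rewrite -addr_eq0 addrC -H.
Qed.

(** The Maurer-Cartan equation. By [derive_om_left], with [om a g] and [om b g] in either order,
    both derivatives are pulled back to [x0]; the second derivatives of [mu g] agree by Schwarz and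
    drop out, and what remains at [x0] is [br_def] up to sign. *)
Lemma om_closed g a b : U g ->
  'D_a (om b) g - 'D_b (om a) g = - br (om a g) (om b g).
Proof.
move=> Ug; have EL := derive_om_leftE Ug (X_om a Ug) (X_om b Ug).
have ER := derive_om_leftE Ug (X_om b Ug) (X_om a Ug).
have S := congr1 (om ^~ g) (derive_swap_rV (om a g) (om b g) (smooth_mu Ug Ux0)).
have alg (p q o1 o2 t1 t2 : 'rV[R]_n) :
    p = o1 + t1 -> q = o2 + t2 -> o1 = o2 -> t1 - t2 = p - q.
  by move=> -> -> ->; rewrite opprD addrACA subrr add0r.
have alg2 (p q : 'rV[R]_n) : - p - - q = - (p - q) by rewrite opprD.
apply: etrans (alg _ _ _ _ _ _ EL ER S) _.
have D1 := derive_om_x0 (om a g) (om b g).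
have D2 := derive_om_x0 (om b g) (om a g).
apply: etrans (congr2 (fun p q : 'rV[R]_n => p - q) D1 D2) _.
exact: etrans (alg2 _ _) (congr1 -%R (esym (br_def _ _))).
Qed.

Lemma is_derive_om v x w : U x -> is_derive x w (om v) ('D_w (om v) x).
Proof. by move=> Ux; apply: derivableP; exact: smooth_at_derivable (smooth_om v Ux). Qed.

Lemma row_mx_norm (a b : 'rV[R]_n) :
  `|row_mx a b : 'rV[R]_(n + n)| <= Num.max `|a| `|b|.
Proof.
apply: rV_norm_le; first by rewrite le_max normr_ge0.
move=> i; rewrite mxE; case: splitP => j _; rewrite le_max coord_le_norm ?orbT//.
Qed.

Lemma near_mu2 d : 0 < d -> exists2 r, 0 < r &
  forall g x, `|g - x0| < r -> `|x - x0| < r -> `|mu g x - x0| < d.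
Proof.
move=> d0; have := smooth_at_continuous (smooth_mu2 Ux0 Ux0).
have mu2x0 : mu2 (row_mx x0 x0) = x0 by rewrite /mu2 row_mxKl row_mxKr mux0.
have xd : nbhs (mu2 (row_mx x0 x0)) (ball x0 d).
  by rewrite mu2x0; exact: nbhsx_ballx.
move=> /(_ _ xd) /nbhs_ballP[r /= r0 Hr]; exists r => // g x gr xr.
have := Hr (row_mx g x); rewrite -!ball_normE /= /mu2 row_mxKl row_mxKr.
rewrite distrC => H; rewrite distrC; apply: H.
rewrite opp_row_mx add_row_mx (le_lt_trans (row_mx_norm _ _))//.
by rewrite gt_max gr.
Qed.

(** The algebra behind the closedness of [omega + br F omega / 2]: the defect [- br p q] is
    compensated by half of [br p q - br q p], and [br f] annihilates the difference [A - B], which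
    is a bracket. *)
Lemma closed_correction (A B p q f : 'rV[R]_n) : A - B = - br p q ->
  A + 2^-1 *: (br (P p) q + br f A) = B + 2^-1 *: (br (P q) p + br f B).
Proof.
move=> /eqP; rewrite subr_eq => /eqP ->; rewrite !(br_P brP) (brDr brP) (brNr brP).
rewrite (br_br brP) oppr0 add0r (brC brP q p).
by apply/rowP => k; rewrite !mxE; field.
Qed.

(** The multiplicativity of the logarithm [Phi] is proved in the variable [x], with [g] fixed: both
    sides agree at [x0] and have the same derivative, by the left invariance of [om] and the
    additivity of [F]. *)
Lemma local_exp : exists2 r : R, 0 < r & exists2 Phi : 'rV[R]_n -> 'rV[R]_n,
  Phi x0 = 0 &
  [/\ forall x, `|x - x0| < r -> U x /\ smooth_at Phi x,
      forall x w, `|x - x0| < r ->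
        is_derive x w Phi (om w x + 2^-1 *: br (Phi x) (om w x)) &
      forall g x, `|g - x0| < r -> `|x - x0| < r ->
        Phi (mu g x) = Phi g + Phi x + 2^-1 *: br (Phi g) (Phi x)].
Proof.
have /nbhs_ballP[rU /= rU0 HU] := nearU Ux0.
have {}HU x : `|x - x0| < rU -> U x.
  by move=> xr; apply: HU; rewrite -ball_normE /= distrC.
have dP v x w : U x -> is_derive x w (P \o om v) (P ('D_w (om v) x)).
  by move=> Ux; apply: is_derive_linear; exact: is_derive_om.
have [||r1 /andP[r10 r1U] [F F0 HF]] :=
    @poincare_rV R n n (fun i => P \o om (delta_mx 0 i)) x0 rU rU0.
- by move=> i x xr; apply: smooth_at_linear_comp; apply: smooth_om; exact: HU.
- move=> i j x /HU Ux.
  apply: etrans (@derive_val _ _ _ _ _ _ _ (dP _ _ _ Ux)) _.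
  apply: etrans _ (esym (@derive_val _ _ _ _ _ _ _ (dP _ _ _ Ux))).
  apply/eqP; rewrite -subr_eq0 -linearB.
  by rewrite (om_closed _ _ Ux) linearN (P_br brP) oppr0.
have {}HU x : `|x - x0| < r1 -> U x by move=> xr; apply/HU/(lt_le_trans xr).
have dF x w : `|x - x0| < r1 -> is_derive x w F (P (om w x)).
  move=> xr; have := (HF x xr).2 w; congr is_derive.
  rewrite (om_lin w (HU x xr)) linear_sum; apply: eq_bigr => i _.
  by rewrite linearZ.
pose b i x := om (delta_mx 0 i) x + 2^-1 *: br (F x) (om (delta_mx 0 i) x).
have db i x w : `|x - x0| < r1 -> is_derive x w (b i)
    ('D_w (om (delta_mx 0 i)) x + 2^-1 *:
      (br (P (om w x)) (om (delta_mx 0 i) x)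
       + br (F x) ('D_w (om (delta_mx 0 i)) x))).
  move=> xr; have H := is_derive_om (delta_mx 0 i) w (HU x xr).
  exact: is_deriveD H (is_deriveZ _ (is_derive_br brP (dF x w xr) H)).
have [||r2 /andP[r20 r21] [Phi Phi0 HPhi]] := @poincare_rV R n n b x0 r1 r10.
- move=> i x xr; have H := smooth_om (delta_mx 0 i) (HU x xr).
  apply: smooth_at_add => //.
  exact: (smooth_at_linear_comp (GRing.scale 2^-1)
    (smooth_at_br brP (HF x xr).1 H)).
- move=> i j x xr; have Ux := HU x xr.
  apply: etrans (@derive_val _ _ _ _ _ _ _ (db i x _ xr)) _.
  apply: etrans _ (esym (@derive_val _ _ _ _ _ _ _ (db j x _ xr))).
  exact: closed_correction (om_closed (delta_mx 0 j) (delta_mx 0 i) Ux).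
have dPhiF x w : `|x - x0| < r2 ->
    is_derive x w Phi (om w x + 2^-1 *: br (F x) (om w x)).
  move=> xr; have xr1 : `|x - x0| < r1 by exact: lt_le_trans r21.
  have := (HPhi x xr).2 w; congr is_derive.
  rewrite [in RHS](om_lin w (HU x xr1)) -[in RHS](br_linE brP) linear_sum.
  rewrite scaler_sumr -big_split; apply: eq_bigr => i _ /=.
  by rewrite /b scalerDr (br_linE brP) (brZr brP) !scalerA (mulrC (w 0 i)).
(* [P] annihilates the correction term, so [P \o Phi] and [F] have the same derivative and the same
   value at [x0]. This allows [Phi] to replace [F] in the derivative of [Phi]. *)
have PPhi x : `|x - x0| < r2 -> P (Phi x) = F x.
  have := @same_derive_eq _ _ _ (P \o Phi) F (fun x w => P (om w x)) x0 r2 _ _ x.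
  rewrite /= Phi0 F0 linear0 !subr0; apply=> y w yr; last first.
    by apply: dF; exact: lt_le_trans r21.
  have := is_derive_linear P (dPhiF y w yr).
  by rewrite linearD linearZ_LR (P_br brP) scaler0 addr0.
have dPhi x w : `|x - x0| < r2 ->
    is_derive x w Phi (om w x + 2^-1 *: br (Phi x) (om w x)).
  by move=> xr; rewrite -(br_P brP (Phi x)) PPhi//; exact: dPhiF.
have [r3 r30 Hr3] := near_mu2 r20.
pose r := Num.min r2 r3.
have r0 : 0 < r by rewrite lt_min r20.
have rr2 x : `|x - x0| < r -> `|x - x0| < r2.
  by move=> xr; rewrite (lt_le_trans xr)// ge_min lexx.
have rr1 x : `|x - x0| < r -> `|x - x0| < r1.
  by move=> xr; rewrite (lt_le_trans (rr2 x xr)).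
have rmu g x : `|g - x0| < r -> `|x - x0| < r -> `|mu g x - x0| < r2.
  by move=> gr xr; apply: Hr3; rewrite (lt_le_trans gr, lt_le_trans xr)// ge_min lexx orbT.
have x0r : `|x0 - x0| < r by rewrite subrr normr0.
have d_mu g x w : `|g - x0| < r -> `|x - x0| < r ->
    is_derive x w (mu g) ('D_w (mu g) x).
  by move=> gr xr; apply: derivableP; apply: smooth_at_derivable;
    apply: smooth_mu; apply: HU; exact: rr1.
have om_mu_r g x w : `|g - x0| < r -> `|x - x0| < r ->
    om ('D_w (mu g) x) (mu g x) = om w x.
  move=> gr xr; apply: om_mu; apply: HU; try exact: rr1.
  by rewrite (lt_le_trans (rmu g x gr xr)).
have F_mu g x : `|g - x0| < r -> `|x - x0| < r -> F (mu g x) = F g + F x.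
  move=> gr xr; have Ug : U g by apply: HU; exact: rr1.
  have := @same_derive_eq _ _ _ (F \o mu g) F (fun x w => P (om w x)) x0 r _ _ x xr.
  rewrite /= mux0// F0 subr0 => H; apply/eqP; rewrite addrC -subr_eq; apply/eqP.
  apply: H => y w yr; last by apply: dF; exact: rr1.
  have mr1 : `|mu g y - x0| < r1 by rewrite (lt_le_trans (rmu g y gr yr)).
  have := is_derive_comp (@ex_derive _ _ _ _ _ _ _ (d_mu g y w gr yr))
    (smooth_at_differentiable (HF _ mr1).1).
  by rewrite (@derive_val _ _ _ _ _ _ _ (dF _ _ mr1)) om_mu_r.
exists r => //; exists Phi => //; split.
- by move=> x xr; split; [apply: HU; exact: rr1|exact: (HPhi x (rr2 x xr)).1].
- by move=> x w xr; apply: dPhi; exact: rr2.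
move=> g x gr xr; have Ug : U g by apply: HU; exact: rr1.
(* The common derivative of the two sides. For the right-hand side, the nested bracket of [F g] with
   [br (F y) (om w y)] vanishes. *)
pose d y w := om w y + 2^-1 *: br (F (mu g y)) (om w y).
have := @same_derive_eq _ _ _ (Phi \o mu g)
  (Phi + 2^-1 *: (br_lin brP (F g) \o Phi)) d x0 r _ _ x xr.
rewrite !fctE /= Phi0 mux0// linear0 scaler0 addr0 subr0 => H.
apply/eqP; rewrite -(br_P brP) (PPhi g (rr2 g gr)) -addrA addrC -subr_eq.
rewrite -(br_linE brP); apply/eqP; apply: H => y w yr.
  have := is_derive_comp (@ex_derive _ _ _ _ _ _ _ (d_mu g y w gr yr))
    (smooth_at_differentiable (HPhi _ (rmu g y gr yr)).1).
  by rewrite (@derive_val _ _ _ _ _ _ _ (dPhiF _ _ (rmu g y gr yr))) om_mu_r.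
have -> : d y w = (om w y + 2^-1 *: br (F y) (om w y))
    + 2^-1 *: br_lin brP (F g) (om w y + 2^-1 *: br (F y) (om w y)).
  rewrite /d (F_mu g y gr yr) (br_linE brP) (brDl brP) (brDr brP) (brZr brP).
  by rewrite (br_br brP) scaler0 addr0 scalerDr (addrC (_ *: _)) addrA.
have dy := dPhiF y w (rr2 y yr).
exact: is_deriveD dy (is_deriveZ _ (is_derive_linear _ dy)).
Qed.

Lemma local_coordinates : exists (r rho : R) (Phi sig : 'rV[R]_n -> 'rV[R]_n),
  [/\ 0 < r, 0 < rho, Phi x0 = 0, forall w, 'D_w Phi x0 = w &
    [/\ forall x, `|x - x0| < r -> U x /\ smooth_at Phi x,
        forall g x, `|g - x0| < r -> `|x - x0| < r ->
          Phi (mu g x) = Phi g + Phi x + 2^-1 *: br (Phi g) (Phi x),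
        forall x y, `|x - x0| < r -> `|y - x0| < r -> Phi x = Phi y -> x = y &
        forall z, `|z| < rho ->
          [/\ `|sig z - x0| < r, Phi (sig z) = z & smooth_at sig z]]].
Proof.
have [r0 r00 [Phi Phi0 [Usm dPhi hom]]] := local_exp.
have x0r : `|x0 - x0| < r0 by rewrite subrr normr0.
have D0 w : 'D_w Phi x0 = w.
  rewrite (@derive_val _ _ _ _ _ _ _ (dPhi x0 w x0r)) Phi0 om_x0 (br0l brP).
  by rewrite scaler0 addr0.
(* The inverse of the differential of [Phi]: as nested brackets vanish, [w |-> w - br (Phi x) w / 2]
   inverts [v |-> v + br (Phi x) v / 2], and [X] inverts [om]. The expansion over the standard basis
   displays the smoothness in [x]. *)
pose B w x := \sum_i (w - 2^-1 *: br (Phi x) w) 0 i *: X (delta_mx 0 i) x.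
have BE w x : U x -> B w x = X (w - 2^-1 *: br (Phi x) w) x.
  by move=> Ux; rewrite /X (smooth_deriveE_rV _ (smooth_mu Ux Ux0)).
have [|r [rho [sig [/andP[r_gt0 rr0] rho0 inj inv]]]] :=
    @inverse_function R n Phi B x0 r0 r00 D0.
  move=> x w xr; have [Ux sPhi] := Usm x xr; split=> //.
    apply: smooth_at_lincomb; last by move=> i; exact: smooth_X.
    apply: smooth_at_add; first exact: smooth_at_cst.
    have -> : (fun y => - (2^-1 *: br (Phi y) w)) =
        (GRing.scale (- 2^-1)) \o (fun y => br (Phi y) w).
      by apply/funext => y; rewrite /= scaleNr.
    apply: (smooth_at_linear_comp (GRing.scale (- 2^-1))).
    by apply: (@smooth_at_br _ _ _ _ brP _ Phi (cst w)) => //; exact: smooth_at_cst.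
  rewrite BE// (@derive_val _ _ _ _ _ _ _ (dPhi x _ xr)) om_X//.
  rewrite (brDr brP) (brNr brP) (brZr brP) (br_br brP) scaler0 oppr0 addr0.
  by rewrite subrK.
exists r, rho, Phi, sig; split=> //; split=> //.
- by move=> x xr; apply: Usm; exact: lt_le_trans rr0.
- by move=> g x gr xr; apply: hom; [exact: lt_le_trans gr rr0|exact: lt_le_trans xr rr0].
- by move=> z zr; apply: inv; rewrite Phi0 subr0.
Qed.

End LocalGroup.

(** * Charts of a Lie group *)

Section Charts.
Context {R : realType}.

Section Chart.
Context {m : nat} {M : topologicalType} (c : chart R m M).

Lemma ccoord_continuous p : cdom c p -> {for p, continuous (ccoord c)}.
Proof.
move=> cp; have := @Defs.coord_continuous _ _ _ c.
rewrite continuous_open_subspace; last exact: dom_open.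
by apply; rewrite inE.
Qed.

Lemma cparam_continuous x : (ccoord c @` cdom c) x ->
  {for x, continuous (cparam c)}.
Proof.
move=> cx; have := @param_continuous _ _ _ c.
rewrite continuous_open_subspace; last exact: codom_open.
by apply; rewrite inE.
Qed.

Lemma paramK x : (ccoord c @` cdom c) x ->
  cdom c (cparam c x) /\ ccoord c (cparam c x) = x.
Proof. by move=> [p cp <-]; rewrite coordK. Qed.

Lemma near_codom p : cdom c p ->
  \forall x \near ccoord c p, (ccoord c @` cdom c) x.
Proof.
move=> cp; apply: open_nbhs_nbhs; split; first exact: codom_open.
by exists p.
Qed.

Lemma near_param (A : set M) p : cdom c p -> nbhs p A ->
  \forall x \near ccoord c p, A (cparam c x).
Proof.
move=> cp pA; have cx : (ccoord c @` cdom c) (ccoord c p) by exists p.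
by apply: (cparam_continuous cx); rewrite coordK.
Qed.

End Chart.

Context {m n : nat} {M : manifold R m} {N : manifold R n}.
Implicit Types (f : M -> N) (p q : M).

Lemma nbhs_cdom {k} {L : manifold R k} (q p : L) : cdom (chart_at q) p ->
  nbhs p (cdom (chart_at q)).
Proof. by move=> qp; apply: open_nbhs_nbhs; split=> //; exact: dom_open. Qed.

Lemma smooth_map_at f p (q : N) a : smooth_map f ->
    cdom (chart_at p) a -> cdom (chart_at q) (f a) ->
  smooth_at (ccoord (chart_at q) \o f \o cparam (chart_at p))
    (ccoord (chart_at p) a).
Proof.
move=> [cf sf] pa qfa; exists (ccoord (chart_at p) @`
  (cdom (chart_at p) `&` f @^-1` cdom (chart_at q))); last exact: sf.
have H : nbhs a (cdom (chart_at p) `&` f @^-1` cdom (chart_at q)).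
  by apply: filterI; [exact: nbhs_cdom|apply: cf; exact: nbhs_cdom].
apply: filterS (filterI (near_codom pa) (near_param pa H)) => x [cx Hx].
by exists (cparam (chart_at p) x) => //; exact: (paramK cx).2.
Qed.

Lemma transition_smooth {k} {L : manifold R k} (p q a : L) :
    cdom (chart_at p) a -> cdom (chart_at q) a ->
  smooth_at (ccoord (chart_at q) \o cparam (chart_at p)) (ccoord (chart_at p) a).
Proof.
move=> pa qa; exists (ccoord (chart_at p) @`
  (cdom (chart_at p) `&` cdom (chart_at q))); last exact: chart_compat.
have H : nbhs a (cdom (chart_at p) `&` cdom (chart_at q)).
  by apply: filterI; exact: nbhs_cdom.
apply: filterS (filterI (near_codom pa) (near_param pa H)) => x [cx Hx].
by exists (cparam (chart_at p) x) => //; exact: (paramK cx).2.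
Qed.

(** Any other pair of charts differs from the preferred ones at [a] and [f a] by transition maps,
    which are smooth. *)
Lemma smooth_mapP f : continuous f ->
    (forall p, smooth_at (ccoord (chart_at (f p)) \o f \o cparam (chart_at p))
      (ccoord (chart_at p) p)) ->
  smooth_map f.
Proof.
move=> cf sf; split=> // p q.
set D := (_ @` _); set F := (_ \o _).
suff H : forall x, D x -> smooth_at F x.
  have [E DE [_ FE]] := (smooth_on_at D F).1 H.
  by move=> k; exact: Ck_on_sub DE (FE k).
move=> x [a [pa qfa] <-].
have sa := sf a; have aa := mem_chart_at a; have faa := mem_chart_at (f a).
have s1 := transition_smooth pa aa.
have s3 := transition_smooth faa qfa.
have s12 : smooth_at ((ccoord (chart_at (f a)) \o f \o cparam (chart_at a))
    \o (ccoord (chart_at a) \o cparam (chart_at p))) (ccoord (chart_at p) a).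
  by apply: smooth_at_comp => //=; rewrite coordK.
have s123 : smooth_at ((ccoord (chart_at q) \o cparam (chart_at (f a))) \o
    ((ccoord (chart_at (f a)) \o f \o cparam (chart_at a))
    \o (ccoord (chart_at a) \o cparam (chart_at p)))) (ccoord (chart_at p) a).
  by apply: smooth_at_comp => //=; rewrite !coordK.
apply: smooth_at_eq s123.
have H : nbhs a (cdom (chart_at a) `&` f @^-1` cdom (chart_at (f a))).
  by apply: filterI; [exact: nbhs_cdom|apply: cf; exact: nbhs_cdom].
apply: filterS (near_param pa H) => y [ay fay].
by rewrite /F /= (coordK ay) (coordK fay).
Qed.

Lemma smooth_map2_at {k} {L : manifold R k} (f : M -> N -> L)
    (p a : M) (q b : N) (r : L) : smooth_map2 f ->
    cdom (chart_at p) a -> cdom (chart_at q) b -> cdom (chart_at r) (f a b) ->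
  smooth_at (fun w : 'rV[R]_m * 'rV[R]_n => ccoord (chart_at r)
      (f (cparam (chart_at p) w.1) (cparam (chart_at q) w.2)))
    (ccoord (chart_at p) a, ccoord (chart_at q) b).
Proof.
move=> [cf sf] pa qb rfab.
have sfr := sf p q r; set D := (X in smooth_on X _) in sfr.
exists D => //.
have H : nbhs (a, b) (fun z : M * N => cdom (chart_at r) (f z.1 z.2)).
  by apply: (cf (a, b)); exact: nbhs_cdom.
have [[A B] /= [aA bB] AB] := H.
exists ((ccoord (chart_at p) @` cdom (chart_at p)) `&`
          [set x | A (cparam (chart_at p) x)],
        (ccoord (chart_at q) @` cdom (chart_at q)) `&`
          [set y | B (cparam (chart_at q) y)]) => /=.
  by split; apply: filterI; [exact: near_codom|exact: near_param|
    exact: near_codom|exact: near_param].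
move=> [x y] /= [[cx Ax] [cy By]].
exists (cparam (chart_at p) x, cparam (chart_at q) y) => /=.
  split; [exact: (paramK cx).1|exact: (paramK cy).1|].
  exact: (AB (_, _)).
by rewrite (paramK cx).2 (paramK cy).2.
Qed.

End Charts.

Section GroupLaws.
Context {R : realType} {m : nat} (G : lieGroup R m).
Implicit Types p q : G.

Lemma lmulKg p q : lmul (linv p) (lmul p q) = q.
Proof. by rewrite lmulA lmulVg lmul1g. Qed.

Lemma lmulgV p : lmul p (linv p) = lone G.
Proof.
rewrite -[LHS](lmulKg (linv p)) [lmul (linv p) (lmul _ _)]lmulA lmulVg lmul1g.
by rewrite lmulVg.
Qed.

Lemma lmulg1 p : lmul p (lone G) = p.
Proof. by rewrite -(lmulVg p) lmulA lmulgV lmul1g. Qed.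

Lemma lmulVKg p q : lmul p (lmul (linv p) q) = q.
Proof. by rewrite lmulA lmulgV lmul1g. Qed.

Lemma linv_unique p q : lmul p q = lone G -> linv p = q.
Proof. by move=> pq; rewrite -(lmulKg p q) pq lmulg1. Qed.

Lemma linvM p q : linv (lmul p q) = lmul (linv q) (linv p).
Proof.
by apply: linv_unique; rewrite lmulA -(lmulA p) lmulgV lmulg1 lmulgV.
Qed.

Lemma linv1 : linv (lone G) = lone G.
Proof. by apply: linv_unique; exact: lmul1g. Qed.

Lemma ldivMM g p q : lmul (linv (lmul g p)) (lmul g q) = lmul (linv p) q.
Proof. by rewrite linvM -lmulA lmulKg. Qed.

Lemma lmul_continuous : continuous (fun z : G * G => lmul z.1 z.2).
Proof. exact: (lmul_smooth G).1. Qed.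

Lemma linv_continuous : continuous (@linv R m G : G -> G).
Proof. exact: (linv_smooth G).1. Qed.

Lemma lmul_cvg (T : topologicalType) (f g : T -> G) (x : T) :
    {for x, continuous f} -> {for x, continuous g} ->
  {for x, continuous (fun y => lmul (f y) (g y))}.
Proof.
move=> cf cg; apply: (@continuous_comp _ _ _ (fun y => (f y, g y))
  (fun z : G * G => lmul z.1 z.2)).
  exact: cvg_pair.
exact: lmul_continuous.
Qed.

End GroupLaws.

Lemma continuous_pair_at (T S1 S2 : topologicalType) (f : T -> S1) (g : T -> S2) x :
    {for x, continuous f} -> {for x, continuous g} ->
  {for x, continuous (fun y => (f y, g y))}.
Proof. by move=> cf cg; exact: cvg_pair. Qed.

Lemma smooth_at_row_mx {R : realType} (V : normedModType R) n p
    (f : V -> 'rV[R]_n) (g : V -> 'rV[R]_p) (x : V) :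
    smooth_at f x -> smooth_at g x ->
  smooth_at (fun y => row_mx (f y) (g y) : 'rV[R]_(n + p)) x.
Proof.
move=> /smooth_at_coordP sf /smooth_at_coordP sg; apply/smooth_at_coordP => i.
rewrite (_ : (fun y => _) = fun y => match fintype.split i with
    inl j => f y 0 j | inr j => g y 0 j end).
  by case: (fintype.split i).
by apply/funext => y; rewrite mxE.
Qed.

(** * The group law in the chart at the identity *)

Section LieLocal.
Context {R : realType} {m : nat} (G : lieGroup R m).
Let e : G := lone G.
Let c := chart_at e.
Let x0 := ccoord c e.
Let U := [set x | exists p, cdom c p /\ ccoord c p = x].

Let ce : cdom c e. Proof. exact: mem_chart_at. Qed.

Lemma nbhs_group : exists W : set G, [/\ nbhs e W, W `<=` cdom c &
  forall p q, W p -> W q ->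
    [/\ cdom c (lmul p q), cdom c (lmul (linv p) q) & cdom c (linv p)]].
Proof.
have nc : nbhs e (cdom c) by exact: nbhs_cdom.
have [[A1 A2] /= [A1e A2e] HA] : nbhs (e, e) (fun z : G * G => cdom c (lmul z.1 z.2)).
  by apply: (@lmul_continuous _ _ G (e, e)); rewrite /= lmul1g.
have cinv : {for e, continuous (@linv R m G)} by exact: linv_continuous.
have inve : nbhs e (fun p : G => cdom c (linv p)).
  by apply: cinv; rewrite linv1.
have [[B1 B2] /= [B1e B2e] HB] :
    nbhs (e, e) (fun z : G * G => cdom c (lmul (linv z.1) z.2)).
  have : {for (e, e), continuous (fun z : G * G => lmul (linv z.1) z.2)}.
    apply: lmul_cvg; last exact: cvg_snd.
    apply: (@continuous_comp _ _ _ (fun z : G * G => z.1) (@linv R m G)).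
      exact: cvg_fst.
    exact: cinv.
  by apply; rewrite /= linv1 lmul1g.
exists (cdom c `&` (fun p : G => cdom c (linv p)) `&` (A1 `&` A2) `&` (B1 `&` B2)).
split; first by do ?apply: filterI.
  by move=> p [[[]]].
move=> p q [[[cp cip] [A1p A2p]] [B1p B2p]] [[[cq ciq] [A1q A2q]] [B1q B2q]].
by split=> //; [exact: (HA (p, q))|exact: (HB (p, q))].
Qed.

Let lsub_linear : linear (fun z : 'rV[R]_(m + m) => lsubmx z).
Proof. by move=> a u v; apply/rowP => i; rewrite !mxE. Qed.
Let rsub_linear : linear (fun z : 'rV[R]_(m + m) => rsubmx z).
Proof. by move=> a u v; apply/rowP => i; rewrite !mxE. Qed.

Let smooth_lsub (z : 'rV[R]_(m + m)) : smooth_at (fun z : 'rV[R]_(m + m) => lsubmx z) z.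
Proof.
apply: (@smooth_at_linear _ _ _ (lin_of lsub_linear)).
exact: rV_linear_continuous.
Qed.
Let smooth_rsub (z : 'rV[R]_(m + m)) : smooth_at (fun z : 'rV[R]_(m + m) => rsubmx z) z.
Proof.
apply: (@smooth_at_linear _ _ _ (lin_of rsub_linear)).
exact: rV_linear_continuous.
Qed.

Let mu (x y : 'rV[R]_m) : 'rV[R]_m := ccoord c (lmul (cparam c x) (cparam c y)).
Let de (x y : 'rV[R]_m) : 'rV[R]_m := ccoord c (lmul (linv (cparam c x)) (cparam c y)).

(** The pair of arguments is replaced by a concatenated row vector, the setting in which smooth maps
    are composed. *)
Lemma smooth_mul_chart (p q : G) :
    cdom c p -> cdom c q -> cdom c (lmul p q) ->
  smooth_at (fun z : 'rV[R]_(m + m) => mu (lsubmx z) (rsubmx z))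
    (row_mx (ccoord c p) (ccoord c q)).
Proof.
move=> cp cq cpq; have H := smooth_map2_at (lmul_smooth G) cp cq cpq.
pose A (z : 'rV[R]_(m + m)) := (lsubmx z, rsubmx z).
apply: (@smooth_at_affine _ _ _ _ (fun w : 'rV[R]_m * 'rV[R]_m => mu w.1 w.2) A A).
- move=> z; apply: continuous_pair_at.
    apply: (@smooth_at_continuous _ 'rV[R]_(m + m) 'rV[R]_m (fun z => lsubmx z)).
    exact: smooth_lsub.
  apply: (@smooth_at_continuous _ 'rV[R]_(m + m) 'rV[R]_m (fun z => rsubmx z)).
  exact: smooth_rsub.
- move=> x v h; rewrite /A; congr (_, _); first exact: lsub_linear.
  exact: rsub_linear.
- by rewrite /A row_mxKl row_mxKr.
Qed.

Lemma smooth_div_chart (p q : G) :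
    cdom c p -> cdom c q -> cdom c (linv p) -> cdom c (lmul (linv p) q) ->
  smooth_at (fun z : 'rV[R]_(m + m) => de (lsubmx z) (rsubmx z))
    (row_mx (ccoord c p) (ccoord c q)).
Proof.
move=> cp cq cip cpq.
pose iota := ccoord c \o (@linv R m G) \o cparam c.
have siota : smooth_at iota (ccoord c p) := smooth_map_at (linv_smooth G) cp cip.
have sl := smooth_lsub (row_mx (ccoord c p) (ccoord c q)).
have sr := smooth_rsub (row_mx (ccoord c p) (ccoord c q)).
have sil : smooth_at (iota \o (fun z : 'rV[R]_(m + m) => lsubmx z))
    (row_mx (ccoord c p) (ccoord c q)).
  by apply: smooth_at_comp => //=; rewrite row_mxKl.
have s := smooth_at_row_mx sil sr.
have smu := smooth_mul_chart cip cq cpq.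
have : smooth_at ((fun z : 'rV[R]_(m + m) => mu (lsubmx z) (rsubmx z)) \o
   (fun z : 'rV[R]_(m + m) => row_mx (iota (lsubmx z)) (rsubmx z) : 'rV[R]_(m + m)))
   (row_mx (ccoord c p) (ccoord c q)).
  apply: smooth_at_comp; first exact: s.
  by rewrite row_mxKl row_mxKr /iota /= coordK.
apply: smooth_at_eq.
have H : \forall x \near lsubmx (row_mx (ccoord c p) (ccoord c q)),
    cdom c (linv (cparam c x)).
  rewrite row_mxKl.
  apply: (@near_param _ _ _ c (fun p : G => cdom c (linv p)) p) => //.
  by apply: (@linv_continuous _ _ G p); exact: nbhs_cdom.
have Hz : \forall z \near row_mx (ccoord c p) (ccoord c q) : 'rV[R]_(m + m),
    cdom c (linv (cparam c (lsubmx z))).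
  have := smooth_at_continuous sl; move=> /(_ _ H); exact.
near=> z; have Hz1 : cdom c (linv (cparam c (lsubmx z))) by near: z; exact: Hz.
by rewrite /= /mu /de row_mxKl row_mxKr /iota /= coordK.
Unshelve. all: by end_near. Qed.

Variable P : {linear 'rV[R]_m -> 'rV[R]_m}.
Hypothesis brP : two_step_bracket (lie_bracket G) P.

Lemma local_iso : exists (W : set G) (rho : R) (phi : G -> 'rV[R]_m)
    (sig : 'rV[R]_m -> G),
  [/\ nbhs e W, 0 < rho, phi e = 0 &
    forall p q, W p -> W q -> phi (lmul p q) =
      phi p + phi q + 2^-1 *: lie_bracket G (phi p) (phi q)] /\
  [/\ forall p q, W p -> W q -> phi p = phi q -> p = q,
      forall z, `|z| < rho ->
        [/\ W (sig z), phi (sig z) = z & {for z, continuous sig}],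
      {for e, continuous phi},
      smooth_at (phi \o cparam c) x0 /\ (forall w, 'D_w (phi \o cparam c) x0 = w) &
      smooth_at (ccoord c \o sig) 0].
Proof.
have [W [We Wc HW]] := nbhs_group.
have : \forall x \near x0, (ccoord c @` cdom c) x /\ W (cparam c x).
  by apply: filterI; [exact: near_codom|exact: near_param].
move=> /nbhs_ballP[r1 /= r10 Hr1].
pose V := ball x0 r1.
have VW x : V x -> W (cparam c x) by move=> /Hr1[].
have Vc x : V x -> cdom c (cparam c x) by move=> /VW /Wc.
have VK x : V x -> ccoord c (cparam c x) = x by move=> /Hr1[/paramK[]].
have Vx0 : V x0 by exact: ballxx.
have x0K : cparam c x0 = e by rewrite /x0 coordK.
have mulx0 v : V v -> mu v x0 = v by move=> Vv; rewrite /mu x0K lmulg1 VK.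
have mux0' v : V v -> mu x0 v = v by move=> Vv; rewrite /mu x0K lmul1g VK.
have smu x y : V x -> V y ->
    smooth_at (fun z : 'rV[R]_(m + m) => mu (lsubmx z) (rsubmx z)) (row_mx x y).
  move=> Vx Vy; rewrite -(VK x Vx) -(VK y Vy).
  have [h1 h2 h3] := HW _ _ (VW x Vx) (VW y Vy).
  by apply: smooth_mul_chart => //; exact: Vc.
have sde x y : V x -> V y ->
    smooth_at (fun z : 'rV[R]_(m + m) => de (lsubmx z) (rsubmx z)) (row_mx x y).
  move=> Vx Vy; rewrite -(VK x Vx) -(VK y Vy).
  have [h1 h2 h3] := HW _ _ (VW x Vx) (VW y Vy).
  by apply: smooth_div_chart => //; exact: Vc.
have de_mu2 g x y : V g -> V x -> V y -> de (mu g x) (mu g y) = de x y.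
  move=> Vg Vx Vy; rewrite /de /mu.
  have [h1 _ _] := HW _ _ (VW g Vg) (VW x Vx).
  have [h2 _ _] := HW _ _ (VW g Vg) (VW y Vy).
  by rewrite !coordK// ldivMM.
have de_mu x y : V x -> V y -> de x (mu x y) = y.
  move=> Vx Vy; have [h1 _ _] := HW _ _ (VW x Vx) (VW y Vy).
  by rewrite /de /mu coordK// lmulKg VK.
have mu_de x y : V x -> V y -> mu x (de x y) = y.
  move=> Vx Vy; have [_ h1 _] := HW _ _ (VW x Vx) (VW y Vy).
  by rewrite /de /mu coordK// lmulVKg VK.
have oV : open V by exact: ball_open.
(* The directions of differentiation in [lie_bracket] are values of left-invariant fields at [x0],
   hence the vectors themselves; this brings the bracket to the form required by
   [local_coordinates]. *)
have left_field_x0 u : left_field G u x0 = u.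
  exact: (X_x0 oV Vx0 mux0').
have br_def u v : lie_bracket G u v =
    'D_u (fun x => 'D_v (mu x) x0) x0 - 'D_v (fun x => 'D_u (mu x) x0) x0.
  by rewrite /lie_bracket -/e -/c -/x0 !left_field_x0.
have [r [rho [Phi [sig [[r0 rho0 Phi0 DPhi] [Usm hom inj inv]]]]]] :=
  local_coordinates brP oV Vx0 smu sde de_mu2 de_mu mu_de mulx0 mux0' br_def.
have Vsig z : `|z| < rho -> V (sig z) by move=> /inv[/Usm[]].
have Phi_eq : {near x0, Phi =1 (Phi \o ccoord c) \o cparam c}.
  near=> x; have Vx : V x by near: x; exact: nbhsx_ballx.
  by rewrite /= VK.
have x0r : `|x0 - x0| < r by rewrite subrr normr0.
exists [set p : G | cdom c p /\ `|ccoord c p - x0| < r], rho,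
  (Phi \o ccoord c), (cparam c \o sig).
have cce : {for e, continuous (ccoord c)} by exact: ccoord_continuous.
split; split=> //.
- apply: filterI; first exact: nbhs_cdom.
  apply: (cce (fun x => `|x - x0| < r)); apply/nbhs_ballP; exists r => // x.
  by rewrite -ball_normE /= distrC.
- move=> p q [cp pr] [cq qr]; rewrite -hom//.
  by rewrite /mu /= !coordK.
- by move=> p q [cp pr] [cq qr] /(inj _ _ pr qr) pq; rewrite -(coordK cp) pq coordK.
- move=> z zr; have Vz := Vsig z zr; have [sr sK ssig] := inv z zr; split.
  + by split; [exact: Vc|rewrite /= VK].
  + by rewrite /= VK.
  + apply: continuous_comp; first exact: smooth_at_continuous.
    by apply: cparam_continuous; have [] := Hr1 _ Vz.
- apply: continuous_comp => //; apply: smooth_at_continuous.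
  exact: (Usm x0 x0r).2.
- split; first exact: smooth_at_eq Phi_eq (Usm x0 x0r).2.
  by move=> w; rewrite -(near_eq_derive w Phi_eq).
- have n0 : `|0 : 'rV[R]_m| < rho by rewrite normr0.
  have [_ _ ssig] := inv 0 n0; apply: smooth_at_eq ssig.
  near=> z; rewrite /= VK//; apply: Vsig; near: z.
  apply/nbhs_ballP; exists rho => // z; rewrite -ball_normE /= sub0r normrN.
  exact.
Unshelve. all: by end_near. Qed.

End LieLocal.

(** * The global exponential *)

Section Chain.
Context {S : Type} (mS : S -> S -> S) (eS : S).
Hypothesis mSA : associative mS.
Hypothesis mS1 : left_id eS mS.
Hypothesis mSr1 : right_id eS mS.

(** The ordered product of [F 0], ..., [F (n - 1)], later factors on the right. It is used in the
    group and in the vector space with the law [star]. *)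
Fixpoint chain (F : nat -> S) n := if n is k.+1 then mS (chain F k) (F k) else eS.

Lemma eq_chain F F' n : (forall i, (i < n)%N -> F i = F' i) -> chain F n = chain F' n.
Proof.
elim: n => //= n IH H; rewrite IH ?H// => i iltn; apply: H.
exact: ltn_trans iltn _.
Qed.

Lemma chain_cstD p a b :
  chain (fun=> p) (a + b) = mS (chain (fun=> p) a) (chain (fun=> p) b).
Proof. by elim: b => [|b IH]; rewrite ?addn0 ?mSr1// addnS /= IH mSA. Qed.

Lemma chain_cstM p a b :
  chain (fun=> p) (a * b) = chain (fun=> chain (fun=> p) a) b.
Proof. by elim: b => [|b IH]; rewrite ?muln0// mulnSr chain_cstD IH. Qed.

Lemma chain_unit n : chain (fun=> eS) n = eS.
Proof. by elim: n => //= n ->; rewrite mS1. Qed.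

(** [d a b] stands for [a^-1 b], and [f] is a homomorphism only on small elements. It is
    instantiated by [sig], from vectors to the group, and by [phi], from the group to vectors. *)
Context {T : Type} (mT d : T -> T -> T) (f : T -> S) (small : T -> Prop).
Hypothesis dd : forall a b c, mT (d a b) (d b c) = d a c.
Hypothesis fM : forall x y, small x -> small y -> small (mT x y) ->
  f (mT x y) = mS (f x) (f y).

(* Both sides are the value of f along the strip between the two chains: each
   square a i, a i.+1, b i.+1, b i is cut along its diagonal, so that only small
   elements are ever multiplied. *)
Lemma chain_shift (a b : nat -> T) n :
    (forall i, (i < n)%N -> [/\ small (d (a i) (a i.+1)),
        small (d (b i) (b i.+1)) & small (d (a i) (b i.+1))]) ->
    (forall i, (i <= n)%N -> small (d (a i) (b i))) ->
  mS (chain (fun i => f (d (a i) (a i.+1))) n) (f (d (a n) (b n))) =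
  mS (f (d (a 0%N) (b 0%N))) (chain (fun i => f (d (b i) (b i.+1))) n).
Proof.
elim: n => [|n IH] H1 H2 /=; first by rewrite mS1 mSr1.
have [s1 s2 s3] := H1 n (leqnn _).
rewrite mSA -IH; last 2 first.
- by move=> i iltn; apply: H1; exact: leqW.
- by move=> i ilen; apply: H2; exact: leqW.
rewrite -!mSA; congr (mS _ _).
have e1 : mS (f (d (a n) (a n.+1))) (f (d (a n.+1) (b n.+1))) = f (d (a n) (b n.+1)).
  rewrite -fM ?dd//; exact: H2 _ (leqnn _).
rewrite e1 -fM ?dd//; exact: H2 _ (leqnSn _).
Qed.

End Chain.

Section Star.
Context {R : realType} {n : nat}.
Context {br : 'rV[R]_n -> 'rV[R]_n -> 'rV[R]_n}.
Context {P : {linear 'rV[R]_n -> 'rV[R]_n}}.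
Hypothesis brP : two_step_bracket br P.

(** The Campbell-Hausdorff product, whose series stops at the first bracket here. *)
Definition star (br' : 'rV[R]_n -> 'rV[R]_n -> 'rV[R]_n) a b :=
  a + b + 2^-1 *: br' a b.
Local Notation "a ** b" := (star br a b) (at level 40, left associativity).

Lemma starA a b c : a ** (b ** c) = a ** b ** c.
Proof.
rewrite /star !(brDl brP) !(brDr brP) !(brZl brP) !(brZr brP).
rewrite (br_br brP) (br_brl brP) scaler0 !addr0 !scalerDr.
by apply/rowP => k; rewrite !mxE; ring.
Qed.

Lemma star0x a : 0 ** a = a.
Proof. by rewrite /star (br0l brP) scaler0 addr0 add0r. Qed.

Lemma starx0 a : a ** 0 = a.
Proof. by rewrite /star (br0r brP) scaler0 !addr0. Qed.

Lemma star_scale (s t : R) a : (s *: a) ** (t *: a) = (s + t) *: a.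
Proof. by rewrite /star (brZl brP) (brZr brP) (brxx brP) !scaler0 addr0 -scalerDl. Qed.

Lemma starNx a : (- a) ** a = 0.
Proof. by rewrite /star (brNl brP) (brxx brP) oppr0 scaler0 addr0 addNr. Qed.

Lemma starxN a : a ** (- a) = 0.
Proof. by rewrite /star (brNr brP) (brxx brP) oppr0 scaler0 addr0 subrr. Qed.

Lemma starKx a b : (- a) ** (a ** b) = b.
Proof. by rewrite starA starNx star0x. Qed.

Lemma starNKx a b : a ** ((- a) ** b) = b.
Proof. by rewrite starA starxN star0x. Qed.

Lemma star_div a b c : ((- a) ** b) ** ((- b) ** c) = (- a) ** c.
Proof. by rewrite -starA starNKx. Qed.

(** The quotient of a point of the ray of [x ** u] by a point of the ray of [x]. Each term carries a
    factor [t - s] or [u], so for bounded parameters it is small when the parameters are close and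
    [u] is small, however long [x] is. *)
Lemma star_strip (s t : R) x u :
  (- (s *: x)) ** (t *: (x ** u)) =
  (t - s) *: x + t *: u + (2^-1 * t * (1 - s)) *: br x u.
Proof.
rewrite /star (brNl brP) (brZl brP) (brZr brP) !(brDr brP) (brxx brP).
rewrite (brZr brP) (br_br brP) scaler0 add0r addr0.
by apply/rowP => k; rewrite !mxE; ring.
Qed.

Lemma br_bounded : exists2 C, 0 <= C & forall x y, `|br x y| <= C * `|x| * `|y|.
Proof.
exists (\sum_i \sum_j `|br (delta_mx 0 i) (delta_mx 0 j)|).
  by apply: sumr_ge0 => i _; apply: sumr_ge0.
move=> x y; rewrite (br_expand brP) (le_trans (ler_norm_sum _ _ _))//.
rewrite -mulrA mulr_suml ler_sum// => i _; rewrite normrZ.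
rewrite rV_linearE mulrCA ler_pM ?coord_le_norm//.
rewrite (le_trans (ler_norm_sum _ _ _))// mulr_suml ler_sum// => j _.
by rewrite normrZ br_linE mulrC ler_wpM2l// coord_le_norm.
Qed.

End Star.

Lemma exists_natr_gt {R : realType} (r : R) : exists2 k : nat, (0 < k)%N & r < k%:R.
Proof.
exists (Num.truncn r).+1 => //; exact: truncnS_gt.
Qed.

Lemma lmul_left_continuous {R : realType} {m : nat} (G : lieGroup R m) (p : G) :
  continuous (lmul p).
Proof.
move=> q; apply: (@lmul_cvg _ _ G G (cst p) id); first exact: cvg_cst.
exact: cvg_id.
Qed.

(** A Lebesgue number: around each [x] the quotient lies in [W] by continuity, as it is the identity
    on the diagonal, and compactness makes the distance uniform. *)
Lemma lebesgue_small {R : realType} {m : nat} (G : lieGroup R m)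
    (V : normedModType R) (K : set V) (H : V -> G) (W : set G) :
    compact K -> {within K, continuous H} -> nbhs (lone G) W ->
  exists2 d : R, 0 < d & forall z z', K z -> K z' -> `|z - z'| < d ->
    W (lmul (linv (H z)) (H z')).
Proof.
move=> cK cH eW.
pose Q (d : R) (z : V) := forall z', K z' -> `|z - z'| < d ->
  W (lmul (linv (H z)) (H z')).
have : \forall d \near 0^'+, K `<=` Q d.
  move/compact_near_coveringP/near_covering_withinP : cK; apply => x Kx.
  have [[A B] /= [Ax Bx] AB] : nbhs (H x, H x)
      (fun z : G * G => W (lmul (linv z.1) z.2)).
    have : {for (H x, H x), continuous (fun z : G * G => lmul (linv z.1) z.2)}.
      apply: lmul_cvg; last exact: cvg_snd.
      apply: (@continuous_comp _ _ _ (fun z : G * G => z.1) (@linv R m G)).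
        exact: cvg_fst.
      exact: linv_continuous.
    by apply; rewrite /= lmulVg.
  have HO : \forall y \near x, K y -> (A `&` B) (H y).
    have : within K (nbhs x) (H @^-1` (A `&` B)).
      by rewrite nbhs_subspace_in//; exact: cH x (A `&` B) (filterI Ax Bx).
    exact.
  have /nbhs_ballP[d /= d0 Hd] := HO.
  (* One half locates [y] near [x], the other locates [z'] near [y], so both values are taken within
     [d] of [x]. *)
  have d2 : 0 < d / 2 by rewrite divr_gt0.
  exists (ball x (d / 2), [set e : R | e < d / 2]) => /=.
    by split; [exact: nbhsx_ballx|exact: nbhs_right_lt].
  move=> [y e] /= [xy ed] Ky z' Kz' yz'.
  apply: (AB (H y, H z')); split => /=.
    apply: (Hd y _ Ky).1; move: xy; rewrite -!ball_normE /= => /lt_trans; apply.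
    by rewrite ltr_pdivrMr// ltr_pMr// ltr1n.
  apply: (Hd z' _ Kz').2; move: xy; rewrite -!ball_normE /= => xy.
  rewrite (splitr d) -(subrKA y) (le_lt_trans (ler_normD _ _))// ltrD//.
  exact: lt_trans ed.
move=> HQ; have HQ0 : \forall d \near (0 : R)^'+, K `<=` Q d /\ 0 < d.
  by apply: filterI => //; exact: nbhs_right_gt.
have [d [KQ d0]] := @filter_ex _ _ (at_right_proper_filter (0 : R)) _ HQ0.
by exists d => // z z' Kz Kz' zz'; exact: KQ.
Qed.

(** * From the local inverse of the logarithm to the global exponential *)

Section Global.
Context {R : realType} {m : nat} (G : lieGroup R m).
Context {br : 'rV[R]_m -> 'rV[R]_m -> 'rV[R]_m}.
Context {P : {linear 'rV[R]_m -> 'rV[R]_m}}.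
Hypothesis brP : two_step_bracket br P.
Local Notation "a ** b" := (star br a b) (at level 40, left associativity).
Let e : G := lone G.
Local Notation gchain := (chain (@lmul R m G) e).
Local Notation echain := (chain (star br) 0).

Variables (W : set G) (rho : R) (phi : G -> 'rV[R]_m) (sig : 'rV[R]_m -> G).
Hypothesis We : nbhs e W.
Hypothesis rho0 : 0 < rho.
Hypothesis phi1 : phi e = 0.
Hypothesis phiM : forall p q, W p -> W q -> phi (lmul p q) = phi p ** phi q.
Hypothesis phi_inj : forall p q, W p -> W q -> phi p = phi q -> p = q.
Hypothesis Wsig : forall z, `|z| < rho -> W (sig z).
Hypothesis sigK : forall z, `|z| < rho -> phi (sig z) = z.
Hypothesis sig_cont : forall z : 'rV[R]_m, `|z| < rho -> {for z, continuous sig}.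
Hypothesis phi_cont : {for e, continuous phi}.

Let rho_0 : `|0 : 'rV[R]_m| < rho. Proof. by rewrite normr0. Qed.

Lemma sig0 : sig 0 = e.
Proof.
apply: phi_inj; [exact: Wsig|exact: nbhs_singleton|].
by rewrite phi1 sigK.
Qed.

Lemma small_radius : exists2 r : R, 0 < r <= rho & forall a b,
  `|a| < r -> `|b| < r -> W (lmul (sig a) (sig b)).
Proof.
have [[A1 A2] /= [A1e A2e] HA] : nbhs (e, e) (fun z : G * G => W (lmul z.1 z.2)).
  by apply: (@lmul_continuous _ _ G (e, e)); rewrite /= lmul1g.
have H : nbhs (sig 0) (A1 `&` A2) by rewrite sig0; exact: filterI.
have /nbhs_ballP[r1 /= r10 Hr1] : nbhs (0 : 'rV[R]_m) (sig @^-1` (A1 `&` A2)).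
  exact: (sig_cont rho_0) H.
exists (Num.min rho r1); first by rewrite lt_min rho0 r10 ge_min lexx.
move=> a b; rewrite !lt_min => /andP[_ ar] /andP[_ br1].
apply: (HA (sig a, sig b)); split => /=.
  by apply: (Hr1 a _).1; rewrite -ball_normE /= sub0r normrN.
by apply: (Hr1 b _).2; rewrite -ball_normE /= sub0r normrN.
Qed.

Variable r : R.
Hypothesis r0 : 0 < r.
Hypothesis r_rho : r <= rho.
Hypothesis Wsig2 : forall a b, `|a| < r -> `|b| < r -> W (lmul (sig a) (sig b)).

Let in_rho (z : 'rV[R]_m) : `|z| < r -> `|z| < rho.
Proof. by move=> zr; exact: lt_le_trans r_rho. Qed.

Lemma sigM (a b : 'rV[R]_m) : `|a| < r -> `|b| < r -> `|a ** b| < r ->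
  sig (a ** b) = lmul (sig a) (sig b).
Proof.
move=> ar br1 abr; apply: phi_inj.
- exact: Wsig (in_rho abr).
- exact: Wsig2.
- rewrite phiM ?sigK//; try exact: in_rho; exact: Wsig (in_rho _).
Qed.

Lemma sig_frac (x : 'rV[R]_m) k : (0 < k)%N -> `|x| < r ->
  sig x = gchain (fun=> sig (k%:R^-1 *: x)) k.
Proof.
move=> k0 xr; have kp : 0 < k%:R :> R by rewrite ltr0n.
have small (t : R) : 0 <= t <= 1 -> `|t *: x| < r.
  move=> /andP[t0 t1]; rewrite normrZ ger0_norm//.
  by rewrite (le_lt_trans _ xr)// ler_piMl.
have frac (j : nat) : (j <= k)%N -> 0 <= (j%:R / k%:R : R) <= 1.
  by move=> jk; rewrite divr_ge0//= ler_pdivrMr// mul1r ler_nat.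
have H j : (j <= k)%N -> sig ((j%:R / k%:R) *: x) = gchain (fun=> sig (k%:R^-1 *: x)) j.
  elim: j => [_|j IH jk]; first by rewrite mul0r scale0r sig0.
  have e1 : (j.+1%:R / k%:R) *: x = ((j%:R / k%:R) *: x) ** (k%:R^-1 *: x).
    by rewrite (star_scale brP) -[X in _ + X]mul1r -mulrDl natr1.
  rewrite /= -IH ?(ltnW jk)// e1 sigM// -?e1; try (apply: small; exact: frac).
  + by apply: small; apply: frac; exact: ltnW.
  + by rewrite -[k%:R^-1]mul1r; apply: small; exact: (frac 1%N).
by rewrite -H// divff ?scale1r// gt_eqF.
Qed.

(** [k] is the least natural number for which [x / k] has norm below [r]; by [gexpE] every larger
    one gives the same element. *)
Definition gexp (x : 'rV[R]_m) : G := let k := (Num.truncn (`|x| / r)).+1 in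
  gchain (fun=> sig (k%:R^-1 *: x)) k.

Let gchainM := chain_cstM (@lmulA R m G) (@lmulg1 R m G).

Let small_frac k (x : 'rV[R]_m) : (0 < k)%N -> `|x| < k%:R * r -> `|k%:R^-1 *: x| < r.
Proof.
move=> k0 xk; have kp : 0 < k%:R :> R by rewrite ltr0n.
by rewrite normrZ ger0_norm ?invr_ge0 ?ler0n// ltr_pdivrMl.
Qed.

(** Two subdivisions [k] and [l] are both refined by [k * l], where [sig_frac] computes them. *)
Lemma gexpE k (x : 'rV[R]_m) : (0 < k)%N -> `|x| < k%:R * r ->
  gexp x = gchain (fun=> sig (k%:R^-1 *: x)) k.
Proof.
move=> k0 xk; rewrite /gexp; set l := (Num.truncn (`|x| / r)).+1.
have xl : `|x| < l%:R * r by rewrite -ltr_pdivrMr//; exact: truncnS_gt.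
have l0 : (0 < l)%N by [].
rewrite (sig_frac k0 (small_frac l0 xl)) (sig_frac l0 (small_frac k0 xk)).
by rewrite !scalerA -!invfM -!natrM -!gchainM (mulnC k l).
Qed.

Lemma gexp_small (x : 'rV[R]_m) : `|x| < r -> gexp x = sig x.
Proof. by move=> xr; rewrite (@gexpE 1%N) ?mul1r// invr1 scale1r /= lmul1g. Qed.

Lemma gexp0 : gexp 0 = e.
Proof. by rewrite gexp_small ?normr0// sig0. Qed.

Variable C : R.
Hypothesis C0 : 0 <= C.
Hypothesis brC : forall x y, `|br x y| <= C * `|x| * `|y|.

(** One half of [r] is spent on the term in [t - s], the other on the two terms in [u], the bracket
    being bounded through [C]. *)
Lemma strip_small (s t d : R) (x u : 'rV[R]_m) : 0 <= s <= 1 -> 0 <= t <= 1 -> `|t - s| <= d ->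
    d * `|x| < r / 2 -> `|u| * (1 + C * `|x|) < r / 2 ->
  `|(- (s *: x)) ** (t *: (x ** u))| < r.
Proof.
move=> /andP[s0 s1] /andP[t0 t1] ts dx ux; rewrite (star_strip brP).
rewrite (splitr r) -addrA (le_lt_trans (ler_normD _ _))// ler_ltD//.
  by rewrite normrZ (le_trans _ (ltW dx))// ler_wpM2r.
rewrite (le_lt_trans _ ux)// (le_trans (ler_normD _ _))// [leRHS]mulrDr mulr1 lerD//.
  by rewrite normrZ ger0_norm// ler_piMl.
have s1' : 0 <= 1 - s by rewrite subr_ge0.
rewrite normrZ !normrM (ger0_norm t0) (ger0_norm s1') ger0_norm ?invr_ge0//.
rewrite (@le_trans _ _ `|br x u|)//; last by rewrite (le_trans (brC _ _))// mulrC.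
rewrite ler_piMl// mulr_ile1 ?mulr_ge0 ?invr_ge0 ?subr_ge0//.
  by rewrite mulr_ile1 ?invr_ge0// invf_le1// ler1n.
by rewrite gerBl.
Qed.

(** The rays from 0 to [x] and from 0 to [x ** u] are cut into [k] pieces and the products along
    them compared by [chain_shift]. The transversal factor is trivial at the start and [sig u] at
    the end. The condition on [u] does not involve [k], so the pieces can be made short
    afterwards. *)
Lemma gexp_step (x u : 'rV[R]_m) : `|u| * (1 + C * `|x|) < r / 2 ->
  gexp (x ** u) = lmul (gexp x) (sig u).
Proof.
move=> ux; pose y := x ** u.
(* With this [k] the pieces of both rays have length below [r / 2], as [strip_small] asks for
   [x]. *)
have [k k0 Hk] := exists_natr_gt (2 * (`|x| + `|y|) / r).
have kp : 0 < k%:R :> R by rewrite ltr0n.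
have {}Hk : 2 * (`|x| + `|y|) < k%:R * r by rewrite -ltr_pdivrMr.
have Hx : 2 * `|x| < k%:R * r.
  by rewrite (le_lt_trans _ Hk)// ler_pM2l// lerDl.
have Hy : 2 * `|y| < k%:R * r.
  by rewrite (le_lt_trans _ Hk)// ler_pM2l// lerDr.
have le2 (z : 'rV[R]_m) : `|z| <= 2 * `|z| by rewrite ler_peMl// ler1n.
have frac (j : nat) : (j <= k)%N -> 0 <= (j%:R / k%:R : R) <= 1.
  by move=> jk; rewrite divr_ge0//= ler_pdivrMr// mul1r ler_nat.
have dx : k%:R^-1 * `|x| < r / 2.
  by rewrite ltr_pdivrMl// mulrA ltr_pdivlMr// mulrC.
have strip (i j : nat) : (i <= k)%N -> (j <= k)%N -> (i <= j <= i.+1)%N ->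
    `|(- ((i%:R / k%:R) *: x)) ** ((j%:R / k%:R) *: y)| < r.
  move=> ik jk /andP[ij ji]; apply: (strip_small (frac i ik) (frac j jk) _ dx ux).
  rewrite -mulrBl normrM normfV [in `|k%:R|]ger0_norm// ler_piMl ?invr_ge0//.
  by rewrite -natrB// ger0_norm// lern1 leq_subLR addn1.
have step (z : 'rV[R]_m) (i : nat) :
    (- ((i%:R / k%:R) *: z)) ** ((i.+1%:R / k%:R) *: z) = k%:R^-1 *: z.
  rewrite -scaleNr (star_scale brP) -mulNr -mulrDl -natr1 addKr mul1r //.
have stepx : `|k%:R^-1 *: x| < r.
  by apply: small_frac => //; exact: le_lt_trans (le2 x) Hx.
have stepy : `|k%:R^-1 *: y| < r.
  by apply: small_frac => //; exact: le_lt_trans (le2 y) Hy.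
have := @chain_shift G (@lmul R m G) e (@lmulA R m G) (@lmul1g R m G) (@lmulg1 R m G)
  _ (star br) (fun a b => (- a) ** b) sig (fun z => `|z| < r)
  (star_div brP) sigM (fun i => (i%:R / k%:R) *: x) (fun i => (i%:R / k%:R) *: y) k.
rewrite mul0r !scale0r oppr0 (star0x brP) sig0 lmul1g divff ?gt_eqF// !scale1r.
rewrite (starKx brP) => H.
rewrite (gexpE k0 (le_lt_trans (le2 x) Hx)) (gexpE k0 (le_lt_trans (le2 y) Hy)).
have Ez (z : 'rV[R]_m) : gchain (fun i =>
    sig ((- ((i%:R / k%:R) *: z)) ** ((i.+1%:R / k%:R) *: z))) k =
    gchain (fun=> sig (k%:R^-1 *: z)) k.
  by apply: eq_chain => i _; rewrite step.
rewrite -!Ez; apply/esym; apply: H.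
- move=> i ik; rewrite !step; split=> //.
  by apply: strip; rewrite ?leqnSn ?leqnn// ltnW.
- by move=> i ik; apply: strip => //; rewrite leqnn leqnSn.
Qed.

(** [y] is appended in [k] equal steps, each short enough for [gexp_step]. *)
Lemma gexpM x y : gexp (x ** y) = lmul (gexp x) (gexp y).
Proof.
(* A bound for all intermediate points [x ** (t y)], so that one [k] suits every step. *)
pose K := `|x| + `|y| + C * `|x| * `|y|.
have K0 : 0 <= K by rewrite !addr_ge0// !mulr_ge0.
have [k k0 Hk] := exists_natr_gt (2 * (`|y| * (1 + C * K)) / r).
have kp : 0 < k%:R :> R by rewrite ltr0n.
have {}Hk : 2 * (`|y| * (1 + C * K)) < k%:R * r by rewrite -ltr_pdivrMr.
have yr : `|y| < k%:R * r.
  rewrite (le_lt_trans _ Hk)// (@le_trans _ _ (2 * `|y|))//.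
    by rewrite ler_peMl// ler1n.
  by rewrite ler_pM2l// ler_peMr// lerDl mulr_ge0.
have xty (t : R) : 0 <= t <= 1 -> `|x ** (t *: y)| <= K.
  move=> /andP[t0 t1]; have ty : `|t *: y| <= `|y|.
    by rewrite normrZ ger0_norm// ler_piMl.
  rewrite /star (le_trans (ler_normD _ _))// lerD//.
    by rewrite (le_trans (ler_normD _ _))// lerD2l.
  rewrite normrZ ger0_norm ?invr_ge0// (@le_trans _ _ `|br x (t *: y)|)//.
    by rewrite ler_piMl// invf_le1// ler1n.
  by rewrite (le_trans (brC _ _))// ler_wpM2l// mulr_ge0.
have H j : (j <= k)%N -> gexp (x ** ((j%:R / k%:R) *: y)) =
    lmul (gexp x) (gchain (fun=> sig (k%:R^-1 *: y)) j).
  elim: j => [_|j IH jk]; first by rewrite mul0r scale0r (starx0 brP) lmulg1.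
  have e1 : (j.+1%:R / k%:R) *: y = ((j%:R / k%:R) *: y) ** (k%:R^-1 *: y).
    by rewrite (star_scale brP) -[X in _ + X]mul1r -mulrDl natr1.
  rewrite e1 (starA brP) gexp_step; first by rewrite IH ?(ltnW jk)//= lmulA.
  set z := x ** _.
  have zK : `|z| <= K.
    apply: xty; rewrite divr_ge0//= ler_pdivrMr// mul1r ler_nat; exact: ltnW.
  rewrite normrZ ger0_norm ?invr_ge0// (@le_lt_trans _ _
    (k%:R^-1 * `|y| * (1 + C * K)))//.
    by rewrite ler_wpM2l ?mulr_ge0 ?invr_ge0// lerD2l ler_wpM2l.
  by rewrite -mulrA ltr_pdivrMl// mulrA ltr_pdivlMr// mulrC.
have := H k (leqnn k); rewrite divff ?gt_eqF// scale1r => ->.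
by rewrite -gexpE.
Qed.

Lemma gexpN x : gexp (- x) = linv (gexp x).
Proof. by apply/esym/linv_unique; rewrite -gexpM (starxN brP) gexp0. Qed.

Lemma gexp_phi p : W p -> `|phi p| < r -> gexp (phi p) = p.
Proof.
move=> Wp pr; rewrite gexp_small//; apply: phi_inj => //; first exact: Wsig (in_rho pr).
by rewrite sigK//; exact: in_rho.
Qed.

(** A path from the identity to [p] is cut so finely that the quotients of successive points are
    exponentials of their logarithms; by [gexpM] each point of the subdivision is then an
    exponential. *)
Lemma gexp_surjective : path_connected R G -> forall p, exists x, gexp x = p.
Proof.
move=> pc p; have [c [cc c0 c1]] := pc e p.
have W1 : nbhs e (W `&` (fun p => `|phi p| < r)).
  apply: filterI => //.
  have H : nbhs (phi e) (fun x => `|x| < r).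
    rewrite phi1; apply/nbhs_ballP; exists r => // x.
    by rewrite -ball_normE /= sub0r normrN.
  exact: (phi_cont H).
have [d d0 Hd] := lebesgue_small (@segment_compact R 0 1) cc W1.
have [k k0 Hk] := exists_natr_gt d^-1.
have kp : 0 < k%:R :> R by rewrite ltr0n.
have frac (j : nat) : (j <= k)%N -> (`[0, 1]%classic : set R) (j%:R / k%:R).
  by move=> jk; rewrite /= in_itv /= divr_ge0//= ler_pdivrMr// mul1r ler_nat.
have H j : (j <= k)%N -> exists x, gexp x = c (j%:R / k%:R).
  elim: j => [_|j IH jk]; first by exists 0; rewrite mul0r c0 gexp0.
  have [x Hx] := IH (ltnW jk).
  have [|Wq qr] := Hd _ _ (frac j (ltnW jk)) (frac j.+1 jk).
    rewrite -mulrBl -natr1 opprD addrA subrr add0r mulN1r normrN.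
    by rewrite ger0_norm ?invr_ge0// invf_plt.
  exists (x ** phi (lmul (linv (c (j%:R / k%:R))) (c (j.+1%:R / k%:R)))).
  by rewrite gexpM gexp_phi// Hx lmulVKg.
have [x Hx] := H k (leqnn k); exists x.
by rewrite Hx divff ?gt_eqF// c1.
Qed.

Lemma smooth_at_star y x : smooth_at (fun z => y ** z) x.
Proof.
apply: smooth_at_add.
  apply: smooth_at_add; [exact: smooth_at_cst|exact: smooth_at_id].
apply: (smooth_at_linear_comp (GRing.scale 2^-1)).
by apply: (smooth_at_br brP (f := cst y) (g := id));
  [exact: smooth_at_cst|exact: smooth_at_id].
Qed.

(** The expression of [gexp] near [y] through [sig] near 0, from which continuity and smoothness of
    [gexp] at [y] follow. *)
Lemma gexp_near y : \forall z \near y, gexp z = lmul (gexp y) (sig ((- y) ** z)).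
Proof.
have c := smooth_at_continuous (smooth_at_star (- y) y).
have : \forall z \near y, `|(- y) ** z| < r.
  have H : nbhs ((- y) ** y) (fun z => `|z| < r).
    rewrite (starNx brP); apply/nbhs_ballP; exists r => // x.
    by rewrite -ball_normE /= sub0r normrN.
  exact: (c _ H).
apply: filterS => z zr; rewrite -(gexp_small zr) -gexpM.
by rewrite (starNKx brP).
Qed.

Lemma gexp_continuous : continuous gexp.
Proof.
move=> y; have c := smooth_at_continuous (smooth_at_star (- y) y).
have H : {for y, continuous (fun z => lmul (gexp y) (sig ((- y) ** z)))}.
  apply: (@continuous_comp _ _ _ (sig \o (fun z => (- y) ** z)) (lmul (gexp y)));
    last exact: lmul_left_continuous.
  apply: (@continuous_comp _ _ _ (fun z => (- y) ** z) sig); first exact: c.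
  by rewrite /= (starNx brP); exact: sig_cont rho_0.
apply: near_eq_continuous H.
by near=> z; apply/esym; near: z; exact: gexp_near.
Unshelve. all: by end_near. Qed.

Lemma echain_cst x k : echain (fun=> x) k = k%:R *: x.
Proof.
elim: k => [|k IH]; first by rewrite scale0r.
by rewrite /= IH -[X in _ ** X]scale1r (star_scale brP) natr1.
Qed.

(** [Pi j] multiplies, in the law [star], the logarithms of the successive quotients along row [j]
    of a grid in the homotopy square. Adjacent rows give equal products by [chain_shift]; row 0 is
    the loop and gives [x], row [k] is constant and gives 0. *)
Lemma gexp_kernel x : simply_connected R G -> gexp x = e -> x = 0.
Proof.
move=> [_ _ sc] gx.
pose c (t : R) := gexp (t *: x).
have cc : {within `[0, 1], continuous c}.
  apply: continuous_subspaceT => t.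
  apply: (@continuous_comp _ _ _ (fun t : R => t *: x) gexp).
    by apply: (@cvgZr_tmp _ _ _ (nbhs t)); exact: cvg_id.
  exact: gexp_continuous.
have c0 : c 0 = e by rewrite /c scale0r gexp0.
have c1 : c 1 = e by rewrite /c scale1r.
have [H [cH H0 H1 Hs]] := sc c cc (etrans c0 (esym c1)).
have KK : compact ((`[0, 1]%classic : set R) `*` (`[0, 1]%classic : set R)).
  by apply: compact_setX; exact: segment_compact.
have [d d0 Hd] := lebesgue_small KK cH We.
(* The first summand makes the mesh finer than [d], the second puts [x / k] in the ball where [gexp]
   is [sig]. *)
have [k k0 Hk] := exists_natr_gt (d^-1 + `|x| / r).
have kp : 0 < k%:R :> R by rewrite ltr0n.
have kd : k%:R^-1 < d.
  by rewrite invf_plt// (le_lt_trans _ Hk)// lerDl divr_ge0// ltW.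
have kx : `|x| < k%:R * r.
  by rewrite -ltr_pdivrMr// (le_lt_trans _ Hk)// lerDr invr_ge0 ltW.
have frac (j : nat) : (j <= k)%N -> (j%:R / k%:R : R) \in `[0, 1].
  by move=> jk; rewrite in_itv /= divr_ge0//= ler_pdivrMr// mul1r ler_nat.
pose a (j i : nat) := H (j%:R / k%:R, i%:R / k%:R).
have small (j j' i i' : nat) : (j <= k)%N -> (j' <= k)%N -> (i <= k)%N ->
    (i' <= k)%N -> (j <= j' <= j.+1)%N -> (i <= i' <= i.+1)%N ->
    W (lmul (linv (a j i)) (a j' i')).
  move=> jk j'k ik i'k jj ii; apply: Hd; [by split; exact: frac..|].
  have dist (u v : nat) : (u <= v <= u.+1)%N -> `|u%:R / k%:R - v%:R / k%:R : R| < d.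
    move=> /andP[uv vu]; rewrite distrC -mulrBl normrM normfV.
    rewrite [in `|k%:R|]ger0_norm// (le_lt_trans _ kd)// ler_piMl ?invr_ge0//.
    by rewrite -natrB// ger0_norm// lern1 leq_subLR addn1.
  by rewrite prod_normE /= gt_max !dist.
pose Pi (j : nat) := echain (fun i => phi (lmul (linv (a j i)) (a j i.+1))) k.
have lddd (p q s : G) : lmul (lmul (linv p) q) (lmul (linv q) s) = lmul (linv p) s.
  by rewrite -lmulA lmulVKg.
have a0 (j : nat) : (j <= k)%N -> a j 0%N = e.
  by move=> jk; rewrite /a mul0r (Hs _ (frac j jk)).1.
have ak (j : nat) : (j <= k)%N -> a j k = e.
  by move=> jk; rewrite /a divff ?gt_eqF// (Hs _ (frac j jk)).2.
have row (j : nat) : (j < k)%N -> Pi j = Pi j.+1.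
  move=> jk; have := @chain_shift _ (star br) 0 (starA brP) (star0x brP) (starx0 brP)
    G (@lmul R m G) (fun p q => lmul (linv p) q) phi W lddd
    (fun p q Wp Wq _ => phiM Wp Wq) (a j) (a j.+1) k.
  (* The homotopy fixes the ends of the loop at the identity, so both transversal factors are
     [phi e = 0]. *)
  rewrite !a0 ?ak ?(ltnW jk)// lmulVg phi1 (star0x brP) (starx0 brP); apply.
    by move=> i ik; split; apply: small;
      rewrite ?leqnn ?leqnSn ?(ltnW ik) ?(ltnW jk).
  by move=> i ik; apply: small; rewrite ?leqnn ?leqnSn ?(ltnW jk).
have rows (j : nat) : (j <= k)%N -> Pi 0%N = Pi j.
  elim: j => [//|j IH jk]; exact: etrans (IH (ltnW jk)) (row j jk).
have Pk : Pi k = 0.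
  rewrite /Pi -[RHS](chain_unit (star0x brP) k); apply: eq_chain => i ik.
  rewrite /a divff ?gt_eqF// !H1; [|exact: frac|exact/frac/ltnW].
  by rewrite lmulVg phi1.
have P0 : Pi 0%N = x.
  rewrite /Pi -[RHS]scale1r -(divff (lt0r_neq0 kp)) -scalerA -echain_cst.
  apply: eq_chain => i ik; rewrite /a mul0r !H0; [|exact: frac|exact/frac/ltnW].
  rewrite /c -gexpN -gexpM -scaleNr (star_scale brP) -mulNr -mulrDl -natr1.
  rewrite addKr mul1r.
  have xr : `|k%:R^-1 *: x| < r by exact: small_frac.
  by rewrite gexp_small// sigK//; exact: in_rho.
by rewrite -P0 (rows k (leqnn k)).
Qed.

Lemma gexp_injective : simply_connected R G -> injective gexp.
Proof.
move=> sc x y xy; have /(gexp_kernel sc) : gexp ((- x) ** y) = e.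
  by rewrite gexpM gexpN xy lmulVg.
by move=> H; rewrite -(starNKx brP x y) H (starx0 brP).
Qed.

End Global.

Lemma pair_continuous_r (S T : topologicalType) (c : S) :
  continuous (fun y : T => (c, y)).
Proof.
move=> y; apply: continuous_pair_at; first exact: cvg_cst.
exact: cvg_id.
Qed.

Section LeftTranslation.
Context {R : realType} {m : nat} (G : lieGroup R m).

Lemma smooth_left (a p q b : G) : cdom (chart_at p) b ->
    cdom (chart_at q) (lmul a b) ->
  smooth_at (ccoord (chart_at q) \o lmul a \o cparam (chart_at p))
    (ccoord (chart_at p) b).
Proof.
move=> pb qab; have aa := mem_chart_at a.
have H := smooth_map2_at (lmul_smooth G) aa pb qab.
pose A (y : 'rV[R]_m) := (ccoord (chart_at a) a, y).
pose L (y : 'rV[R]_m) := (0 : 'rV[R]_m, y).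
pose f (w : 'rV[R]_m * 'rV[R]_m) := ccoord (chart_at q)
  (lmul (cparam (chart_at a) w.1) (cparam (chart_at p) w.2)).
have : smooth_at (f \o A) (ccoord (chart_at p) b).
  apply: (@smooth_at_affine _ _ _ _ f A L) => //.
  - exact: pair_continuous_r.
  - move=> x v h; rewrite /A /L.
    by congr (_, _); rewrite /= scaler0 add0r.
apply: smooth_at_eq; near=> y.
by rewrite /f /A /= coordK.
Unshelve. all: by end_near. Qed.

End LeftTranslation.

(** * Global logarithmic coordinates *)

Section Flat.
Context {R : realType} {m : nat} (G : lieGroup R m).
Context {P : {linear 'rV[R]_m -> 'rV[R]_m}}.
Hypothesis brP : two_step_bracket (lie_bracket G) P.
Local Notation br := (lie_bracket G).
Let e : G := lone G.

Lemma is_derive_star (V : normedModType R) (g : V -> 'rV[R]_m) (x v : V)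
    (a dg : 'rV[R]_m) : is_derive x v g dg ->
  is_derive x v (fun y => star br a (g y)) (dg + 2^-1 *: br a dg).
Proof.
move=> dgx; have d1 := is_deriveD (is_derive_cst a x v) dgx.
have d2 := is_deriveZ 2^-1 (is_derive_linear (br_lin brP a) dgx).
have := is_deriveD d1 d2; rewrite (br_linE brP) add0r.
congr is_derive; apply/funext => y.
Qed.

(** [Psi] is the global logarithm, inverse to [s], the extended exponential. Near [p] it sends [q]
    to [Psi p ** phi (p^-1 q)]; since [phi] has the identity as differential at the unit, the
    differential of [Psi] at [p] is that of the left [star]-translation by [Psi p], applied to the
    left-invariant value [w]. *)
Lemma flat_coordinates : simply_connected R G ->
  exists (Psi : G -> 'rV[R]_m) (s : 'rV[R]_m -> G),
    [/\ cancel Psi s, cancel s Psi, continuous Psi & continuous s] /\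
    [/\ forall p, smooth_at (Psi \o cparam (chart_at p)) (ccoord (chart_at p) p),
        forall x, smooth_at (ccoord (chart_at (s x)) \o s) x &
        forall p u, 'D_u (Psi \o cparam (chart_at p)) (ccoord (chart_at p) p) =
          let w := tangent_map (lmul (linv p)) p u in
          w + 2^-1 *: br (Psi p) w].
Proof.
move=> sc; have [W [rho [phi [sig [[We rho0 phi1 phiM] H2]]]]] := local_iso brP.
have [phi_inj Hsig phi_cont [sphi dphi] ssig] := H2.
have Wsig z : `|z| < rho -> W (sig z) by move=> /Hsig[].
have sigK z : `|z| < rho -> phi (sig z) = z by move=> /Hsig[].
have sig_cont (z : 'rV[R]_m) : `|z| < rho -> {for z, continuous sig} by move=> /Hsig[].
have [r /andP[r0 r_rho] Wsig2] :=
  small_radius We rho0 phi1 phi_inj Wsig sigK sig_cont.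
have [C C0 brC] := br_bounded brP.
pose s := gexp sig r.
have sM : forall x y, s (star br x y) = lmul (s x) (s y) :=
  gexpM brP We rho0 phi1 phiM phi_inj Wsig sigK r0 r_rho Wsig2 C0 brC.
have s_inj : injective s :=
  gexp_injective brP We rho0 phi1 phiM phi_inj Wsig sigK sig_cont r0 r_rho Wsig2 C0 brC sc.
have s_cont : continuous s :=
  gexp_continuous brP We rho0 phi1 phiM phi_inj Wsig sigK sig_cont r0 r_rho Wsig2 C0 brC.
have s_near := gexp_near brP We rho0 phi1 phiM phi_inj Wsig sigK r0 r_rho Wsig2 C0 brC.
have s_surj : forall p, exists x, s x = p.
  have [_ pc _] := sc.
  exact: (gexp_surjective brP We rho0 phi1 phiM phi_inj Wsig sigK phi_cont
    r0 r_rho Wsig2 C0 brC pc).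
have /choice[Psi sPsi] := s_surj.
have PsiK : cancel Psi s by [].
have sK : cancel s Psi by move=> x; apply: s_inj.
have s_phi : forall p, W p -> `|phi p| < r -> s (phi p) = p :=
  gexp_phi brP We rho0 phi1 phiM phi_inj Wsig sigK r0 r_rho Wsig2.
have s0 : sig 0 = e := sig0 We rho0 phi1 phi_inj Wsig sigK.
pose c0 := chart_at e; have c0e : cdom c0 e := mem_chart_at e.
have Wr : nbhs e [set q | W q /\ `|phi q| < r].
  apply: filterI => //.
  have H : nbhs (phi e) (fun x => `|x| < r).
    rewrite phi1; apply/nbhs_ballP; exists r => // x.
    by rewrite -ball_normE /= sub0r normrN.
  exact: (phi_cont _ H).
have left_nbhs (p : G) (A : set G) : nbhs e A -> nbhs p [set q | A (lmul (linv p) q)].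
  have -> : e = lmul (linv p) p by rewrite lmulVg.
  by move=> H; exact: (lmul_left_continuous H).
(* Both sides have the same exponential, because [s] is multiplicative and inverts [phi] near the
   unit. *)
have Psi_near p : \forall q \near p, star br (Psi p) (phi (lmul (linv p) q)) = Psi q.
  near=> q; apply: s_inj; rewrite sM !PsiK s_phi ?lmulVKg//.
    by near: q; apply: filterS (left_nbhs p _ Wr) => q [].
  by near: q; apply: filterS (left_nbhs p _ Wr) => q [].
have Psi_chart p : {near ccoord (chart_at p) p,
    (fun x => star br (Psi p) (((phi \o cparam c0) \o
      (ccoord c0 \o lmul (linv p) \o cparam (chart_at p))) x)) =1
    Psi \o cparam (chart_at p)}.
  near=> x; rewrite /= [cparam c0 _]coordK.
    near: x; apply: (near_param (mem_chart_at p)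
      (A := [set q | star br (Psi p) (phi (lmul (linv p) q)) = Psi q])).
    exact: Psi_near.
  near: x; apply: (near_param (mem_chart_at p)
    (A := [set q | cdom c0 (lmul (linv p) q)])).
  exact: left_nbhs (nbhs_cdom c0e).
have lmulVc p : cdom c0 (lmul (linv p) p) by rewrite lmulVg.
have sleft p := smooth_left (mem_chart_at p) (lmulVc p).
have sphi' p : smooth_at (phi \o cparam c0)
   ((ccoord c0 \o lmul (linv p) \o cparam (chart_at p)) (ccoord (chart_at p) p)).
  by rewrite /= coordK ?lmulVg//; exact: mem_chart_at.
have scomp p := smooth_at_comp (sleft p) (sphi' p).
exists Psi, s; split; split=> //.
- move=> p; apply: near_eq_continuous (Psi_near p) _.
  have H : {for p, continuous (phi \o lmul (linv p))}.
    apply: (@continuous_comp _ _ _ (lmul (linv p)) phi).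
      exact: lmul_left_continuous.
    by rewrite lmulVg.
  apply: (@continuous_comp _ _ _ (phi \o lmul (linv p)) (star br (Psi p))) => //.
  exact: smooth_at_continuous (smooth_at_star brP (Psi p) _).
- move=> p; apply: smooth_at_eq (Psi_chart p) _.
  exact: (smooth_at_comp (scomp p) (smooth_at_star brP (Psi p) _)).
(* Near [x], [s z] is [s x] times [sig ((- x) ** z)]: a [star]-translation to 0, then [sig], then a
   left translation. *)
- move=> x.
  have ssig' : smooth_at (ccoord c0 \o sig) (star br (- x) x).
    by rewrite (starNx brP).
  have q1 := smooth_at_comp (smooth_at_star brP (- x) x) ssig'.
  have ec : cdom (chart_at (s x)) (lmul (s x) e).
    by rewrite lmulg1; exact: mem_chart_at.
  have sl : smooth_at (ccoord (chart_at (s x)) \o lmul (s x) \o cparam c0)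
     (((ccoord c0 \o sig) \o star br (- x)) x).
    by rewrite /= (starNx brP) s0; exact: smooth_left.
  have q2 := smooth_at_comp q1 sl; apply: smooth_at_eq q2.
  have H : nbhs x [set z | cdom c0 (sig (star br (- x) z))].
    have c1 := smooth_at_continuous (smooth_at_star brP (- x) x).
    have H1 : nbhs (star br (- x) x) [set z | cdom c0 (sig z)].
      rewrite (starNx brP).
      have H0 : nbhs (sig 0) (cdom c0) by rewrite s0; exact: nbhs_cdom.
      by apply: (sig_cont 0 _ _ H0); rewrite normr0.
    exact: (c1 _ H1).
  near=> z; rewrite /= coordK; last by near: z; exact: H.
  by congr (ccoord _ _); apply/esym; near: z; exact: s_near.
- move=> p u /=.
  rewrite -(near_eq_derive u (Psi_chart p)).
  have D1 := is_derive_comp (smooth_at_derivable (v := u) (sleft p))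
    (smooth_at_differentiable (sphi' p)).
  have dp (w : 'rV[R]_m) : 'D_w (phi \o cparam c0) ((ccoord c0 \o lmul (linv p) \o
      cparam (chart_at p)) (ccoord (chart_at p) p)) = w.
    by rewrite /= coordK ?lmulVg; [exact: dphi|exact: mem_chart_at].
  have D2 := eq_ind _ (fun z => is_derive _ _ _ z) D1 _ (dp _).
  apply: (etrans (@derive_val _ _ _ _ _ _ _ (is_derive_star (Psi p) D2))).
  have -> : tangent_map (lmul (linv p)) p u = 'D_u (ccoord c0 \o lmul (linv p)
      \o cparam (chart_at p)) (ccoord (chart_at p) p).
    by rewrite /tangent_map lmulVg.
  by [].
Unshelve. all: by end_near. Qed.
End Flat.

(** * The hyperbolic form and the isometry *)

Section NAlgebra.
Context {R : realType} {V : vectType R} (ip : {dot V for idfun}).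
Context (rho : {linear V -> 'End(V)}).
Hypothesis rho_skew : forall u, skew_endo ip (rho u).
Hypothesis rho_alt : forall u v, rho u v + rho v u = 0.
Implicit Types x y z : nalg V.
Local Notation nbr := (nbracket ip rho).

Lemma dot_sym u v : ip u v = ip v u.
Proof. by rewrite hermC /= mul1r. Qed.

Lemma nbracket1E x y w : (nbr x y).1 w = ip (rho w x.2) y.2.
Proof.
have lin : linear (fun w : V => ip (rho w x.2) y.2 : R^o).
  by move=> a u v; rewrite linearP add_lfunE scale_lfunE linearPl.
exact: (lfunE (lin_of lin)).
Qed.

Lemma nbracket_eq x y z : (forall w, ip (rho w x.2) y.2 = z.1 w) -> z.2 = 0 ->
  nbr x y = z.
Proof.
case: z => z1 z2 /= H ->; congr (_, _); apply/lfunP => w.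
by rewrite -H -nbracket1E.
Qed.

Lemma nbracket_linearl y : linear (nbr^~ y).
Proof.
move=> a x z; apply: nbracket_eq => [w|] /=; last by rewrite scaler0 addr0.
rewrite add_lfunE scale_lfunE !nbracket1E linearP linearDl linearZl_LR.
by [].
Qed.

Lemma nbracket_linearr x : linear (nbr x).
Proof.
move=> a y z; apply: nbracket_eq => [w|] /=; last by rewrite scaler0 addr0.
by rewrite add_lfunE scale_lfunE !nbracket1E linearDr linearZr_LR.
Qed.

Lemma nbracketxx x : nbr x x = 0.
Proof.
apply: nbracket_eq => //= w; rewrite zero_lfunE.
have := rho_skew w x.2 x.2; rewrite (dot_sym x.2) => /eqP.
by rewrite -addr_eq0 -mulr2n mulrn_eq0 => /eqP.
Qed.

(** Alternation makes [x.2] the index of [rho] in both terms; skew-symmetry of [rho x.2] then makes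
    them opposite. *)
Lemma hyperbolic_ad_invariant x y z :
  hyperbolic (nbr x y) z + hyperbolic y (nbr x z) = 0.
Proof.
rewrite /hyperbolic !nbracket1E /= !linear0 addr0 add0r.
have alt u v : rho u v = - rho v u by apply/eqP; rewrite -addr_eq0 rho_alt.
have ipN (u v : V) : ip (- u) v = - ip u v by exact: linearNl.
by rewrite !(alt _ x.2) !ipN rho_skew opprK (dot_sym z.2) addrN.
Qed.

Lemma hyperbolic_isotropic x y z w : hyperbolic (nbr x y) (nbr z w) = 0.
Proof. by rewrite /hyperbolic /= !linear0 addr0. Qed.

Lemma hyperbolic_flat (c : R) x y z :
  hyperbolic (y + c *: nbr x y) (z + c *: nbr x z) = hyperbolic y z.
Proof.
have hD (u v w t : nalg V) : hyperbolic (u + c *: v) (w + c *: t) =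
    hyperbolic u w + c * (hyperbolic v w + hyperbolic u t) + c * c * hyperbolic v t.
  rewrite /hyperbolic /= !add_lfunE !scale_lfunE !linearD !linearZ_LR /=.
  rewrite /GRing.scale /=; ring.
by rewrite hD hyperbolic_ad_invariant hyperbolic_isotropic !mulr0 !addr0.
Qed.

(** [nbracket] reads only the second components of its arguments and its values have second
    component 0; [P] forgets the first component, read through [psi]. *)
Lemma nalg_two_step {m} (N : lieGroup R m) (psi : {linear 'rV[R]_m -> nalg V}) :
    lie_algebra_identification N nbr psi ->
  exists P : {linear 'rV[R]_m -> 'rV[R]_m}, two_step_bracket (lie_bracket N) P.
Proof.
move=> [[g psiK gK]]; move: (lie_bracket N) => br psi_br.
have psi_inj : injective psi := can_inj psiK.
have g_lin : linear g.
  by move=> a x y; apply: psi_inj; rewrite linearP !gK.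
have P_lin : linear (fun x : 'rV[R]_m => g ((0, (psi x).2) : nalg V)).
  move=> a x y; rewrite -g_lin; congr g.
  by rewrite linearP; congr (_, _); rewrite /= scaler0 addr0.
exists (lin_of P_lin); split.
- by move=> y a u v; apply: psi_inj; rewrite linearP !psi_br linearP nbracket_linearl.
- by move=> y a u v; apply: psi_inj; rewrite linearP !psi_br linearP nbracket_linearr.
- by move=> x; apply: psi_inj; rewrite psi_br nbracketxx linear0.
- move=> x y /=; rewrite psi_br /=; exact: (linear0 (lin_of g_lin)).
- by move=> x y; apply: psi_inj; rewrite !psi_br /= gK.
Qed.

Lemma hyperbolic_star {m} (N : lieGroup R m) (psi : {linear 'rV[R]_m -> nalg V})
    (c : R) (a w w' : 'rV[R]_m) :
    lie_algebra_identification N nbr psi ->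
  hyperbolic (psi (w + c *: lie_bracket N a w)) (psi (w' + c *: lie_bracket N a w')) =
  hyperbolic (psi w) (psi w').
Proof.
move=> [_]; move: (lie_bracket N) => br psi_br.
by rewrite !linearD !linearZ_LR !psi_br hyperbolic_flat.
Qed.

End NAlgebra.

(** * Maps that are linear in logarithmic coordinates *)

Section Isometry.
Context {R : realType} {m n : nat} (M : manifold R m) (N : manifold R n).
Context (J : {linear 'rV[R]_m -> 'rV[R]_n}).
Context (Psi : M -> 'rV[R]_m) (Psi' : N -> 'rV[R]_n) (s : 'rV[R]_n -> N).
Hypothesis Psi_cont : continuous Psi.
Hypothesis s_cont : continuous s.
Hypothesis sPsi : forall p, smooth_at (Psi \o cparam (chart_at p)) (ccoord (chart_at p) p).
Hypothesis ss : forall x, smooth_at (ccoord (chart_at (s x)) \o s) x.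
Let f p := s (J (Psi p)).

Lemma linear_transfer_smooth : smooth_map f.
Proof.
apply: smooth_mapP.
  move=> p; apply: (@continuous_comp _ _ _ (J \o Psi) s); last exact: s_cont.
  apply: (@continuous_comp _ _ _ Psi J); first exact: Psi_cont.
  exact: rV_linear_continuous.
move=> p; have q1 := smooth_at_linear_comp J (sPsi p).
have q2 : smooth_at (ccoord (chart_at (f p)) \o s)
    ((J \o (Psi \o cparam (chart_at p))) (ccoord (chart_at p) p)).
  by rewrite /= coordK; [exact: ss|exact: mem_chart_at].
exact: smooth_at_comp q1 q2.
Qed.

Hypothesis sPsi' : forall p, smooth_at (Psi' \o cparam (chart_at p)) (ccoord (chart_at p) p).
Hypothesis sK : cancel s Psi'.

(** The derivative of [Psi' \o f = J \o Psi], which holds because [s] is inverted by [Psi']. *)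
Lemma linear_transfer_derive p u :
  'D_(tangent_map f p u) (Psi' \o cparam (chart_at (f p))) (ccoord (chart_at (f p)) (f p)) =
  J ('D_u (Psi \o cparam (chart_at p)) (ccoord (chart_at p) p)).
Proof.
have H1 := smooth_map_at linear_transfer_smooth (mem_chart_at p) (mem_chart_at (f p)).
have H2 : smooth_at (Psi' \o cparam (chart_at (f p)))
   ((ccoord (chart_at (f p)) \o f \o cparam (chart_at p)) (ccoord (chart_at p) p)).
  by rewrite /= coordK; [exact: sPsi'|exact: mem_chart_at].
have D1 := is_derive_comp (smooth_at_derivable (v := u) H1)
  (smooth_at_differentiable H2).
have D2 := is_derive_linear J (derivableP (smooth_at_derivable (v := u) (sPsi p))).
have E : {near ccoord (chart_at p) p,
    (Psi' \o cparam (chart_at (f p))) \o (ccoord (chart_at (f p)) \o f \o cparam (chart_at p))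
    =1 J \o (Psi \o cparam (chart_at p))}.
  near=> x; rewrite /= coordK; first by rewrite /f sK.
  near: x; apply: (near_param (mem_chart_at p) (A := [set q | cdom (chart_at (f p)) (f q)])).
  apply: linear_transfer_smooth.1; exact: nbhs_cdom (mem_chart_at _).
have := etrans (esym (@derive_val _ _ _ _ _ _ _ D1))
  (etrans (near_eq_derive u E) (@derive_val _ _ _ _ _ _ _ D2)).
by move=> <-; rewrite /= coordK//; exact: mem_chart_at.
Unshelve. all: by end_near. Qed.

End Isometry.

Theorem theorem5p6 (R : realType) (V : vectType R) (ip : {dot V for idfun})
    (rho rho' : {linear V -> 'End(V)})
    (rho_inj : injective rho) (rho'_inj : injective rho')
    (rho_skew : forall u, skew_endo ip (rho u))
    (rho'_skew : forall u, skew_endo ip (rho' u))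
    (rho_alt : forall u v, rho u v + rho v u = 0)
    (rho'_alt : forall u v, rho' u v + rho' v u = 0)
    (m m' : nat) (N : lieGroup R m) (N' : lieGroup R m')
    (N_sc : simply_connected R N) (N'_sc : simply_connected R N')
    (psi : {linear 'rV[R]_m -> nalg V}) (psi' : {linear 'rV[R]_m' -> nalg V})
    (psi_lie : lie_algebra_identification N (nbracket ip rho) psi)
    (psi'_lie : lie_algebra_identification N' (nbracket ip rho') psi') :
  isometric (left_metric N psi (@hyperbolic R V))
            (left_metric N' psi' (@hyperbolic R V)).
Proof.
have [P brP] := nalg_two_step rho_skew psi_lie.
have [P' brP'] := nalg_two_step rho'_skew psi'_lie.
have [Psi [s [[PsiK sK Psi_cont s_cont] [Psi_smooth s_smooth Psi_D]]]] :=
  flat_coordinates brP N_sc.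
have [Psi' [s' [[Psi'K s'K Psi'_cont s'_cont] [Psi'_smooth s'_smooth Psi'_D]]]] :=
  flat_coordinates brP' N'_sc.
have [[g psiK gK] psi_br] := psi_lie.
have [[g' psi'K g'K] psi'_br] := psi'_lie.
(* The logarithms are matched through the common space [nalg V]. The resulting linear map preserves
   the hyperbolic forms by construction, while the two brackets may differ. *)
have J_lin : linear (g' \o psi).
  by move=> a x y; apply: (can_inj psi'K); rewrite linearP /= !g'K linearP.
have J'_lin : linear (g \o psi').
  by move=> a x y; apply: (can_inj psiK); rewrite linearP /= !gK linearP.
pose J : {linear 'rV[R]_m -> 'rV[R]_m'} := lin_of J_lin.
pose J' : {linear 'rV[R]_m' -> 'rV[R]_m} := lin_of J'_lin.
exists (fun p => s' (J (Psi p))); split.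
  split; first exact: linear_transfer_smooth.
  exists (fun p => s (J' (Psi' p))); split; first exact: linear_transfer_smooth.
    by move=> p; rewrite s'K /= g'K psiK PsiK.
  by move=> p; rewrite sK /= gK psi'K Psi'K.
move=> p u v; rewrite /left_metric; set f := fun p => _.
(* The left-invariant metric of [N] is rewritten as the constant form evaluated on the differential
   of the logarithm; [hN'] does the same for [N'] at [f p]. *)
have hN w w' : hyperbolic (psi (tangent_map (lmul (linv p)) p w))
    (psi (tangent_map (lmul (linv p)) p w')) =
    hyperbolic (psi ('D_w (Psi \o cparam (chart_at p)) (ccoord (chart_at p) p)))
      (psi ('D_w' (Psi \o cparam (chart_at p)) (ccoord (chart_at p) p))).
  apply: (etrans (esym (hyperbolic_star rho_skew rho_alt 2^-1 (Psi p) _ _ psi_lie))).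
  exact: (f_equal2 (fun a b => hyperbolic (psi a) (psi b))
    (esym (Psi_D p w)) (esym (Psi_D p w'))).
have hN' w w' : hyperbolic (psi' (tangent_map (lmul (linv (f p))) (f p) w))
    (psi' (tangent_map (lmul (linv (f p))) (f p) w')) =
    hyperbolic (psi' ('D_w (Psi' \o cparam (chart_at (f p))) (ccoord (chart_at (f p)) (f p))))
      (psi' ('D_w' (Psi' \o cparam (chart_at (f p))) (ccoord (chart_at (f p)) (f p)))).
  apply: (etrans (esym (hyperbolic_star rho'_skew rho'_alt 2^-1 (Psi' (f p)) _ _ psi'_lie))).
  exact: (f_equal2 (fun a b => hyperbolic (psi' a) (psi' b))
    (esym (Psi'_D (f p) w)) (esym (Psi'_D (f p) w'))).
rewrite hN' hN.
(* In these coordinates the differential of [f] is [J], and [psi' \o J = psi]. *)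
have D := linear_transfer_derive J Psi_cont s'_cont Psi_smooth s'_smooth Psi'_smooth s'K p.
apply: (etrans (f_equal2 (fun a b => hyperbolic (psi' a) (psi' b)) (D u) (D v))).
by rewrite /= !g'K.
Qed.
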